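(* Let $\gamma\in(0,1)$, $S=[-\frac\pi2,\frac\pi2]$, $\theta_0\in(0,\frac\pi2)$, $S_0=[-\theta_0,\theta_0]$, let $\mathcal K$ be a Markov kernel on $S$, and let $\zeta=(\zeta_n)_{n\ge0}$, $\zeta_n=(Z_n,\chi_n,\alpha_n)$, be the stochastic billiards collisions process in $\mathcal D_\gamma$ with reflection kernel $\mathcal K$, as constructed in the context. Suppose: (B1) $\mathcal K(\alpha,S_0)=1$ for all $\alpha\in S$. (B2) There is a bounded measurable $\kappa:S^2\to[0,\infty)$ with $\mathcal K(\alpha,B)=\int_B\kappa(\alpha,\beta)\,d\beta$ for all $\alpha \in S$ and Borel $B\subseteq S$, and $\kappa$ is uniformly equicontinuous in each argument: for any $\varepsilon>0$ there is $\delta>0$ such that $\sup_{\alpha\in S}|\kappa(\alpha,\beta)-\kappa(\alpha,\beta')|\le\varepsilon$ whenever $\beta,\beta'\in S$, $|\beta-\beta'|\le\delta$, and $\sup_{\beta\in S}|\kappa(\alpha,\beta)-\kappa(\alpha',\beta)|\le\varepsilon$ whenever $\alpha,\alpha'\in S$, $|\alpha-\alpha'|\le\delta$. (B3) There is $\varepsilon>0$ with $\mathcal K(\alpha,[\varepsilon,\frac\pi2])\ge\varepsilon$ for all $\alpha\in S$. (B4) $\mathcal K$ has a unique invariant probability measure $\mu$, whose density is denoted $\varpi$. (B5) $\kappa'(\alpha,\beta):=\frac{\partial}{\partial\beta}\kappa(\alpha,\beta)$ and $\kappa''(\alpha,\beta):=\frac{\partial^2}{\partial\beta^2}\kappa(\alpha,\beta)$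 exist, are continuous in each argument, and are bounded uniformly for all $\alpha,\beta\in S$. For $k\in\{1,2\}$ put $\rho_k(\alpha):=\int_S\kappa(\alpha,\beta)\tan^k\beta\,d\beta$ and $\bar\rho_k:=\int_S\varpi(\beta)\tan^k\beta\,d\beta$, and suppose $\bar\rho_1=0$. Then there exists $\psi_0\in C_b(S)$, unique up to translation (addition of constants), with $\int_S(\psi_0(\alpha)-\psi_0(\beta))\kappa(\alpha,\beta)\,d\beta=2\rho_1(\alpha)$ for all $\alpha\in S$. Let $$A_1:=\int_S\psi_0(\beta)\varpi(\beta)\tan\beta\,d\beta,\qquad A_2:=\int_S\psi_0(\beta)\varpi'(\beta)\,d\beta.$$ Then $A_1+\bar\rho_2\ge0$. Suppose moreover that $$1+A_1-A_2+2\bar\rho_2\ge0\quad\text{and}\quad\max\{A_1+\bar\rho_2,\ 1+A_1-A_2+2\bar\rho_2\}>0,$$ and define $$\gamma_{\mathrm c}:=\Big(\frac{A_1+\bar\rho_2}{1+A_1-A_2+2\bar\rho_2}\Big)\wedge1$$ (where a positive number divided by $0$ is $\infty$ and $\infty\wedge1=1$). Then $\gamma_{\mathrm c}\in[0,1]$, and $\zeta$ is transient if $\gamma_{\mathrm c}<\gamma<1$ and recurrent if $0<\gamma<\gamma_{\mathrm c}$. Moreover, if, in addition, $\lim_{n\to\infty}\sup_{\alpha\in S}\|\mathcal K^n(\alpha,\cdot)-\mu(\cdot)\|_{\mathrm{TV}}=0$, then one may take $\psi_0$ defined by $$\psi_0(\alpha)=2\sum_{n=0}^\infty\int_S\mathcal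 K^n(\alpha,d\beta)\rho_1(\beta)=2\sum_{n=1}^\infty\int_S\mathcal K^n(\alpha,d\beta)\tan\beta.$$
   Context: Domain and geometry. $\mathcal D_\gamma=\{(x,y)\in[0,\infty)\times\mathbb R:|y|\le x^\gamma\}$, with boundary $\partial\mathcal D_\gamma=\{(z,jz^\gamma):z\ge0,\ j\in\{-1,+1\}\}$. Set $\theta(0)=\frac\pi2$ and $\theta(z)=\arctan(\gamma z^{\gamma-1})$ for $z>0$ (magnitude of the angle between the inward normal at $(z,jz^\gamma)$ and the vertical). For $z\ge0$, $j\in\{-1,+1\}$, $\beta\in S$, $t>0$ let $\ell_t(z,j,\beta)=(z,jz^\gamma)+t\,(\sin(\theta(z)+\beta),\,-j\cos(\theta(z)+\beta))$ (the ray leaving $(z,jz^\gamma)$ at angle $\beta$ to the inward normal). Let $\lambda(z,j,\beta)=\inf\{t>0:\ell_t(z,j,\beta)\in\partial\mathcal D_\gamma\}$ and $\Lambda(z,j,\beta)=(\Lambda_1,\Lambda_2)(z,j,\beta)=\ell_{\lambda}(z,j,\beta)$ if $\lambda=\lambda(z,j,\beta)<\infty$, $\Lambda=(0,0)$ otherwise. With $\mathrm{sgn}(x)=1$ if $x\ge0$ and $-1$ if $x<0$, define for $z>0$: $\Theta(z,j,\beta)=\beta+\theta(z)+\theta(\Lambda_1(z,j,\beta))$ if $j\Lambda_2(z,j,\beta)<0$, and $\Theta(z,j,\beta)=\mathrm{sgn}(\beta)\pi-\beta-\theta(z)+\theta(\Lambda_1(z,j,\beta))$ otherwise; and $\Theta(0,j,\beta)=\frac\pi2-|\beta|+\theta(\Lambda_1(0,j,\beta))$.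 Collisions process. $\zeta_n=(Z_n,\chi_n,\alpha_n)\in[0,\infty)\times\{-1,+1\}\times S$ is the Markov chain with arbitrary initial state (with $\chi_0=1$ if $Z_0=0$) and the following dynamics. Given $\zeta_n$: if $Z_n>0$, draw an outgoing angle $\beta_n$ from $\mathcal K(\alpha_n,\cdot)$ (using an independent uniform random input $U_n$ at each step); if $Z_n=0$, take $\beta_n$ uniform on $S_0$. Then set $Z_{n+1}=\Lambda_1(Z_n,\chi_n,\beta_n)$, $\chi_{n+1}=\mathrm{sgn}(\Lambda_2(Z_n,\chi_n,\beta_n))$, $\alpha_{n+1}=\Theta(Z_n,\chi_n,\beta_n)$. (Here $Z_n$ is the horizontal coordinate of the collision point, $\chi_n$ the sign of the vertical coordinate, $\alpha_n$ the incoming angle.) Definitions. $\zeta$ is transient if $\lim_{n\to\infty}Z_n=\infty$ a.s., and recurrent if $\liminf_{n\to\infty}Z_n<\infty$ a.s. A measure $\mu$ is invariant for $\mathcal K$ if $\mu(B)=\int_S\mu(d\alpha)\mathcal K(\alpha,B)$ for all Borel $B\subseteq S$; under (B2) every invariant measure has a density, with $\varpi(\beta)=\int_S\varpi(\alpha)\kappa(\alpha,\beta)\,d\alpha$. Under (B5) $\varpi$ is differentiable with $\varpi'(\beta)=\int_S\kappa'(\alpha,\beta)\varpi(\alpha)\,d\alpha$. $C_b(S)$ is the set of continuous real functions on $S$. $\mathcal K^n$ is the $n$-fold convolution: $\mathcal K^0(\alpha,B)=\mathbf 1\{\alpha\in B\}$, $\mathcal K^n(\alpha,B)=\int_S\mathcal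 K(\alpha,d\beta)\mathcal K^{n-1}(\beta,B)$. $\|\cdot\|_{\mathrm{TV}}$ is the total variation norm. *)

(* Defs.v *)
From HB Require Import structures.
From mathcomp Require Import all_boot all_order all_algebra.
From mathcomp Require Import all_classical all_reals all_analysis.

Set Implicit Arguments.
Unset Strict Implicit.
Unset Printing Implicit Defensive.
Import Order.TTheory GRing.Theory Num.Theory.
Import numFieldNormedType.Exports.

Local Open Scope classical_set_scope.
Local Open Scope ring_scope.

Section Geometry.
Context {R : realType}.
Implicit Types (gamma z t alpha beta : R).

(* j ranges over {-1, 1}, encoded as elements of R. *)
Definition is_sign (j : R) : Prop := j = -1 \/ j = 1.

Definition sgn (x : R) : R := if 0 <= x then 1 else -1.

Definition boundary gamma : set (R * R) :=
  [set p | exists z j, [/\ 0 <= z, is_sign j & p = (z, j * z `^ gamma)]].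

Definition theta gamma z : R :=
  if z == 0 then pi / 2 else atan (gamma * z `^ (gamma - 1)).

Definition ray gamma z j beta t : R * R :=
  (z + t * sin (theta gamma z + beta),
   j * z `^ gamma + t * (- j * cos (theta gamma z + beta))).

(* +oo when the ray never meets the boundary again. *)
Definition hit_time gamma z j beta : \bar R :=
  ereal_inf
    [set t%:E | t in [set t | 0 < t /\ boundary gamma (ray gamma z j beta t)]].

Definition hit_point gamma z j beta : R * R :=
  if (hit_time gamma z j beta < +oo)%E
  then ray gamma z j beta (fine (hit_time gamma z j beta))
  else (0, 0).

Definition in_angle gamma z j beta : R :=
  let L := hit_point gamma z j beta in
  if z == 0 then pi / 2 - `|beta| + theta gamma L.1
  else if j * L.2 < 0 then beta + theta gamma z + theta gamma L.1
  else sgn beta * pi - beta - theta gamma z + theta gamma L.1.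

End Geometry.

Section Kernels.
Context {R : realType}.
Local Notation leb := (@lebesgue_measure R).

Definition Sang : set R := `[- (pi / 2), pi / 2].

Definition Sang0 (theta0 : R) : set R := `[- theta0, theta0].

(* A Markov kernel on S = Sang is encoded as a probability kernel K on R with
   K alpha S = 1 for alpha in S; the values of K alpha for alpha outside S are
   irrelevant. Functions and probability measures on S are likewise encoded as
   functions on R, used only on S, and probability measures on R carried by
   S. *)
Definition markov_on_S (K : R.-pker R ~> R) : Prop :=
  forall alpha, Sang alpha -> K alpha Sang = 1%E.

(* Derivatives are taken relative to S, hence one-sided at its endpoints. *)
Definition quotientS (f : R -> R) (x y : R) : R := (f y - f x) / (y - x).

Definition derivableS (f : R -> R) (x : R) : Prop :=
  cvg (quotientS f x y @[y --> within Sang x^']).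

Definition deriveS (f : R -> R) (x : R) : R :=
  lim (quotientS f x y @[y --> within Sang x^']).

Definition hypB1 (theta0 : R) (K : R.-pker R ~> R) : Prop :=
  forall alpha, Sang alpha -> K alpha (Sang0 theta0) = 1%E.

Record hypB2 (K : R.-pker R ~> R) (kappa : R -> R -> R) : Prop := {
  kappa_ge0 : forall alpha beta, Sang alpha -> Sang beta -> 0 <= kappa alpha beta ;
  kappa_bounded : exists M : R,
    forall alpha beta, Sang alpha -> Sang beta -> kappa alpha beta <= M ;
  kappa_measurable :
    measurable_fun (Sang `*` Sang) (fun p : R * R => kappa p.1 p.2) ;
  kappa_density : forall alpha B, Sang alpha -> measurable B -> B `<=` Sang ->
    K alpha B = (\int[leb]_(beta in B) (kappa alpha beta)%:E)%E ;
  kappa_equicontinuous : forall eps : R, 0 < eps ->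
    exists delta : R, [/\ 0 < delta,
      forall beta beta', Sang beta -> Sang beta' -> `|beta - beta'| <= delta ->
        forall alpha, Sang alpha ->
          `|kappa alpha beta - kappa alpha beta'| <= eps &
      forall alpha alpha', Sang alpha -> Sang alpha' -> `|alpha - alpha'| <= delta ->
        forall beta, Sang beta ->
          `|kappa alpha beta - kappa alpha' beta| <= eps]
}.

Definition hypB3 (K : R.-pker R ~> R) : Prop :=
  exists2 eps : R, 0 < eps &
    forall alpha, Sang alpha -> (eps%:E <= K alpha [set x | eps <= x <= pi / 2]%R)%E.

Definition invariant_prob (K : R.-pker R ~> R) (mu : probability R R) : Prop :=
  mu Sang = 1%E /\
  forall B, measurable B -> B `<=` Sang ->
    mu B = (\int[mu]_(alpha in Sang) K alpha B)%E.

Definition hypB4 (K : R.-pker R ~> R) (mu : probability R R) : Prop :=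
  invariant_prob K mu /\
  forall nu : probability R R, invariant_prob K nu ->
    forall B, measurable B -> nu B = mu B.

(* The last clause selects, among the almost everywhere equal densities of mu,
   the version defined at every point of S. *)
Record invariant_density (kappa : R -> R -> R) (mu : probability R R)
    (varpi : R -> R) : Prop := {
  varpi_ge0 : forall beta, Sang beta -> 0 <= varpi beta ;
  varpi_measurable : measurable_fun Sang varpi ;
  varpi_density : forall B, measurable B -> B `<=` Sang ->
    mu B = (\int[leb]_(beta in B) (varpi beta)%:E)%E ;
  varpi_stationary : forall beta, Sang beta ->
    varpi beta = \int[leb]_(alpha in Sang) (varpi alpha * kappa alpha beta)
}.

Definition bounded_continuous2 (g : R -> R -> R) : Prop :=
  [/\ forall alpha, Sang alpha -> {within Sang, continuous (g alpha)},
      forall beta, Sang beta -> {within Sang, continuous (fun alpha => g alpha beta)} &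
      exists M : R, forall alpha beta, Sang alpha -> Sang beta ->
        `|g alpha beta| <= M].

Record hypB5 (kappa : R -> R -> R) : Prop := {
  kappa_derivable : forall alpha beta, Sang alpha -> Sang beta ->
    derivableS (kappa alpha) beta ;
  kappa_derivable2 : forall alpha beta, Sang alpha -> Sang beta ->
    derivableS (deriveS (kappa alpha)) beta ;
  kappa'_regular : bounded_continuous2 (fun alpha => deriveS (kappa alpha)) ;
  kappa''_regular :
    bounded_continuous2 (fun alpha => deriveS (deriveS (kappa alpha)))
}.

(* tan (+- pi / 2) = 0 in the library; the endpoints of S are negligible. *)
Definition rho (kappa : R -> R -> R) (k : nat) (alpha : R) : R :=
  \int[leb]_(beta in Sang) (kappa alpha beta * tan beta ^+ k).

Definition rhobar (varpi : R -> R) (k : nat) : R :=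
  \int[leb]_(beta in Sang) (varpi beta * tan beta ^+ k).

(* Boundedness is automatic since S is compact. *)
Definition CbS (psi : R -> R) : Prop := {within Sang, continuous psi}.

Definition poisson_eq (kappa : R -> R -> R) (psi : R -> R) : Prop :=
  forall alpha, Sang alpha ->
    \int[leb]_(beta in Sang) ((psi alpha - psi beta) * kappa alpha beta) =
    2 * rho kappa 1 alpha.

Definition A1 (varpi psi : R -> R) : R :=
  \int[leb]_(beta in Sang) (psi beta * varpi beta * tan beta).

Definition A2 (varpi psi : R -> R) : R :=
  \int[leb]_(beta in Sang) (psi beta * deriveS varpi beta).

Definition gamma_den (varpi psi : R -> R) : R :=
  1 + A1 varpi psi - A2 varpi psi + 2 * rhobar varpi 2.

(* A positive number divided by 0 is infinite, and its minimum with 1 is 1. *)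
Definition gamma_c (varpi psi : R -> R) : R :=
  if gamma_den varpi psi == 0 then 1
  else Num.min ((A1 varpi psi + rhobar varpi 2) / gamma_den varpi psi) 1.

(* K^n = K o K^(n-1); since K alpha S = 1 for alpha in S, the integral over R
   in the composition of kernels is an integral over S. *)
Fixpoint kpow (K : R.-pker R ~> R) (n : nat) : R.-spker R ~> R :=
  if n is m.+1 then mkcomp_noparam K (kpow K m)
  else kdirac (@measurable_id _ R setT).

(* Total variation distance of two probability measures on S, normalised so as
   to be at most 1 (half the total mass of the variation of the difference). *)
Definition tv_dist (m1 m2 : set R -> \bar R) : \bar R :=
  ereal_sup [set `|m1 B - m2 B|%E | B in [set B | measurable B /\ B `<=` Sang]].

Definition uniformly_ergodic (K : R.-pker R ~> R) (mu : probability R R) : Prop :=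
  ereal_sup [set tv_dist (kpow K n alpha) mu | alpha in Sang]
    @[n --> \oo] --> 0%E.

Definition psi_term (K : R.-pker R ~> R) (kappa : R -> R -> R) (alpha : R)
  : R^nat := fun n => \int[kpow K n alpha]_(beta in Sang) rho kappa 1 beta.

Definition tan_term (K : R.-pker R ~> R) (alpha : R) : R^nat :=
  fun n => \int[kpow K n.+1 alpha]_(beta in Sang) tan beta.

End Kernels.

Section Process.
Context {R : realType}.

(* A state (z, chi, alpha). *)
Local Notation state := (R * R * R)%type.

Definition state_space : set state :=
  [set s | [/\ 0 <= s.1.1, is_sign s.1.2, Sang s.2 & s.1.1 = 0 -> s.1.2 = 1]].

Definition step (gamma : R) (s : state) (beta : R) : state :=
  let L := hit_point gamma s.1.1 s.1.2 beta in
  (L.1, sgn L.2, in_angle gamma s.1.1 s.1.2 beta).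

Definition out_law (theta0 : R) (K : R.-pker R ~> R) (s : state) (B : set R)
  : \bar R :=
  if 0 < s.1.1 then K s.2 B
  else (\int[lebesgue_measure]_(x in B)
          (uniform_pdf (- theta0) theta0 x)%:E)%E.

Context {d : measure_display} {Omega : measurableType d}.

(* The sigma-algebra generated by zeta_0, ..., zeta_n. *)
Definition past (zeta : nat -> Omega -> state) (n : nat) : set (set Omega) :=
  <<s [set H | exists i A, [/\ (i <= n)%N, measurable A & H = zeta i @^-1` A]] >>.

(* beta n is the angle used to leave zeta n: given zeta_0, ..., zeta_n, its
   conditional law is out_law (zeta n). *)
Record collisions_process (gamma theta0 : R) (K : R.-pker R ~> R)
    (P : probability Omega R) (zeta : nat -> Omega -> state)
    (beta : nat -> Omega -> R) : Prop := {
  zeta_measurable : forall n, measurable_fun setT (zeta n) ;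
  beta_measurable : forall n, measurable_fun setT (beta n) ;
  zeta_init : forall w, state_space (zeta 0%N w) ;
  beta_law : forall n H B, past zeta n H -> measurable B ->
    P (H `&` beta n @^-1` B) =
    (\int[P]_(w in H) out_law theta0 K (zeta n w) B)%E ;
  zeta_step : forall n w, zeta n.+1 w = step gamma (zeta n w) (beta n w)
}.

Definition transient (P : probability Omega R) (zeta : nat -> Omega -> state)
  : Prop := {ae P, forall w, (zeta n w).1.1 @[n --> \oo] --> +oo}.

Definition recurrent (P : probability Omega R) (zeta : nat -> Omega -> state)
  : Prop :=
  {ae P, forall w, (limn_einf (fun n => ((zeta n w).1.1)%:E) < +oo)%E}.

End Process.

(* Main.v *)
Require Import Defs.
From HB Require Import structures.
From mathcomp Require Import all_boot all_order all_algebra.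
From mathcomp Require Import all_classical all_reals all_analysis measurable_realfun.
From mathcomp Require Import ring lra.

Set Implicit Arguments.
Unset Strict Implicit.
Unset Printing Implicit Defensive.
Import Order.TTheory GRing.Theory Num.Theory.
Import numFieldNormedType.Exports.

Local Open Scope classical_set_scope.
Local Open Scope ring_scope.

(** Put [w = z ^ (g - 1)], the relative width of the domain at abscissa [z]. Far out,
    where [w] is small, a collision that leaves at angle [b] multiplies the abscissa
    by [exp (w * v)] with [v] close to [2 * tan b], and the next incoming angle
    exceeds [b] by about [2 * g * w]. Thus [ln z] is driven by the chain of angles,
    with increments of order [w] and of mean zero in the stationary regime, and its
    long-run behaviour is decided at the second order.

    The solution [psi] of the Poisson equation cancels the first order: with a second
    corrector [psi1], the function [z ^ nu * (1 + nu * w * psi + nu * w ^ 2 * psi1)]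
    of the state has mean one-step change [z ^ nu * w ^ 2 * nu * (Bbar + o(1))], where
    [Bbar] does not depend on the angle ([drift_expansion]) and equals
    [2 * (g * den - (1 - nu) * num)], where [num = A1 + rhobar 2] and
    [den = gamma_den] form the ratio in [gamma_c] ([drift_mean]). If [g * den < num], a small [nu > 0] gives a
    supermartingale that would have to tend to infinity along an escaping path, so
    the process is recurrent ([recurrent_of_supermartingale]). If [num < g * den], a
    small [nu < 0] gives a supermartingale that is small far out and large below a
    given level, so that returns from far away are unlikely; together with the almost
    sure visit of all levels ([escape]) this gives transience
    ([transient_of_supermartingale]).

    The delicate term is the mean of [psi] at the next incoming angle, because [psi]
    is merely continuous and cannot be expanded. Both the outgoing angle and the next
    incoming angle are smooth increasing functions of the exit parameter [v]; changing
    variables from the one to the other moves the shift of the angle onto the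
    density, which is twice differentiable ([alphaw_shift]). The derivative that
    appears is the one in [A2], after an exchange of integrals ([A2E]).

    Both correctors come from the Fredholm alternative for the compact operator
    [Top] of the kernel: a right-hand side of mean zero is solvable
    ([poisson_exists]) because bounded harmonic functions are constant
    ([harmonic_cst]), which in turn expresses the uniqueness of the invariant
    probability. The quantity [num] is nonnegative as a multiple of a mean conditional
    variance ([A1_rho2_ge0]), and under uniform ergodicity the series for [psi] telescopes
    ([poisson_eq_series]).

    For the process itself, the strict convexity of the domain shows that a ray meets
    the boundary at most once more ([hit_unique]), so that exhibiting a point of the
    ray on the boundary identifies the collision. The conditional law of the outgoing
    angle given the past enters through [joint_law_integral], and all martingale
    arguments are carried out on events of the past, without stopping times. *)

(** * Bounded measurable functions *)

Section Density.
Context {R : realType} {d : measure_display} {T : measurableType d}.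
Variables (m lam : {measure set T -> \bar R}) (D : set T) (p : T -> R).
Hypothesis mD : measurable D.
Hypothesis mp : measurable_fun D p.
Let mpE : measurable_fun D (EFin \o p). Proof. exact/measurable_EFinP. Qed.
Hypothesis p0 : forall x, D x -> 0 <= p x.
Hypothesis mE : forall B, measurable B -> B `<=` D ->
  m B = (\int[lam]_(x in B) (p x)%:E)%E.

Import HBNNSimple.

Let density_indic B : measurable B ->
  (\int[m]_(x in D) (\1_B x)%:E = \int[lam]_(x in D) ((\1_B x)%:E * (p x)%:E))%E.
Proof.
move=> mB; rewrite integral_indic// mE//; last exact: measurableI.
rewrite setIC integral_mkcondr; apply: eq_integral => x xD.
by rewrite patchE indicE; case: ifPn => xB; rewrite ?mul1e ?mul0e.
Qed.

Let density_nnsfun (f : {nnsfun T >-> R}) :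
  (\int[m]_(x in D) (f x)%:E = \int[lam]_(x in D) ((f x)%:E * (p x)%:E))%E.
Proof.
under [LHS]eq_integral do rewrite fimfunE -fsumEFin//.
rewrite [LHS]ge0_integral_fsum//; last 2 first.
  - by move=> r; apply/measurable_funTS/measurable_EFinP/measurableT_comp.
  - by move=> n x _; rewrite EFinM nnfun_muleindic_ge0.
under [RHS]eq_integral.
  move=> x /[!inE] xD; rewrite fimfunE -fsumEFin// ge0_mule_fsuml; last first.
    by move=> r; rewrite EFinM nnfun_muleindic_ge0.
  over.
rewrite [RHS]ge0_integral_fsum//; last 2 first.
  - move=> r; apply: emeasurable_funM => //.
    by apply/measurable_funTS/measurable_EFinP/measurableT_comp.
  - move=> n x xD; rewrite mule_ge0//; last by rewrite lee_fin p0.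
    by rewrite EFinM nnfun_muleindic_ge0.
apply: eq_fsbigr => r _.
rewrite integralZl_indic_nnsfun//= density_indic//.
have mB : measurable (f @^-1` [set r]) by exact: measurable_sfunP.
have mindic : measurable_fun D (fun x => (\1_(f @^-1` [set r]) x)%:E * (p x)%:E)%E.
  apply: emeasurable_funM => //.
  by apply/measurable_funTS/measurable_EFinP/measurable_indic.
have [r0|r0] := leP 0 r.
  rewrite -ge0_integralZl//.
  - by apply: eq_integral => x _; rewrite EFinM muleA.
  - by move=> x Dx; apply: mule_ge0; [rewrite lee_fin | rewrite lee_fin; exact: p0].
have fr0 : f @^-1` [set r] = set0 by rewrite preimage_nnfun0.
rewrite fr0 !integral0_eq ?mule0// => x _; rewrite indic0 ?mul0e//.
by rewrite mulr0 mul0e.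
Qed.

(** Both sides are limits along simple functions increasing to [G], for which the
    identity is the definition of a density. *)
Lemma integral_density (G : T -> \bar R) :
  measurable_fun D G -> (forall x, D x -> (0 <= G x)%E) ->
  (\int[m]_(x in D) G x = \int[lam]_(x in D) (G x * (p x)%:E))%E.
Proof.
move=> mG G0.
pose f_ := nnsfun_approx mD mG.
transitivity (lim (\int[m]_(x in D) (f_ n x)%:E @[n --> \oo])%E).
  rewrite -monotone_convergence//=.
  - apply: eq_integral => x /[!inE] xD; apply/esym/cvg_lim => //=.
    exact: cvg_nnsfun_approx.
  - by move=> n; apply/measurable_EFinP/measurable_funTS.
  - by move=> n x _; rewrite lee_fin.
  - by move=> x _ a b ab; rewrite lee_fin; exact/lefP/nd_nnsfun_approx.
transitivity (lim (\int[lam]_(x in D) ((f_ n x)%:E * (p x)%:E) @[n --> \oo])%E).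
  by congr (lim (_ @ \oo)); apply/funext => n; exact: density_nnsfun.
rewrite -monotone_convergence//=.
- apply: eq_integral => x /[!inE] xD; apply/cvg_lim => //=.
  rewrite muleC (_ : (fun n => _) = (fun n => (p x)%:E * (f_ n x)%:E)%E).
    by apply: cvgeZl => //; exact: cvg_nnsfun_approx.
  by apply/funext => n; rewrite muleC.
- move=> n; apply: emeasurable_funM => //.
  by apply/measurable_EFinP/measurable_funTS.
- by move=> n x xD; apply: mule_ge0; [rewrite lee_fin | rewrite lee_fin; exact: p0].
- move=> x xD a b ab; apply: lee_wpmul2r; first by rewrite lee_fin p0.
  by rewrite lee_fin; exact/lefP/nd_nnsfun_approx.
Qed.

End Density.

Section BoundedMeasurable.
Context {d : measure_display} {T : measurableType d} {R : realType}.
Implicit Types (D : set T) (f g : T -> R).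

Definition bmf D f := measurable_fun D f /\ exists M : R, forall x, D x -> `|f x| <= M.

Lemma bmf_integrable (m : {measure set T -> \bar R}) D f : measurable D ->
  (m D < +oo)%E -> bmf D f -> m.-integrable D (EFin \o f).
Proof.
move=> mD mDf [mf [M Mf]]; apply: measurable_bounded_integrable => //.
exists M; split; first by rewrite num_real.
by move=> N MN x Dx /=; rewrite (le_trans (Mf x Dx))// ltW.
Qed.

Lemma bmf_cst D c : bmf D (fun=> c).
Proof. by split; [exact: measurable_cst | exists `|c|]. Qed.

Lemma bmfD D f g : bmf D f -> bmf D g -> bmf D (fun x => f x + g x).
Proof.
move=> [mf [M Mf]] [mg [N Ng]]; split; first exact: measurable_funD.
by exists (M + N) => x Dx; rewrite (le_trans (ler_normD _ _))// lerD ?Mf ?Ng.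
Qed.

Lemma bmfM D f g : bmf D f -> bmf D g -> bmf D (fun x => f x * g x).
Proof.
move=> [mf [M Mf]] [mg [N Ng]]; split; first exact: measurable_funM.
by exists (M * N) => x Dx; rewrite normrM ler_pM ?Mf ?Ng.
Qed.

Lemma bmfZ D c f : bmf D f -> bmf D (fun x => c * f x).
Proof. by move=> bf; apply: bmfM => //; exact: bmf_cst. Qed.

Lemma bmfN D f : bmf D f -> bmf D (fun x => - f x).
Proof.
move=> /(bmfZ (-1)); rewrite (_ : (fun x => -1 * f x) = (fun x => - f x))//.
by apply/funext => x; rewrite mulN1r.
Qed.

Lemma bmfB D f g : bmf D f -> bmf D g -> bmf D (fun x => f x - g x).
Proof. by move=> bf bg; apply: bmfD => //; exact: bmfN. Qed.

Lemma bmfX D f n : bmf D f -> bmf D (fun x => f x ^+ n).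
Proof.
move=> bf; elim: n => [|n IH]; first exact: bmf_cst.
rewrite (_ : (fun x => _) = (fun x => f x * f x ^+ n)); first exact: bmfM.
by apply/funext => x; rewrite exprS.
Qed.

Lemma bmf_sum D (F : nat -> T -> R) n :
  (forall i, bmf D (F i)) -> bmf D (fun x => \sum_(i < n) F i x).
Proof.
move=> bF; elim: n => [|n IH].
  rewrite (_ : (fun x => _) = fun=> 0); first exact: bmf_cst.
  by apply/funext => x; rewrite big_ord0.
rewrite (_ : (fun x => _) = fun x => \sum_(i < n) F i x + F n x).
  exact: bmfD.
by apply/funext => x; rewrite big_ord_recr.
Qed.

Lemma bmf_eq D f g : {in D, f =1 g} -> bmf D f -> bmf D g.
Proof.
move=> fg [mf [M Mf]]; split; first exact: eq_measurable_fun mf.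
by exists M => x Dx; rewrite -fg ?inE//; exact: Mf.
Qed.

End BoundedMeasurable.

Section FiniteIntegral.
Context {d : measure_display} {T : measurableType d} {R : realType}.
Variables (m : {measure set T -> \bar R}) (D : set T).
Hypotheses (mD : measurable D) (mDfin : (m D < +oo)%E).
Implicit Types (f g : T -> R).

Let int f : bmf D f -> m.-integrable D (EFin \o f).
Proof. exact: bmf_integrable. Qed.

Lemma fint_fin f : bmf D f -> (\int[m]_(x in D) (f x)%:E)%E \is a fin_num.
Proof. by move=> bf; apply: integrable_fin_num => //; exact: int. Qed.

Lemma fint_EFin f : bmf D f ->
  (\int[m]_(x in D) f x)%:E = (\int[m]_(x in D) (f x)%:E)%E.
Proof. by move=> bf; rewrite fineK// fint_fin. Qed.

Lemma fintD f g : bmf D f -> bmf D g ->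
  \int[m]_(x in D) (f x + g x) = \int[m]_(x in D) f x + \int[m]_(x in D) g x.
Proof. by move=> bf bg; rewrite RintegralD//; exact: int. Qed.

Lemma fintB f g : bmf D f -> bmf D g ->
  \int[m]_(x in D) (f x - g x) = \int[m]_(x in D) f x - \int[m]_(x in D) g x.
Proof. by move=> bf bg; rewrite RintegralB//; exact: int. Qed.

Lemma fintZ c f : bmf D f ->
  \int[m]_(x in D) (c * f x) = c * \int[m]_(x in D) f x.
Proof. by move=> bf; rewrite RintegralZl//; exact: int. Qed.

Lemma fintZr c f : bmf D f ->
  \int[m]_(x in D) (f x * c) = (\int[m]_(x in D) f x) * c.
Proof. by move=> bf; rewrite RintegralZr//; exact: int. Qed.

Lemma fint_cst c : \int[m]_(x in D) c = c * fine (m D).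
Proof. by rewrite Rintegral_cst. Qed.

Lemma le_fint f g : bmf D f -> bmf D g -> (forall x, D x -> f x <= g x) ->
  \int[m]_(x in D) f x <= \int[m]_(x in D) g x.
Proof. by move=> bf bg fg; apply: le_Rintegral => //; exact: int. Qed.

Lemma fint_norm_le f C : bmf D f -> (forall x, D x -> `|f x| <= C) ->
  `|\int[m]_(x in D) f x| <= C * fine (m D).
Proof.
move=> bf fC; rewrite -fint_cst ler_norml; apply/andP; split.
- rewrite lerNl -[in X in X <= _]mulN1r -fintZ//; apply: le_fint => [||x Dx].
  + exact: bmfZ.
  + exact: bmf_cst.
  + by rewrite mulN1r (le_trans (ler_norm _))// normrN fC.
- by apply: le_fint => // [|x Dx]; [exact: bmf_cst|rewrite (le_trans (ler_norm _))// fC].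
Qed.

Lemma fint_sum (F : nat -> T -> R) n : (forall i, bmf D (F i)) ->
  \int[m]_(x in D) (\sum_(i < n) F i x) = \sum_(i < n) \int[m]_(x in D) F i x.
Proof.
move=> bF; elim: n => [|n IH].
  under eq_Rintegral do rewrite big_ord0.
  by rewrite fint_cst mul0r big_ord0.
rewrite big_ord_recr/= -IH -fintD//; last exact: bmf_sum.
by apply: eq_Rintegral => x _; rewrite big_ord_recr.
Qed.

End FiniteIntegral.

(** * The interval of angles *)

Section SangBasics.
Context {R : realType}.
Implicit Types (f g : R -> R).
Notation leb := (@lebesgue_measure R).
Notation S := (@Sang R).

Lemma mS : measurable S. Proof. exact: measurable_itv. Qed.

Lemma leb_Sang : leb S = (pi : R)%:E.
Proof.
rewrite /Sang lebesgue_measure_itv/= lte_fin.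
have p0 : (0:R) < pi by exact: pi_gt0.
have -> : - (pi / 2) < pi / 2 :> R by lra.
by rewrite -EFinD; congr EFin; lra.
Qed.

Lemma leb_Sang_lty : (leb S < +oo)%E. Proof. by rewrite leb_Sang ltry. Qed.

Lemma SangP x : S x <-> `|x| <= pi / 2.
Proof. by rewrite /Sang/= in_itv/= ler_norml. Qed.

Definition clamp_to (r x : R) := Num.max (- r) (Num.min x r).

Lemma clamp_to_le r x : 0 <= r -> `|clamp_to r x| <= r.
Proof.
by move=> r0; rewrite ler_norml /clamp_to le_max ge_max ge_min !lexx !orbT /= andbT; lra.
Qed.

Lemma clamp_to_id r x : `|x| <= r -> clamp_to r x = x.
Proof.
by rewrite ler_norml /clamp_to => /andP[h1 h2]; rewrite (min_idPl h2) (max_idPr h1).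
Qed.

Lemma clamp_to_lip r x y : 0 <= r -> `|clamp_to r x - clamp_to r y| <= `|x - y|.
Proof.
move=> r0; rewrite /clamp_to /Num.max /Num.min; do ! case: ifPn; rewrite -?leNgt => *;
 rewrite ler_norml; apply/andP; split;
 have := ler_norm (x - y); have := ler_norm (y - x); rewrite (distrC y x);  lra.
Qed.

(** Composing with this retraction onto [Sang] turns functions on [Sang] into functions
    on the line with the same modulus of continuity. *)
Definition clamp (x : R) := clamp_to (pi / 2) x.

Let pihalf_ge0 : 0 <= pi / 2 :> R. Proof. by have := @pi_gt0 R; lra. Qed.

Lemma clamp_S x : S (clamp x).
Proof. by apply/SangP; exact: clamp_to_le. Qed.

Lemma clamp_id x : S x -> clamp x = x.
Proof. by move=> /SangP; exact: clamp_to_id. Qed.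

Lemma clamp_lip x y : `|clamp x - clamp y| <= `|x - y|.
Proof. exact: clamp_to_lip. Qed.

Definition ucont f := forall e : R, 0 < e ->
  exists2 del : R, 0 < del & forall x y, `|x - y| <= del -> `|f x - f y| <= e.

Lemma ucont_continuous f : ucont f -> continuous f.
Proof.
move=> uf x; apply/cvgrPdist_le => e e0; have [del d0 H] := uf e e0.
near=> y; apply: H; near: y.
exact: cvgr_dist_le.
Unshelve. all: by end_near. Qed.

Lemma ucont_bmf f M D : measurable D -> ucont f -> (forall x, D x -> `|f x| <= M) -> bmf D f.
Proof.
move=> mD uf fM; split; last by exists M.
by apply: measurable_funTS; apply: continuous_measurable_fun; exact: ucont_continuous.
Qed.

Lemma ucontD f g : ucont f -> ucont g -> ucont (fun x => f x + g x).
Proof.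
move=> uf ug e e0; have e2 : 0 < e / 2 by lra.
have [d1 d10 H1] := uf _ e2; have [d2 d20 H2] := ug _ e2.
exists (Num.min d1 d2); first by rewrite lt_min d10.
move=> x y; rewrite le_min => /andP[/H1 h1 /H2 h2].
rewrite opprD addrACA (le_trans (ler_normD _ _))//.
by rewrite [leRHS](splitr e) lerD.
Qed.

Lemma ucontZ c f : ucont f -> ucont (fun x => c * f x).
Proof.
move=> uf e e0; have c0 : 0 < `|c| + 1 by rewrite ltr_wpDl.
have [d1 d10 H1] := uf _ (divr_gt0 e0 c0).
exists d1 => // x y /H1 h; rewrite -mulrBr normrM.
rewrite (@le_trans _ _ ((`|c| + 1) * (e / (`|c| + 1))))//.
  by rewrite ler_pM// lerDl.
by rewrite mulrC divfK// gt_eqF.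
Qed.

Lemma ucontB f g : ucont f -> ucont g -> ucont (fun x => f x - g x).
Proof.
move=> uf /(ucontZ (-1)) ug; have := ucontD uf ug.
by under [X in ucont X -> _]eq_fun do rewrite mulN1r.
Qed.

Lemma ucont_cst c : ucont (fun=> c).
Proof. by move=> e e0; exists 1 => // x y _; rewrite subrr normr0 ltW. Qed.

Lemma ucontM f g M N : ucont f -> ucont g -> (forall x, `|f x| <= M) ->
  (forall x, `|g x| <= N) -> ucont (fun x => f x * g x).
Proof.
move=> uf ug fM gN e e0.
have M0 : 0 <= M by exact: le_trans (fM 0).
have N0 : 0 <= N by exact: le_trans (gN 0).
pose C := M + N + 1; have C0 : 0 < C by rewrite /C; lra.
have e'0 : 0 < e / 2 / C by rewrite !divr_gt0.
have [d1 d10 H1] := uf _ e'0; have [d2 d20 H2] := ug _ e'0.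
exists (Num.min d1 d2); first by rewrite lt_min d10.
move=> x y; rewrite le_min => /andP[/H1 h1 /H2 h2].
rewrite (_ : _ - _ = f x * (g x - g y) + (f x - f y) * g y); last by ring.
rewrite (le_trans (ler_normD _ _))// !normrM.
rewrite (@le_trans _ _ (C * (e / 2 / C) + (e / 2 / C) * C))//.
  rewrite lerD// ler_pM//; first by rewrite (le_trans (fM _))// /C; lra.
  by rewrite (le_trans (gN _))// /C; lra.
by rewrite [C * _]mulrC divfK ?gt_eqF//; lra.
Qed.

End SangBasics.

(** * Limits along ultrafilters *)

Section Ultra.
Context {R : realType} (U : set_system nat) {UU : UltraFilter U}.
Hypothesis Uoo : \oo `<=` U.

(** Along an ultrafilter every bounded sequence converges, which replaces the
    extraction of subsequences in the compactness arguments below. *)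
Lemma ultra_bounded_cvg (u : nat -> R) (M : R) : (\forall n \near U, `|u n| <= M) ->
  exists2 l : R, `|l| <= M & u n @[n --> U] --> l.
Proof.
move=> uM.
have := @segment_compact R (- M) M; rewrite compact_ultra.
have UFu : UltraFilter (u @ U).
  split; first exact: fmap_proper_filter.
  move=> G PG sG; apply/seteqP; split => // A GA.
  have [//|Un] := in_ultra_setVsetC (u @^-1` A) UU.
  have GAc : G (~` A) by apply: sG.
  exfalso; apply: (@filter_not_empty _ G PG); rewrite -(setICr A); exact: filterI.
move=> /(_ (u @ U) UFu) [|l [lM ul]].
  by apply: filterS uM => n; rewrite /= in_itv/= ler_norml.
by exists l => //; move: lM; rewrite /= in_itv/= ler_norml.
Qed.

Lemma ultra_cvg_oo (u : nat -> R) (l : R) : u @ \oo --> l -> u @ U --> l.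
Proof. by move=> ul A /ul; exact: Uoo. Qed.

End Ultra.

Section ContinuousOnS.
Context {R : realType}.
Notation S := (@Sang R).
Implicit Types psi : R -> R.

Lemma exists_ultra : exists2 U : set_system nat, UltraFilter U & \oo `<=` U.
Proof. by have [G [? ?]] := ultraFilterLemma eventually_filter; exists G. Qed.

Lemma CbS_bounded psi : CbS psi -> exists2 M : R, 0 <= M & forall x, S x -> `|psi x| <= M.
Proof.
move=> cp; have p0 : (0:R) < pi by exact: pi_gt0.
have le : - (pi / 2) <= pi / 2 :> R by lra.
have [c1 _ H1] := EVT_max le cp; have [c2 _ H2] := EVT_min le cp.
exists (`|psi c1| + `|psi c2|); first by rewrite addr_ge0.
move=> x Sx; have := H1 x Sx; have := H2 x Sx.
have := ler_norm (psi c1); have := ler_norm (- psi c2); rewrite normrN.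
have := normr_ge0 (psi c1); have := normr_ge0 (psi c2).
move=> *; rewrite ler_norml; apply/andP; split; lra.
Qed.

(** Otherwise there are two sequences in [Sang] at vanishing distance whose images
    stay apart; along an ultrafilter both converge to the same point, where [psi]
    is continuous. *)
Lemma CbS_ucont psi : CbS psi -> ucont (psi \o @clamp R).
Proof.
move=> cp; apply: contrapT => /existsNP[e] /not_implyP[e0 H].
have {}H n : exists xy : R * R, `|xy.1 - xy.2| <= n.+1%:R^-1 /\
    e < `|psi (clamp xy.1) - psi (clamp xy.2)|.
  have n0 : (0:R) < n.+1%:R^-1 by rewrite invr_gt0.
  have := contra_not (ex_intro2 _ _ n.+1%:R^-1 n0) H.
  move=> /existsNP[x] /existsNP[y] /not_implyP[h /negP]; rewrite -ltNge => h'.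
  by exists (x, y).
have [xy Hxy] := choice H.
have [U UU Uoo] := exists_ultra.
pose x n := clamp (xy n).1; pose y n := clamp (xy n).2.
have bx n : `|x n| <= pi / 2 by apply/SangP; exact: clamp_S.
have [l lS xl] : exists2 l : R, `|l| <= pi / 2 & x n @[n --> U] --> l.
  apply: (@ultra_bounded_cvg _ U _ x); exact: nearW.
have xy0 : x n - y n @[n --> U] --> 0.
  apply: ultra_cvg_oo => //; apply/cvgr0Pnorm_le => e' e'0.
  near=> n; rewrite (le_trans (clamp_lip _ _))// (le_trans (Hxy n).1)// ltW//.
  near: n; exact: (near_infty_natSinv_lt (PosNum e'0)).
have yl : y n @[n --> U] --> l.
  rewrite (_ : y = fun n => x n - (x n - y n)).
    by rewrite -[l]subr0; exact: cvgB.
  by apply/funext => n; lra.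
have Sl : S l by apply/SangP.
have cpl : psi z @[z --> within S (nbhs l)] --> psi l.
  by move/subspace_continuousP : cp; exact.
have cv (u : nat -> R) : (forall n, S (u n)) -> u n @[n --> U] --> l ->
    psi (u n) @[n --> U] --> psi l.
  move=> Su ul.
  have ulw : u n @[n --> U] --> within S (nbhs l).
    move=> B BS; apply: (@filterS _ U _ _ _ _ (ul _ BS)) => n; apply; exact: Su.
  exact: (cvg_comp _ _ ulw cpl).
have c1 := cv x (fun n => clamp_S _) xl; have c2 := cv y (fun n => clamp_S _) yl.
have c3 : psi (x n) - psi (y n) @[n --> U] --> 0.
  by rewrite -(subrr (psi l)); exact: cvgB.
have : \forall n \near U, `|psi (x n) - psi (y n)| <= e.
  by move/cvgr0Pnorm_le : c3; exact.
move=> /filter_ex[n]; rewrite leNgt => /negP; apply; exact: (Hxy n).2.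
Unshelve. all: by end_near. Qed.

Lemma ucont_CbS f psi : ucont f -> (forall x, S x -> psi x = f x) -> CbS psi.
Proof.
move=> /ucont_continuous cf e; rewrite /CbS.
have fpsi : {in S, f =1 psi} by move=> x /set_mem Sx; rewrite e.
exact: (subspace_eq_continuous fpsi (continuous_subspaceT cf)).
Qed.

End ContinuousOnS.

(** * Integrals over the interval of angles *)

Section IntegralOnS.
Context {R : realType}.
Notation leb := (@lebesgue_measure R).
Notation S := (@Sang R).
Implicit Types f g : R -> R.

Let lS : (leb S < +oo)%E. Proof. exact: leb_Sang_lty. Qed.

Lemma IS_EFin f : bmf S f ->
  (\int[leb]_(x in S) f x)%:E = (\int[leb]_(x in S) (f x)%:E)%E.
Proof. by move=> bf; apply: fint_EFin => //; exact: mS. Qed.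

Lemma ISD f g : bmf S f -> bmf S g ->
  \int[leb]_(x in S) (f x + g x) = \int[leb]_(x in S) f x + \int[leb]_(x in S) g x.
Proof. by move=> bf bg; apply: fintD => //; exact: mS. Qed.

Lemma ISB f g : bmf S f -> bmf S g ->
  \int[leb]_(x in S) (f x - g x) = \int[leb]_(x in S) f x - \int[leb]_(x in S) g x.
Proof. by move=> bf bg; apply: fintB => //; exact: mS. Qed.

Lemma ISZ c f : bmf S f ->
  \int[leb]_(x in S) (c * f x) = c * \int[leb]_(x in S) f x.
Proof. by move=> bf; apply: fintZ => //; exact: mS. Qed.

Lemma ISZr c f : bmf S f ->
  \int[leb]_(x in S) (f x * c) = (\int[leb]_(x in S) f x) * c.
Proof. by move=> bf; apply: fintZr => //; exact: mS. Qed.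

Lemma IS_cst c : \int[leb]_(x in S) c = c * pi.
Proof.
rewrite (fint_cst leb mS) [X in fine X](_ : _ = pi%:E)//; exact: leb_Sang.
Qed.

Lemma le_IS f g : bmf S f -> bmf S g -> (forall x, S x -> f x <= g x) ->
  \int[leb]_(x in S) f x <= \int[leb]_(x in S) g x.
Proof. by move=> bf bg; apply: (@le_fint _ _ _ leb S mS lS f g bf bg). Qed.

Lemma IS_ge0 f : (forall x, S x -> 0 <= f x) -> 0 <= \int[leb]_(x in S) f x.
Proof. exact: (@Rintegral_ge0 _ _ _ leb S f). Qed.

Lemma IS_norm_le f C : bmf S f -> (forall x, S x -> `|f x| <= C) ->
  `|\int[leb]_(x in S) f x| <= C * pi.
Proof.
move=> bf fC; have := @fint_norm_le _ _ _ leb S mS lS f C bf fC.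
rewrite [X in fine X](_ : _ = pi%:E)//; exact: leb_Sang.
Qed.

Lemma eq_IS f g : (forall x, S x -> f x = g x) ->
  \int[leb]_(x in S) f x = \int[leb]_(x in S) g x.
Proof. by move=> fg; apply: eq_Rintegral => x /set_mem; exact: fg. Qed.

Lemma IS_sum (F : nat -> R -> R) n : (forall i, bmf S (F i)) ->
  \int[leb]_(x in S) (\sum_(i < n) F i x) = \sum_(i < n) \int[leb]_(x in S) F i x.
Proof. by move=> bF; apply: fint_sum => //; exact: mS. Qed.

End IntegralOnS.

Section FubiniOnS.
Context {R : realType}.
Notation leb := (@lebesgue_measure R).
Notation S := (@Sang R).
Implicit Types g : R -> R -> R.

(** Measurability is required on the whole plane so that sections and swaps are
    measurable without restricting to a product of intervals. *)
Definition bmf2 g := measurable_fun setT (fun p : R * R => g p.1 p.2) /\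
  exists M : R, forall x y, S x -> S y -> `|g x y| <= M.

Lemma bmf2_swap g : bmf2 g -> bmf2 (fun x y => g y x).
Proof.
move=> [mg [M gM]]; split; last by exists M => x y Sx Sy; exact: gM.
exact: (measurableT_comp mg (@measurable_swap _ _ R R)).
Qed.

Lemma bmf2M g1 g2 : bmf2 g1 -> bmf2 g2 -> bmf2 (fun x y => g1 x y * g2 x y).
Proof.
move=> [mg [M gM]] [mh [N hN]]; split; first exact: measurable_funM.
by exists (M * N) => x y Sx Sy; rewrite normrM ler_pM// (gM, hN).
Qed.

Lemma bmf2_fst (f : R -> R) : bmf S f -> bmf2 (fun x _ => (f \_ S) x).
Proof.
move=> [mf [M fM]]; split.
  apply: (measurableT_comp _ measurable_fst).
  by apply/measurable_restrict => //; [exact: mS | rewrite setTI].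
by exists M => x y Sx _; rewrite patchE mem_set// fM.
Qed.

Lemma bmf2_snd (f : R -> R) : bmf S f -> bmf2 (fun _ x => (f \_ S) x).
Proof. by move=> /bmf2_fst/bmf2_swap. Qed.

Lemma bmf2_section g x : bmf2 g -> S x -> bmf S (g x).
Proof.
move=> [mg [M gM]] Sx; split; last by exists M => y; exact: gM.
apply: measurable_funTS.
exact: (measurableT_comp mg (@pair1_measurable _ _ R R x)).
Qed.

Let pos g C (p : R * R) : R := ((fun p => g p.1 p.2 + C) \_ (S `*` S)) p.

Let posE g C x y : pos g C (x, y) = if (x \in S) && (y \in S) then g x y + C else 0.
Proof. by rewrite /pos patchE in_setX. Qed.

Let mpos g C : bmf2 g -> measurable_fun setT (pos g C).
Proof.
move=> [mg _]; rewrite /pos; apply/(measurable_restrictT _ _).1.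
  by apply: measurableX; exact: mS.
by apply: measurable_funTS; exact: measurable_funD.
Qed.

Let pos_ge0 g C p : (forall x y, S x -> S y -> `|g x y| <= C) -> (0 <= (pos g C p)%:E)%E.
Proof.
case: p => x y gC; rewrite lee_fin posE; case: ifPn => // /andP[/set_mem S1 /set_mem S2].
by have := gC _ _ S1 S2; rewrite ler_norml => /andP[? _]; lra.
Qed.

Let pos_int g C x : bmf2 g -> (forall x y, S x -> S y -> `|g x y| <= C) ->
  (\int[leb]_y (pos g C (x, y))%:E)%E =
  (((fun x => \int[leb]_(y in S) (g x y) + C * pi) \_ S) x)%:E.
Proof.
move=> bg gC; rewrite patchE; under eq_integral do rewrite posE.
case: ifPn => Sx /=; last by rewrite integral0_eq.
move/set_mem : Sx => Sx.
have bgx := bmf2_section bg Sx.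
transitivity (\int[leb]_(y in S) (g x y + C)%:E)%E.
  rewrite [RHS]integral_mkcond; apply: eq_integral => y _.
  by rewrite patchE; case: ifPn.
have bs : bmf S (fun y => g x y + C) by apply: bmfD => //; exact: bmf_cst.
by rewrite -IS_EFin// ISD// ?IS_cst//; exact: bmf_cst.
Qed.

(** Adding a bound of [|g|] makes the integrand nonnegative, so that Tonelli's
    theorem gives the measurability. *)
Lemma bmf2_integral g : bmf2 g -> bmf S (fun x => \int[leb]_(y in S) g x y).
Proof.
move=> bg; have [mg [C gC]] := bg.
have C0 : 0 <= C.
  have p0 : (0:R) < pi by exact: pi_gt0.
  have S0 : S 0 by apply/SangP; rewrite normr0; lra.
  exact: le_trans (gC _ _ S0 S0).
split; last first.
  by exists (C * pi) => x Sx; apply: IS_norm_le => [|y Sy]; [exact: bmf2_section|exact: gC].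
have mF : measurable_fun setT (fun x => (\int[leb]_y (pos g C (x, y))%:E)%E).
  apply: (@measurable_fun_fubini_tonelli_F _ _ _ _ R leb (fun p => (pos g C p)%:E)) => //.
    by apply/measurable_EFinP; exact: mpos.
  by move=> p; exact: pos_ge0.
have m1 : measurable_fun S (fun x => \int[leb]_(y in S) g x y + C * pi).
  have := measurable_funTS (D := S) mF.
  rewrite (_ : (fun x => _) = EFin \o ((fun x => \int[leb]_(y in S) g x y + C * pi) \_ S)).
    move=> /measurable_EFinP h; apply: eq_measurable_fun h => x xS.
    by rewrite patchE xS.
  by apply/funext => x; rewrite /= pos_int.
have := measurable_funB m1 (@measurable_cst _ _ _ _ S (C * pi)).
by apply: eq_measurable_fun => x _ /=; rewrite addrK.
Qed.

Lemma fubiniS g : bmf2 g ->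
  \int[leb]_(x in S) \int[leb]_(y in S) g x y =
  \int[leb]_(y in S) \int[leb]_(x in S) g x y.
Proof.
move=> bg; have [mg [C gC]] := bg.
have gC' : forall x y, S x -> S y -> `|(fun x y => g y x) x y| <= C.
  by move=> x y Sx Sy; exact: gC.
have bg' := bmf2_swap bg.
have : (\int[leb]_x \int[leb]_y (pos g C (x, y))%:E =
        \int[leb]_y \int[leb]_x (pos g C (x, y))%:E)%E.
  apply: (@fubini_tonelli _ _ _ _ R leb leb (fun p => (pos g C p)%:E)) => //.
    by apply/measurable_EFinP; exact: mpos.
  by move=> p; exact: pos_ge0.
under eq_integral do rewrite pos_int//.
have posC x y : pos g C (x, y) = pos (fun x y => g y x) C (y, x) by rewrite !posE andbC.
under [RHS]eq_integral => y _.
  under eq_integral do rewrite posC.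
  rewrite pos_int//.
  over.
have E (h : R -> R) : (\int[leb]_x ((h \_ S) x)%:E = \int[leb]_(x in S) (h x)%:E)%E.
  by rewrite [RHS]integral_mkcond; apply: eq_integral => x _; rewrite !patchE; case: ifP.
rewrite !E.
have h1 := bmf2_integral bg; have h2 := bmf2_integral bg'.
have bc : bmf S (fun=> C * pi) by exact: bmf_cst.
rewrite -IS_EFin; last exact: bmfD.
rewrite -IS_EFin; last exact: bmfD.
by rewrite (ISD h1 bc) (ISD h2 bc) => -[] /addIr.
Qed.

(** An instance of [fubiniS], for the kernel and later for its derivative. *)
Lemma duality2 g (p f : R -> R) : bmf2 g -> bmf S p -> bmf S f ->
  \int[leb]_(b in S) (\int[leb]_(a in S) (p a * g a b) * f b) =
  \int[leb]_(a in S) (p a * \int[leb]_(b in S) (g a b * f b)).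
Proof.
move=> bg bp bf.
have b2 : bmf2 (fun a b => (p \_ S) a * g a b * (f \_ S) b).
  by apply: bmf2M; [apply: bmf2M; [exact: bmf2_fst|exact: bg]|exact: bmf2_snd].
transitivity (\int[leb]_(b in S) \int[leb]_(a in S) ((p \_ S) a * g a b * (f \_ S) b)).
  apply: eq_IS => b Sb; rewrite -ISZr; last first.
    by apply: bmfM bp _; exact: (bmf2_section (bmf2_swap bg) Sb).
  by apply: eq_IS => a Sa; rewrite !patchE !mem_set.
rewrite -fubiniS//; apply: eq_IS => a Sa.
rewrite -ISZ; last by apply: bmfM => //; exact: (bmf2_section bg Sa).
by apply: eq_IS => b Sb; rewrite !patchE !mem_set// mulrA.
Qed.

End FubiniOnS.

Section CvgOrder.
Context {R : realType} {T : Type} (F : set_system T) {PF : ProperFilter F}.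
Implicit Types (u : T -> R) (l c : R).

Lemma cvg_ge_near u l c : u @ F --> l -> (\forall n \near F, c <= u n) -> c <= l.
Proof.
move=> cv h; rewrite -(cvg_lim _ cv)//; apply: limr_ge => //.
by apply/cvg_ex; exists l.
Qed.

Lemma cvg_le_near u l c : u @ F --> l -> (\forall n \near F, u n <= c) -> l <= c.
Proof.
move=> cv h; rewrite -(cvg_lim _ cv)//; apply: limr_le => //.
by apply/cvg_ex; exists l.
Qed.

Lemma cvg_uniqR u (a b : R) : u @ F --> a -> u @ F --> b -> a = b.
Proof. by move=> h1 h2; exact: (@cvg_unique _ (@Rhausdorff R) _ _ _ _ h1 h2). Qed.

End CvgOrder.

Section UltraLimits.
Context {R : realType} (U : set_system nat) {UU : UltraFilter U}.
Notation leb := (@lebesgue_measure R).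
Notation S := (@Sang R).
Implicit Types (fn : nat -> R -> R) (f g h : R -> R).

Definition ucv fn g := forall e : R, 0 < e ->
  \forall n \near U, forall x, S x -> `|fn n x - g x| <= e.

Lemma ucv_int fn g h : (forall n, bmf S (fn n)) -> bmf S g -> bmf S h ->
  ucv fn g ->
  \int[leb]_(x in S) (fn n x * h x) @[n --> U] --> \int[leb]_(x in S) (g x * h x).
Proof.
move=> bf bg bh cv; have [_ [M hM]] := bh.
have p0 : (0:R) < pi by exact: pi_gt0.
have M0 : 0 <= M.
  have S0 : S 0 by apply/SangP; rewrite normr0; lra.
  exact: le_trans (hM _ S0).
apply/cvgrPdist_le => e e0.
have C0 : 0 < (M + 1) * pi by rewrite mulr_gt0//; lra.
apply: filterS (cv _ (divr_gt0 e0 C0)) => n Hn.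
rewrite -ISB; [|exact: bmfM|exact: bmfM].
rewrite (eq_IS (g := fun x => (g x - fn n x) * h x)); last by move=> x _; ring.
apply: (le_trans (@IS_norm_le _ _ (e / ((M + 1) * pi) * (M + 1)) _ _)).
- by apply: bmfM => //; exact: bmfB.
- move=> x Sx; rewrite normrM distrC ler_pM//; first exact: Hn.
  by rewrite (le_trans (hM _ Sx))//; lra.
- by rewrite -(mulrA _ (M + 1)) divfK// gt_eqF.
Qed.

(** Arzela-Ascoli: the pointwise limits along the ultrafilter exist by boundedness,
    and equicontinuity reduces uniform closeness to a finite net of points. *)
Lemma ultra_ascoli fn (M : R) :
  (forall n x, `|fn n x| <= M) ->
  (forall e : R, 0 < e -> exists2 del : R, 0 < del &
    forall n x y, `|x - y| <= del -> `|fn n x - fn n y| <= e) ->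
  exists g, [/\ forall x, `|g x| <= M, ucont g,
    forall x, fn n x @[n --> U] --> g x & ucv fn g].
Proof.
move=> fM feq.
have /choice[g Hg] (x : R) : exists l : R, `|l| <= M /\ fn n x @[n --> U] --> l.
  have [l lM cl] := @ultra_bounded_cvg R U UU (fn ^~ x) M (nearW _ (fM ^~ x)).
  by exists l.
have geq e del : (forall n x y, `|x - y| <= del -> `|fn n x - fn n y| <= e) ->
    forall x y, `|x - y| <= del -> `|g x - g y| <= e.
  move=> H x y xy.
  have c : `|fn n x - fn n y| @[n --> U] --> `|g x - g y|.
    by apply: cvg_norm; apply: cvgB; [exact: (Hg x).2 | exact: (Hg y).2].
  by apply: (cvg_le_near c); apply: nearW => n; exact: H.
exists g; split => [x|||].
- exact: (Hg x).1.
- by move=> e e0; have [del d0 H] := feq _ e0; exists del => //; exact: geq.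
- by move=> x; exact: (Hg x).2.
- move=> e e0; have e3 : 0 < e / 3 by lra.
  have [del d0 H] := feq _ e3.
  have Hg' := geq _ _ H.
  (* the points - pi / 2 + i * del, i < N, form a net of mesh del of S *)
  have p0 : (0:R) < pi by exact: pi_gt0.
  pose N := (Num.truncn (pi / del)).+1.
  have near_net m : \forall n \near U, forall i, (i < m)%N ->
      `|fn n (- (pi / 2) + i%:R * del) - g (- (pi / 2) + i%:R * del)| <= e / 3.
    elim: m => [|m IH]; first by apply: nearW => n i; rewrite ltn0.
    have : \forall n \near U, `|g (- (pi / 2) + m%:R * del) - fn n (- (pi / 2) + m%:R * del)| <= e / 3.
      have := (Hg (- (pi / 2) + m%:R * del)).2.
      by move/cvgrPdist_le; apply.
    move: IH; apply: filterS2 => n H1 H2 i; rewrite ltnS leq_eqVlt => /orP[/eqP->|/H1//].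
    by rewrite distrC.
  apply: filterS (near_net N) => n Hn x /SangP xS.
  pose i := Num.truncn ((x + pi / 2) / del).
  have x0 : 0 <= (x + pi / 2) / del.
    by apply: divr_ge0; [move: xS; rewrite ler_norml => /andP[? ?]; lra | exact: ltW].
  have /andP[i1 i2] := truncn_itv x0.
  have iN : (i < N)%N.
    rewrite ltnS /i; apply: le_truncn.
    rewrite ler_pM2r ?invr_gt0//; move: xS; rewrite ler_norml => /andP[? ?]; lra.
  set y := - (pi / 2) + i%:R * del.
  have xy : `|x - y| <= del.
    rewrite -/i in i1 i2.
    move: i1 i2; rewrite ler_pdivlMr// ltr_pdivrMr// -[i.+1%:R]natr1 => i1 i2.
    rewrite /y ler_norml; apply/andP; split; lra.
  have h1 := H n _ _ xy; have h2 := Hg' _ _ xy; have h3 := Hn _ iN; rewrite -/y in h3.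
  rewrite (_ : fn n x - g x = (fn n x - fn n y) + (fn n y - g y) + (g y - g x)); last by ring.
  rewrite (le_trans (ler_normD _ _))// (le_trans (lerD (ler_normD _ _) (lexx _)))//.
  by rewrite [`|g y - g x|]distrC; lra.
Qed.

End UltraLimits.

(** * The reflection kernel as an operator *)

(** What the hypotheses on the density give once it is extended to the line in both
    arguments, so that it can be translated. The last field is a second-order
    Taylor bound, uniform in [a], with [k'] the derivative in [b]. *)
Record smooth_kernel {R : realType} (theta0 M : R) (k k' : R -> R -> R) : Prop := {
  sk_ge0 : forall a b, 0 <= k a b ;
  sk_le : forall a b, k a b <= M ;
  sk_supp : forall a b, theta0 < `|b| -> k a b = 0 ;
  sk_mass : forall a, \int[@lebesgue_measure R]_(b in Sang) k a b = 1 ;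
  sk_meas : measurable_fun setT (fun p : R * R => k p.1 p.2) ;
  sk_equi : forall e : R, 0 < e -> exists2 del : R, 0 < del &
    forall a a' b, `|a - a'| <= del -> `|k a b - k a' b| <= e ;
  sk_lip : forall a b b', `|k a b - k a b'| <= M * `|b - b'| ;
  sk_taylor : forall a b h, `|k a (b - h) - k a b + h * k' a b| <= M * h ^+ 2
}.

(** The operator of a smooth kernel maps bounded measurable functions into this class,
    which also contains the clamped extension of every element of [CbS]. *)
Definition ub {R : realType} (f : R -> R) := ucont f /\ exists C : R, forall x, `|f x| <= C.

Section UB.
Context {R : realType}.
Implicit Types f g : R -> R.

Lemma ub_bmf D f : measurable D -> ub f -> bmf D f.
Proof. by move=> mD [uf [C fC]]; apply: (ucont_bmf (M := C)). Qed.

Lemma ub_cst c : ub (fun=> c : R).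
Proof. by split; [exact: ucont_cst | exists `|c|]. Qed.

Lemma ubD f g : ub f -> ub g -> ub (fun x => f x + g x).
Proof.
move=> [uf [C fC]] [ug [D gD]]; split; first exact: ucontD.
by exists (C + D) => x; rewrite (le_trans (ler_normD _ _))// lerD.
Qed.

Lemma ubZ c f : ub f -> ub (fun x => c * f x).
Proof.
move=> [uf [C fC]]; split; first exact: ucontZ.
by exists (`|c| * C) => x; rewrite normrM ler_pM.
Qed.

Lemma ubB f g : ub f -> ub g -> ub (fun x => f x - g x).
Proof.
move=> [uf [C fC]] [ug [D gD]]; split; first exact: ucontB.
by exists (C + D) => x; rewrite (le_trans (ler_normB _ _))// lerD.
Qed.

Lemma ubM f g : ub f -> ub g -> ub (fun x => f x * g x).
Proof.
move=> [uf [C fC]] [ug [D gD]]; split; first exact: ucontM fC gD.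
by exists (C * D) => x; rewrite normrM ler_pM.
Qed.

Lemma ub_sum (F : nat -> R -> R) n : (forall i, ub (F i)) -> ub (fun x => \sum_(i < n) F i x).
Proof.
move=> bF; elim: n => [|n IH].
  by under [X in ub X]eq_fun do rewrite big_ord0; exact: ub_cst.
by under [X in ub X]eq_fun do rewrite big_ord_recr/=; exact: ubD.
Qed.

Lemma ub_CbS f : CbS f -> ub (f \o @clamp R).
Proof.
move=> cf; split; first exact: CbS_ucont.
by have [M _ H] := CbS_bounded cf; exists M => x; apply: H; exact: clamp_S.
Qed.

Lemma lip_ucont f (M : R) : 0 <= M -> (forall x y, `|f x - f y| <= M * `|x - y|) -> ucont f.
Proof.
move=> M0 H e e0; have M1 : 0 < M + 1 by lra.
exists (e / (M + 1)) => [|x y xy]; first by rewrite divr_gt0.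
rewrite (le_trans (H x y))// (@le_trans _ _ ((M + 1) * (e / (M + 1))))//.
  by rewrite ler_pM//; lra.
by rewrite mulrC divfK// gt_eqF.
Qed.

End UB.

Section Operator.
Context {R : realType} (theta0 M : R) (k k' : R -> R -> R).
Hypothesis sk : smooth_kernel theta0 M k k'.
Notation leb := (@lebesgue_measure R).
Notation S := (@Sang R).
Implicit Types (f g p : R -> R) (a b x y : R).

Definition Top f a : R := \int[leb]_(b in S) (k a b * f b).

Let M0 : 0 <= M. Proof. exact: le_trans (sk_ge0 sk 0 0) (sk_le sk 0 0). Qed.

Let S0 : S 0.
Proof. by apply/SangP; rewrite normr0; have := @pi_gt0 R; lra. Qed.

Lemma k_norm a b : `|k a b| <= M.
Proof. by rewrite ger0_norm; [exact: (sk_le sk)|exact: (sk_ge0 sk)]. Qed.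

Lemma k_ub a : ub (k a).
Proof.
split; last by exists M => b; exact: k_norm.
by apply: (lip_ucont M0) => b b'; exact: (sk_lip sk).
Qed.

Lemma k_bmf a : bmf S (k a).
Proof. by apply: ub_bmf; [exact: mS | exact: k_ub]. Qed.

Lemma bmf2_k : bmf2 k.
Proof. by split; [exact: (sk_meas sk) | exists M => x y _ _; exact: k_norm]. Qed.

Lemma TopD f g a : bmf S f -> bmf S g -> Top (fun x => f x + g x) a = Top f a + Top g a.
Proof.
move=> bf bg; rewrite /Top -ISD; [|exact: bmfM (k_bmf a) _|exact: bmfM (k_bmf a) _].
by apply: eq_IS => x _; rewrite mulrDr.
Qed.

Lemma TopB f g a : bmf S f -> bmf S g -> Top (fun x => f x - g x) a = Top f a - Top g a.
Proof.
move=> bf bg; rewrite /Top -ISB; [|exact: bmfM (k_bmf a) _|exact: bmfM (k_bmf a) _].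
by apply: eq_IS => x _; rewrite mulrBr.
Qed.

Lemma TopZ c f a : bmf S f -> Top (fun x => c * f x) a = c * Top f a.
Proof.
move=> bf; rewrite /Top -ISZ; last exact: bmfM (k_bmf a) _.
by apply: eq_IS => x _; ring.
Qed.

Lemma Top_cst c a : Top (fun=> c) a = c.
Proof.
rewrite /Top; under eq_Rintegral do rewrite mulrC.
by rewrite ISZ ?(sk_mass sk) ?mulr1//; exact: k_bmf.
Qed.

Lemma Top_sum (F : nat -> R -> R) n a : (forall i, bmf S (F i)) ->
  Top (fun x => \sum_(i < n) F i x) a = \sum_(i < n) Top (F i) a.
Proof.
move=> bF; elim: n => [|n IH].
  by under [X in Top X]eq_fun do rewrite big_ord0; rewrite Top_cst big_ord0.
under [X in Top X]eq_fun do rewrite big_ord_recr/=.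
by rewrite TopD ?IH ?big_ord_recr//; exact: bmf_sum.
Qed.

Lemma eq_Top f g a : (forall x, S x -> f x = g x) -> Top f a = Top g a.
Proof. by move=> fg; apply: eq_IS => x Sx; rewrite fg. Qed.

Lemma le_Top f g a : bmf S f -> bmf S g -> (forall x, S x -> f x <= g x) ->
  Top f a <= Top g a.
Proof.
move=> bf bg fg; apply: le_IS => [||x Sx]; [exact: bmfM (k_bmf a) _ ..|].
by rewrite ler_wpM2l ?fg// (sk_ge0 sk).
Qed.

Lemma Top_norm f C a : bmf S f -> (forall x, S x -> `|f x| <= C) -> `|Top f a| <= C.
Proof.
move=> bf fC; rewrite ler_norml -{1}(Top_cst (- C) a) -{2}(Top_cst C a).
apply/andP; split; apply: le_Top => //; try exact: bmf_cst.
  by move=> x /fC; rewrite ler_norml => /andP[].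
by move=> x /fC; rewrite ler_norml => /andP[].
Qed.

(** The modulus of continuity of [Top f] depends on [f] only through its sup norm:
    this is the compactness of [Top]. *)
Lemma Top_equi (e : R) : 0 < e -> exists2 del : R, 0 < del &
  forall f (C : R), bmf S f -> (forall x, S x -> `|f x| <= C) ->
  forall a a', `|a - a'| <= del -> `|Top f a - Top f a'| <= e * C.
Proof.
move=> e0; have p0 := @pi_gt0 R.
have [del d0 H] := sk_equi sk (divr_gt0 e0 p0).
exists del => // f C bf fC a a' aa.
rewrite /Top -ISB; [|exact: bmfM (k_bmf a) _|exact: bmfM (k_bmf a') _].
rewrite (_ : e * C = (e / pi * C) * pi); last by rewrite mulrAC divfK ?gt_eqF.
apply: IS_norm_le.
  by apply: bmfB; apply: bmfM => //; exact: k_bmf.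
move=> x Sx; rewrite -mulrBl normrM ler_pM//; [exact: H|exact: fC].
Qed.

Lemma Top_ub f : bmf S f -> ub (Top f).
Proof.
move=> bf; have [_ [C fC]] := bf.
have C0 : 0 <= C by exact: le_trans (fC _ S0).
split; last by exists C => a; exact: Top_norm.
move=> e e0; have C1 : 0 < C + 1 by lra.
have [del d0 H] := Top_equi (divr_gt0 e0 C1).
exists del => // a a' aa; apply: (le_trans (H f C bf fC a a' aa)).
rewrite (@le_trans _ _ (e / (C + 1) * (C + 1)))//.
  by rewrite ler_pM2l ?divr_gt0//; lra.
by rewrite divfK// gt_eqF.
Qed.

Lemma ub_iter f n : ub f -> ub (iter n Top f).
Proof.
by move=> uf; elim: n => //= n IH; apply: Top_ub; apply: ub_bmf => //; exact: mS.
Qed.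

Lemma iter_norm f C n : ub f -> (forall x, `|f x| <= C) -> forall x, `|iter n Top f x| <= C.
Proof.
move=> uf fC; elim: n => //= n IH x; apply: Top_norm => // ; apply: ub_bmf; first exact: mS.
exact: ub_iter.
Qed.

Lemma ucv_Top U {UU : UltraFilter U} fn g a : (forall n, bmf S (fn n)) -> bmf S g ->
  ucv U fn g -> Top (fn n) a @[n --> U] --> Top g a.
Proof.
move=> bf bg cv; have := @ucv_int _ U UU fn g (k a) bf bg (k_bmf a) cv.
have E h : \int[leb]_(x in S) (k a x * h x) = \int[leb]_(x in S) (h x * k a x).
  by apply: eq_IS => x _; rewrite mulrC.
rewrite /Top E (_ : (fun n => \int[leb]_(x in S) (k a x * fn n x)) =
  fun n => \int[leb]_(x in S) (fn n x * k a x))//.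
by apply/funext => n; exact: E.
Qed.

(** The adjoint of [Top], acting on densities. *)
Definition Tadj p b : R := \int[leb]_(a in S) (p a * k a b).

(** These densities form an equicontinuous family, stable under [Tadj] and under means;
    the laws of the chain from the first step on belong to it. *)
Definition nice_density p := [/\ forall b, 0 <= p b, forall b, p b <= M,
  forall b b', `|p b - p b'| <= M * `|b - b'| & \int[leb]_(b in S) p b = 1].

Lemma nice_ub p : nice_density p -> ub p.
Proof.
move=> [p0 pM pl _]; split; first exact: (lip_ucont M0).
by exists M => x; rewrite ger0_norm.
Qed.

Lemma nice_bmf p : nice_density p -> bmf S p.
Proof. by move=> np; apply: ub_bmf; [exact: mS|exact: nice_ub]. Qed.

Let bmfT b : bmf S (fun a => k a b).
Proof.
split; last by exists M => a _; exact: k_norm.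
apply: measurable_funTS.
exact: (measurableT_comp (sk_meas sk) (@pair2_measurable _ _ R R b)).
Qed.

Lemma Tadj_duality p f : bmf S p -> bmf S f ->
  \int[leb]_(b in S) (Tadj p b * f b) = \int[leb]_(a in S) (p a * Top f a).
Proof.
by move=> bp bf; apply: duality2 => //; exact: bmf2_k.
Qed.

Lemma Tadj_nice p : nice_density p -> nice_density (Tadj p).
Proof.
move=> np; have [p0 pM pl p1] := np; have bp := nice_bmf np.
split => [b|b|b b'|].
- by apply: IS_ge0 => a _; rewrite mulr_ge0// (sk_ge0 sk).
- rewrite (@le_trans _ _ (\int[leb]_(a in S) (p a * M)))//.
    apply: le_IS => [||a _]; [exact: bmfM bp (bmfT b)| |].
      by apply: bmfM => //; exact: bmf_cst.
    by rewrite ler_wpM2l// (sk_le sk).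
  by rewrite ISZr// p1 mul1r.
- rewrite /Tadj -ISB; [|exact: bmfM bp (bmfT b)|exact: bmfM bp (bmfT b')].
  have bb : bmf S (fun a => p a * k a b - p a * k a b').
    by apply: bmfB; apply: bmfM => //; exact: bmfT.
  have bc c : bmf S (fun a => p a * c) by apply: bmfM => //; exact: bmf_cst.
  rewrite ler_norml; apply/andP; split.
    rewrite -[leLHS]mul1r -p1 -ISZr//; apply: le_IS => // a _.
    rewrite -mulrBr ler_wpM2l//.
    by have := sk_lip sk a b b'; rewrite ler_norml => /andP[].
  rewrite -[leRHS]mul1r -p1 -ISZr//; apply: le_IS => // a _.
  rewrite -mulrBr ler_wpM2l//.
  by have := sk_lip sk a b b'; rewrite ler_norml => /andP[].
- have := Tadj_duality bp (bmf_cst S 1).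
  rewrite (eq_IS (g := Tadj p)); last by move=> x _; rewrite mulr1.
  move=> ->; rewrite -[RHS]p1; apply: eq_IS => a _.
  by rewrite Top_cst mulr1.
Qed.

Lemma k_nice a : nice_density (k a).
Proof.
by split; [exact: (sk_ge0 sk)|exact: (sk_le sk)|exact: (sk_lip sk)|exact: (sk_mass sk)].
Qed.

Lemma nice_mean (F : nat -> R -> R) n : (forall i, nice_density (F i)) ->
  nice_density (fun b => n.+1%:R^-1 * \sum_(i < n.+1) F i b).
Proof.
move=> nF; have n0 : (0:R) < n.+1%:R^-1 by rewrite invr_gt0.
have nn : n.+1%:R^-1 * n.+1%:R = 1 :> R by rewrite mulVf// pnatr_eq0.
split => [b|b|b b'|].
- by apply: mulr_ge0; [exact: ltW | apply: sumr_ge0 => i _; case: (nF i)].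
- rewrite ler_pdivrMl ?ltr0Sn//.
  rewrite (le_trans (ler_sum _ (G := fun=> M) _))//; first by move=> i _; case: (nF i).
  by rewrite sumr_const card_ord mulr_natl.
- rewrite -mulrBr -sumrB normrM gtr0_norm// ler_pdivrMl ?ltr0Sn//.
  rewrite (le_trans (ler_norm_sum _ _ _))//.
  rewrite (le_trans (ler_sum _ (G := fun=> M * `|b - b'|) _))//; first by move=> i _; case: (nF i).
  by rewrite sumr_const card_ord mulr_natl.
- have bF i : bmf S (F i) by exact: nice_bmf.
  rewrite ISZ ?IS_sum//; last exact: bmf_sum.
  rewrite (eq_bigr (fun=> 1)); last by move=> i _; case: (nF i).
  by rewrite sumr_const card_ord.
Qed.

End Operator.

(** * The Poisson equation *)

Section Fredholm.
Context {R : realType} (theta0 M : R) (k k' : R -> R -> R) (varpi : R -> R).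
Hypothesis sk : smooth_kernel theta0 M k k'.
Notation leb := (@lebesgue_measure R).
Notation S := (@Sang R).
Implicit Types (f g p psi : R -> R) (a b x y : R).
Local Notation T := (Top k).

Hypothesis varpi_bmf : bmf S varpi.
Hypothesis varpi_mass : \int[leb]_(b in S) varpi b = 1.
Hypothesis varpi_inv : forall b, S b -> varpi b = Tadj k varpi b.
Hypothesis varpi_unique : forall p, nice_density M p ->
  (forall b, p b = Tadj k p b) -> forall f, ub f ->
  \int[leb]_(b in S) (p b * f b) = \int[leb]_(b in S) (varpi b * f b).

Let S0 : S 0.
Proof. by apply/SangP; rewrite normr0; have := @pi_gt0 R; lra. Qed.

Let ubS f : ub f -> bmf S f. Proof. by apply: ub_bmf; exact: mS. Qed.

Let bmfT f a : bmf S f -> bmf S (T f).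
Proof. by move=> bf; apply: ubS; exact: (Top_ub sk bf). Qed.

Lemma stationary_Top f : bmf S f ->
  \int[leb]_(a in S) (varpi a * T f a) = \int[leb]_(b in S) (varpi b * f b).
Proof.
move=> bf; rewrite -(Tadj_duality sk)//.
by apply: eq_IS => b Sb; rewrite -varpi_inv.
Qed.

Lemma stationary_iter f n : ub f ->
  \int[leb]_(a in S) (varpi a * iter n T f a) = \int[leb]_(b in S) (varpi b * f b).
Proof.
move=> uf; elim: n => //= n IH; rewrite stationary_Top//; apply: ubS.
exact: (ub_iter sk n uf).
Qed.

(** The Cesaro means of the law of the chain started from [a] have a limit point
    along an ultrafilter. It is an invariant density, hence integrates [f] as
    [varpi] does, while all the means integrate the harmonic [f] to [f a]. *)
Lemma harmonic_cst f a : ub f -> (forall x, S x -> T f x = f x) ->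
  S a -> f a = \int[leb]_(b in S) (varpi b * f b).
Proof.
move=> uf hf Sa; have [U UU Uoo] := @exists_ultra.
pose kn n := iter n (Tadj k) (k a).
have kn_nice n : nice_density M (kn n).
  by elim: n => [|n IH]; [exact: (k_nice sk a) | exact: (Tadj_nice sk IH)].
pose p n b := n.+1%:R^-1 * \sum_(i < n.+1) kn i b.
have p_nice n : nice_density M (p n) by exact: (nice_mean sk n kn_nice).
have M0 : 0 <= M by exact: (le_trans (sk_ge0 sk 0 0) (sk_le sk 0 0)).
have [q [qM uq qcv qucv]] : exists q, [/\ forall x, `|q x| <= M, ucont q,
    forall x, p n x @[n --> U] --> q x & ucv U p q].
  apply: ultra_ascoli.
    by move=> n x; case: (p_nice n) => h1 h2 _ _; rewrite ger0_norm.
  move=> e e0; have M1 : 0 < M + 1 by lra.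
  exists (e / (M + 1)); first by rewrite divr_gt0.
  move=> n x y xy; case: (p_nice n) => _ _ h _.
  rewrite (le_trans (h _ _))// (@le_trans _ _ ((M + 1) * (e / (M + 1))))//.
    by rewrite ler_pM//; lra.
  by rewrite mulrC divfK// gt_eqF.
have uubq : ub q by split => //; exists M.
have bp n := nice_bmf sk (p_nice n).
have cvint h : bmf S h -> \int[leb]_(x in S) (p n x * h x) @[n --> U] -->
    \int[leb]_(x in S) (q x * h x).
  by move=> bh; apply: ucv_int => //; exact: ubS.
have q_nice : nice_density M q.
  split=> [b|b|b b'|].
  - by apply: (cvg_ge_near (qcv b)); apply: nearW => n; case: (p_nice n).
  - exact: le_trans (ler_norm _) (qM b).
  - have c : `|p n b - p n b'| @[n --> U] --> `|q b - q b'|.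
      by apply: cvg_norm; apply: cvgB.
    by apply: (cvg_le_near c); apply: nearW => n; case: (p_nice n).
  - have := cvint _ (bmf_cst S 1).
    under eq_fun => n.
      rewrite (eq_IS (g := p n)); last by move=> x _; rewrite mulr1.
      case: (p_nice n) => _ _ _ ->; over.
    rewrite (eq_IS (g := q)); last by move=> x _; rewrite mulr1.
    by move=> c; rewrite -(cvg_lim _ c)// lim_cst.
have q_inv b : q b = Tadj k q b.
  have bk : bmf S (fun a => k a b).
    split; last by exists M => x _; exact: (k_norm sk x b).
    apply: measurable_funTS.
    exact: (measurableT_comp (sk_meas sk) (@pair2_measurable _ _ R R b)).
  have c1 := cvint _ bk.
  have E n : \int[leb]_(x in S) (p n x * k x b) - p n b =
      n.+1%:R^-1 * (kn n.+1 b - kn 0 b).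
    transitivity (n.+1%:R^-1 * (\sum_(i < n.+1) kn i.+1 b - \sum_(i < n.+1) kn i b)).
      rewrite mulrBr; congr (_ - _).
      rewrite (eq_IS (g := fun x => n.+1%:R^-1 * \sum_(i < n.+1) (kn i x * k x b))).
        have bi i : bmf S (fun x => kn i x * k x b).
          by apply: bmfM => //; exact: (nice_bmf sk (kn_nice i)).
        by rewrite (ISZ _ (bmf_sum n.+1 bi)) (IS_sum n.+1 bi).
      by move=> x _; rewrite /p -mulrA mulr_suml.
    congr (_ * _); rewrite -sumrB.
    rewrite -(big_mkord xpredT (fun i => kn i.+1 b - kn i b)).
    by rewrite telescope_sumr.
  have c2 : \int[leb]_(x in S) (p n x * k x b) - p n b @[n --> U] --> 0.
    apply: ultra_cvg_oo => //; under eq_fun do rewrite E.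
    apply/cvgr0Pnorm_le => e e0.
    have M1 : 0 < 2 * M + 1 by lra.
    near=> n; rewrite normrM gtr0_norm ?invr_gt0//.
    rewrite (@le_trans _ _ (e / (2 * M + 1) * (2 * M + 1)))//; last first.
      by rewrite divfK// gt_eqF.
    rewrite ler_pM//.
      near: n; apply: filterS (near_infty_natSinv_lt (PosNum (divr_gt0 e0 M1))) => n.
      exact: ltW.
    have [h1 h2 _ _] := kn_nice n.+1; have [h3 h4 _ _] := kn_nice 0%N.
    have := h1 b; have := h2 b; have := h3 b; have := h4 b.
    by move=> *; rewrite ler_norml; apply/andP; split; lra.
  have c3 : \int[leb]_(x in S) (p n x * k x b) - p n b @[n --> U] --> Tadj k q b - q b.
    exact: (cvgB c1 (qcv b)).
  have /eqP : 0 = Tadj k q b - q b by exact: (cvg_uniqR c2 c3).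
  by rewrite eq_sym subr_eq0 => /eqP ->.
rewrite -(varpi_unique q_nice q_inv uf).
have E n : \int[leb]_(x in S) (p n x * f x) = f a.
  have K i : \int[leb]_(x in S) (kn i x * f x) = f a.
    elim: i => [|i IH]; first by rewrite -[RHS]hf.
    rewrite (Tadj_duality sk (nice_bmf sk (kn_nice i)) (ubS uf)).
    by rewrite -IH; apply: eq_IS => x Sx; rewrite hf.
  rewrite (eq_IS (g := fun x => n.+1%:R^-1 * \sum_(i < n.+1) (kn i x * f x))).
    have bi i : bmf S (fun x => kn i x * f x).
      by apply: bmfM; [exact: (nice_bmf sk (kn_nice i))|exact: ubS].
    rewrite (ISZ _ (bmf_sum n.+1 bi)) (IS_sum n.+1 bi).
    rewrite (eq_bigr (fun=> f a)); last by move=> i _; exact: K.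
    by rewrite sumr_const card_ord -[f a *+ _]mulr_natl mulrA mulVf ?mul1r// pnatr_eq0.
  by move=> x _; rewrite /p -mulrA mulr_suml.
have := cvint _ (ubS uf); under eq_fun do rewrite E.
by move=> c; rewrite -(cvg_lim _ c)// lim_cst.
Unshelve. all: by end_near. Qed.

Lemma poisson_unique f psi1 psi2 : ub psi1 -> ub psi2 ->
  (forall x, S x -> psi1 x - T psi1 x = f x) ->
  (forall x, S x -> psi2 x - T psi2 x = f x) ->
  exists c, forall x, S x -> psi1 x = psi2 x + c.
Proof.
move=> u1 u2 h1 h2.
have u12 := ubB u1 u2.
exists (\int[leb]_(b in S) (varpi b * (psi1 b - psi2 b))) => x Sx.
rewrite -(@harmonic_cst (fun x => psi1 x - psi2 x) x u12)//; first by rewrite addrC subrK.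
move=> y Sy; rewrite (TopB sk); [|exact: ubS..].
by have := h1 y Sy; have := h2 y Sy; lra.
Qed.

Section Existence.
Variable f : R -> R.
Hypotheses (uf : ub f) (f0 : \int[leb]_(b in S) (varpi b * f b) = 0).

Let s j x := \sum_(i < j) iter i T f x.
Let psi_ n x := n.+1%:R^-1 * \sum_(j < n.+1) s j.+1 x.
Let a_ n x := T (fun y => n.+1%:R^-1 * \sum_(j < n.+1) iter j T f y) x.

Let ui i : ub (iter i T f). Proof. exact: (ub_iter sk i uf). Qed.
Let us j : ub (s j). Proof. exact: (ub_sum j ui). Qed.
Let upsi n : ub (psi_ n). Proof. exact: (ubZ _ (ub_sum n.+1 (fun j => us j.+1))). Qed.
Let um n : ub (fun y => n.+1%:R^-1 * \sum_(j < n.+1) iter j T f y).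
Proof. exact: (ubZ _ (ub_sum n.+1 ui)). Qed.
Let ua n : ub (a_ n). Proof. exact: (Top_ub sk (ubS (um n))). Qed.

Let aE n x : a_ n x = n.+1%:R^-1 * \sum_(j < n.+1) iter j.+1 T f x.
Proof.
rewrite /a_ (TopZ sk); last exact: (bmf_sum n.+1 (fun i => ubS (ui i))).
by rewrite (Top_sum sk n.+1 x (fun i => ubS (ui i))).
Qed.

Let sE j x : s j.+1 x - T (s j.+1) x = f x - iter j.+1 T f x.
Proof.
rewrite /s (Top_sum sk j.+1 x (fun i => ubS (ui i))) -sumrB.
rewrite -(big_mkord xpredT (fun i => iter i T f x - T (iter i T f) x)).
rewrite -[RHS]opprB -[iter j.+1 T f x - f x](telescope_sumr (fun i => iter i T f x) (leq0n j.+1)).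
by rewrite -sumrN; apply: eq_bigr => i _; rewrite opprB.
Qed.

Let psiE n x : psi_ n x - T (psi_ n) x = f x - a_ n x.
Proof.
have nn : n.+1%:R != 0 :> R by rewrite pnatr_eq0.
rewrite aE /psi_ (TopZ sk); last exact: (bmf_sum n.+1 (fun j => ubS (us j.+1))).
rewrite (Top_sum sk n.+1 x (fun j => ubS (us j.+1))) -mulrBr -sumrB.
rewrite (eq_bigr (fun j : 'I_n.+1 => f x - iter j.+1 T f x)); last by move=> j _; exact: sE.
by rewrite sumrB sumr_const card_ord mulrBr -[f x *+ _]mulr_natl mulrA mulVf// mul1r.
Qed.

Let psi_mean n : \int[leb]_(b in S) (varpi b * psi_ n b) = 0.
Proof.
have bs j : bmf S (fun b => varpi b * s j b) by apply: bmfM => //; exact: ubS.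
have E j : \int[leb]_(b in S) (varpi b * s j b) = 0.
  rewrite (eq_IS (g := fun b => \sum_(i < j) (varpi b * iter i T f b))).
    rewrite (IS_sum j (F := fun i b => varpi b * iter i T f b)).
      by rewrite big1// => i _; rewrite stationary_iter.
    by move=> i; apply: bmfM => //; exact: ubS.
  by move=> b _; rewrite mulr_sumr.
rewrite (eq_IS (g := fun b => n.+1%:R^-1 * \sum_(j < n.+1) (varpi b * s j.+1 b))).
  rewrite (ISZ _ (bmf_sum n.+1 (fun j => bs j.+1))) (IS_sum n.+1 (fun j => bs j.+1)).
  by rewrite big1 ?mulr0// => j _; exact: E.
by move=> b _; rewrite /psi_ mulrCA mulr_sumr.
Qed.

Let norm_mean (C : R) n x : (forall i y, `|iter i T f y| <= C) ->
  `|n.+1%:R^-1 * \sum_(j < n.+1) iter j T f x| <= C.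
Proof.
move=> H; rewrite normrM gtr0_norm ?invr_gt0// ler_pdivrMl ?ltr0Sn//.
rewrite (le_trans (ler_norm_sum _ _ _))//.
rewrite (le_trans (ler_sum _ (G := fun=> C) _))//.
by rewrite sumr_const card_ord mulr_natl.
Qed.

Let T_ascoli U (UU : UltraFilter U) (fn : nat -> R -> R) (C : R) :
  (forall n, bmf S (fn n)) -> (forall n x, S x -> `|fn n x| <= C) ->
  exists g, [/\ ub g, forall x, T (fn n) x @[n --> U] --> g x & ucv U (fun n => T (fn n)) g].
Proof.
move=> bf fC.
have C0 : 0 <= C by exact: (le_trans _ (fC 0%N _ S0)).
have [g [gM ug gcv gucv]] : exists g, [/\ forall x, `|g x| <= C, ucont g,
    forall x, T (fn n) x @[n --> U] --> g x & ucv U (fun n => T (fn n)) g].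
  apply: ultra_ascoli; first by move=> n x; exact: (Top_norm sk _ (bf n) (fC n)).
  move=> e e0; have C1 : 0 < C + 1 by lra.
  have [del d0 H] := Top_equi sk (divr_gt0 e0 C1).
  exists del => // n x y xy; apply: (le_trans (H _ _ (bf n) (fC n) _ _ xy)).
  rewrite (@le_trans _ _ (e / (C + 1) * (C + 1)))//.
    by rewrite ler_pM2l ?divr_gt0//; lra.
  by rewrite divfK// gt_eqF.
by exists g; split => //; split => //; exists C.
Qed.

Let a_cv U (UU : UltraFilter U) : \oo `<=` U -> ucv U a_ (fun=> 0).
Proof.
move=> Uoo; have [_ [C fC]] := uf.
have C0 : 0 <= C by exact: (le_trans _ (fC 0)).
have iC i y : `|iter i T f y| <= C by exact: (iter_norm sk i uf fC y).
have [g [ug gcv gucv]] := @T_ascoli U UU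
  (fun n y => n.+1%:R^-1 * \sum_(j < n.+1) iter j T f y) C
  (fun n => ubS (um n)) (fun n x _ => norm_mean n x iC).
have hg x : S x -> T g x = g x.
  move=> Sx.
  have c1 : T (a_ n) x @[n --> U] --> T g x.
    by apply: (ucv_Top sk) => //; [move=> n; exact: ubS|exact: ubS].
  have c2 : T (a_ n) x - a_ n x @[n --> U] --> T g x - g x by exact: (cvgB c1 (gcv x)).
  have E n : T (a_ n) x - a_ n x = n.+1%:R^-1 * (iter n.+2 T f x - iter 1 T f x).
    rewrite (@eq_Top _ k _ (fun x => n.+1%:R^-1 * \sum_(j < n.+1) iter j.+1 T f x)); last first.
      by move=> y _; exact: aE.
    rewrite (TopZ sk); last exact: (bmf_sum n.+1 (fun i => ubS (ui i.+1))).
    rewrite (Top_sum sk n.+1 x (fun i => ubS (ui i.+1))) aE -mulrBr -sumrB; congr (_ * _).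
    rewrite -(big_mkord xpredT (fun i => T (iter i.+1 T f) x - iter i.+1 T f x)).
    exact: (telescope_sumr (fun i => iter i.+1 T f x) (leq0n n.+1)).
  have c3 : T (a_ n) x - a_ n x @[n --> U] --> 0.
    apply: ultra_cvg_oo => //; under eq_fun do rewrite E.
    apply/cvgr0Pnorm_le => e e0.
    have C1 : 0 < 2 * C + 1 by lra.
    near=> n; rewrite normrM gtr0_norm ?invr_gt0//.
    rewrite (@le_trans _ _ (e / (2 * C + 1) * (2 * C + 1)))//; last first.
      by rewrite divfK// gt_eqF.
    rewrite ler_pM//.
      near: n; apply: filterS (near_infty_natSinv_lt (PosNum (divr_gt0 e0 C1))) => n.
      exact: ltW.
    rewrite (le_trans (ler_normB _ _))//.
    by have := iC n.+2 x; have := iC 1%N x; lra.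
  have /eqP : T g x - g x = 0 by exact: (cvg_uniqR c2 c3).
  by rewrite subr_eq0 => /eqP.
have g0 : \int[leb]_(b in S) (varpi b * g b) = 0.
  have c := @ucv_int _ U UU _ _ _ (fun n => ubS (ua n)) (ubS ug) varpi_bmf gucv.
  have E n : \int[leb]_(x in S) (a_ n x * varpi x) = 0.
    rewrite (eq_IS (g := fun x => varpi x * a_ n x)); last by move=> x _; rewrite mulrC.
    rewrite stationary_Top; last exact: ubS.
    rewrite (eq_IS (g := fun b => n.+1%:R^-1 * \sum_(j < n.+1) (varpi b * iter j T f b))).
      have bi i : bmf S (fun b => varpi b * iter i T f b) by apply: bmfM => //; exact: ubS.
      rewrite (ISZ _ (bmf_sum n.+1 bi)) (IS_sum n.+1 bi).
      by rewrite big1 ?mulr0// => j _; rewrite stationary_iter.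
    by move=> b _; rewrite mulrCA mulr_sumr.
  move: c; under eq_fun do rewrite E.
  move=> c; have E0 : \int[leb]_(x in S) (g x * varpi x) = 0.
    exact: (cvg_uniqR c (cvg_cst 0)).
  by rewrite -[RHS]E0; apply: eq_IS => x _; rewrite mulrC.
move=> e e0; apply: filterS (gucv e e0) => n H x Sx.
by have := H x Sx; rewrite (harmonic_cst ug hg Sx) g0.
Unshelve. all: by end_near. Qed.

(** The Cesaro means [psi_] of the partial sums of the Neumann series solve the
    equation up to the error [a_], which tends to 0. If they stay bounded along the
    ultrafilter, compactness gives a solution; if not, their normalisations
    converge to a nonzero harmonic function of mean zero, which is impossible. *)
Lemma poisson_exists : exists2 psi, ub psi & forall x, psi x - T psi x = f x.
Proof.
have [U UU Uoo] := @exists_ultra.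
have p0 := @pi_gt0 R.
have le : - (pi / 2) <= pi / 2 :> R by lra.
have /choice[x_ Hx] n : exists c : R, S c /\ forall t, S t -> `|psi_ n t| <= `|psi_ n c|.
  have cn : {within S, continuous (fun x => `|psi_ n x|)}.
    apply: continuous_subspaceT => x.
    apply: (@continuous_comp _ _ _ (psi_ n) Num.norm); last exact: norm_continuous.
    by apply: ucont_continuous; case: (upsi n).
  by have [c cS H] := EVT_max le cn; exists c.
pose m n := `|psi_ n (x_ n)|.
have acv := a_cv UU Uoo.
have [[C UC]|nC] := pselect (exists C : R, U [set n | m n <= C]).
  pose fn n := if m n <= C then psi_ n else fun=> 0.
  have ufn n : ub (fn n) by rewrite /fn; case: ifP => _; [exact: upsi | exact: ub_cst].
  have fnC n x : S x -> `|fn n x| <= `|C|.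
    rewrite /fn => Sx; case: ifPn => h; last by rewrite normr0.
    by rewrite (le_trans ((Hx n).2 x Sx))// (le_trans h)// ler_norm.
  have [h [uh hcv hucv]] := @T_ascoli U UU fn `|C| (fun n => ubS (ufn n)) fnC.
  exists (fun x => h x + f x); first exact: ubD.
  have fcv : ucv U fn (fun x => h x + f x).
    move=> e e0; have e2 : 0 < e / 2 by lra.
    near=> n => x Sx.
    have fE : fn n = psi_ n by rewrite /fn ifT//; near: n.
    have h1 : `|T (fn n) x - h x| <= e / 2 by move: (x) (Sx); near: n; exact: hucv _ e2.
    have h2 : `|a_ n x - 0| <= e / 2 by move: (x) (Sx); near: n; exact: acv _ e2.
    rewrite subr0 in h2; have := psiE n x; rewrite -fE => /eqP; rewrite subr_eq => /eqP ->.
    rewrite (_ : _ - _ = (T (fn n) x - h x) - a_ n x); last by ring.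
    by rewrite (le_trans (ler_normB _ _))//; lra.
  move=> x; have c : T (fn n) x @[n --> U] --> T (fun x => h x + f x) x.
    by apply: (ucv_Top sk) => //; [move=> n; exact: ubS|exact: (ubS (ubD uh uf))].
  by rewrite (cvg_uniqR c (hcv x)); ring.
have {}nC C : \forall n \near U, C < m n.
  have [h|h] := in_ultra_setVsetC [set n | m n <= C] UU.
    by exfalso; apply: nC; exists C.
  by apply: filterS h => n /negP; rewrite -ltNge.
exfalso.
pose v n x := (m n)^-1 * psi_ n x.
have uv n : ub (v n) by exact: ubZ.
have v1 n x : S x -> `|v n x| <= 1.
  move=> Sx; rewrite /v normrM normfV normr_id -/(m n).
  have [->|m0] := eqVneq (m n) 0; first by rewrite invr0 mul0r.
  have m0' : 0 < m n by rewrite lt_neqAle eq_sym m0 normr_ge0.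
  by rewrite ler_pdivrMl// mulr1; exact: (Hx n).2.
have [h [uh hcv hucv]] := @T_ascoli U UU v 1 (fun n => ubS (uv n)) v1.
have [_ [C fC]] := uf.
have C0 : 0 <= C by exact: (le_trans _ (fC 0)).
have vcv : ucv U v h.
  move=> e e0; have e2 : 0 < e / 2 by lra.
  near=> n => x Sx.
  have m1 : (C + 1) / (e / 2) < m n by near: n; exact: nC.
  have m0 : 0 < m n by rewrite (le_lt_trans _ m1)// divr_ge0//; lra.
  have h1 : `|T (v n) x - h x| <= e / 2 by move: (x) (Sx); near: n; exact: hucv _ e2.
  have h2 : `|a_ n x - 0| <= 1 by move: (x) (Sx); near: n; exact: acv _ ltr01.
  rewrite subr0 in h2.
  have vE : v n x = T (v n) x + (m n)^-1 * (f x - a_ n x).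
    have TE : T (v n) x = (m n)^-1 * T (psi_ n) x by exact: (TopZ sk _ _ (ubS (upsi n))).
    by rewrite TE /v -mulrDr; congr (_ * _); have := psiE n x; lra.
  rewrite vE (_ : _ - _ = (T (v n) x - h x) + (m n)^-1 * (f x - a_ n x)); last by ring.
  have h3 : `|(m n)^-1 * (f x - a_ n x)| <= e / 2.
    rewrite normrM normfV (gtr0_norm m0) ler_pdivrMl//.
    rewrite (le_trans (ler_normB _ _))//.
    move: m1; rewrite ltr_pdivrMr// => m1.
    by have := fC x; lra.
  by rewrite (le_trans (ler_normD _ _))//; lra.
have hh x : S x -> T h x = h x.
  move=> Sx; have c : T (v n) x @[n --> U] --> T h x.
    by apply: (ucv_Top sk) => //; [move=> n; exact: ubS|exact: ubS].
  exact: (cvg_uniqR c (hcv x)).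
have h0 : \int[leb]_(b in S) (varpi b * h b) = 0.
  have c := @ucv_int _ U UU _ _ _ (fun n => ubS (uv n)) (ubS uh) varpi_bmf vcv.
  have E n : \int[leb]_(x in S) (v n x * varpi x) = 0.
    rewrite (eq_IS (g := fun x => (m n)^-1 * (varpi x * psi_ n x))).
      by rewrite ISZ ?psi_mean ?mulr0//; apply: bmfM => //; exact: ubS.
    by move=> x _; rewrite /v; ring.
  move: c; under eq_fun do rewrite E.
  move=> c; have E0 : \int[leb]_(x in S) (h x * varpi x) = 0.
    exact: (cvg_uniqR c (cvg_cst 0)).
  by rewrite -[RHS]E0; apply: eq_IS => x _; rewrite mulrC.
have : \forall n \near U, False.
  have half0 : 0 < 2^-1 :> R by rewrite invr_gt0.
  near=> n.
  have m0 : 0 < m n by near: n; exact: nC.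
  have : `|v n (x_ n) - h (x_ n)| <= 2^-1.
    move: (x_ n) (Hx n).1; near: n; exact: vcv _ half0.
  rewrite (harmonic_cst uh hh (Hx n).1) h0 subr0 /v normrM normfV normr_id -/(m n).
  by rewrite mulVf ?gt_eqF//; lra.
by move=> /filter_ex[].
Unshelve. all: by end_near. Qed.

End Existence.

End Fredholm.

(** * Regularity of the reflection density *)

Section MeanValue.
Context {R : realType}.
Implicit Types (f df : R -> R).

Lemma derive_continuous f df : (forall x : R, is_derive x (1 : R) f (df x)) -> continuous f.
Proof.
move=> Hf x; apply: differentiable_continuous; apply/derivable1_diffP.
exact: (@ex_derive _ _ _ _ _ _ _ (Hf x)).
Qed.

Lemma MVT_R f df (x y : R) : (forall x : R, is_derive x (1 : R) f (df x)) ->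
  exists2 c, `|c - x| <= `|y - x| & f y - f x = df c * (y - x).
Proof.
move=> Hf; have [xy|yx] := leP x y.
  have [c cxy E] := MVT_segment xy (fun z _ => Hf z)
    (continuous_subspaceT (derive_continuous Hf)).
  exists c => //; move: cxy; rewrite in_itv/= => /andP[h1 h2].
  by rewrite !ger0_norm ?subr_ge0//; lra.
have [c cxy E] := MVT_segment (ltW yx) (fun z _ => Hf z)
  (continuous_subspaceT (derive_continuous Hf)).
exists c; last lra.
move: cxy; rewrite in_itv/= => /andP[h1 h2].
by rewrite !ler0_norm ?subr_le0//; lra.
Qed.

Lemma derive_lip f df (M : R) : (forall x : R, is_derive x (1 : R) f (df x)) ->
  (forall x, `|df x| <= M) -> forall x y, `|f x - f y| <= M * `|x - y|.
Proof.
move=> Hf dM x y; have [c _ ->] := MVT_R y x Hf.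
by rewrite normrM ler_wpM2r.
Qed.

Lemma derive_taylor2 f df (M : R) : (forall x : R, is_derive x (1 : R) f (df x)) ->
  (forall x y, `|df x - df y| <= M * `|x - y|) ->
  forall b h, `|f (b - h) - f b + h * df b| <= M * h ^+ 2.
Proof.
move=> Hf dM b h; have [c cb E] := MVT_R b (b - h) Hf.
have M0 : 0 <= M.
  by have := dM 1 0; rewrite subr0 normr1 mulr1; apply: le_trans.
rewrite E (_ : b - h - b = - h) in cb *; last by ring.
rewrite (_ : _ + _ = h * (df b - df c)); last by ring.
rewrite normrM (le_trans (ler_wpM2l _ (dM _ _)))//.
rewrite -real_normK ?num_real// expr2 mulrCA ler_wpM2l// ler_wpM2l//.
by move: cb; rewrite normrN distrC.
Qed.

(** A neighbourhood of an interior point lies in [Sang], so the limit of difference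
    quotients within [Sang] is the usual derivative. *)
Lemma is_derive_of_quotient f (x l : R) : `|x| < pi / 2 ->
  quotientS f x y @[y --> within Sang x^'] --> l -> is_derive x 1 f l.
Proof.
move=> xpi cvl.
have cv : (fun h => h^-1 *: ((f \o shift x) (h *: 1) - f x)) @ 0^' --> l.
  apply/cvgrPdist_le => e e0.
  have /cvgrPdist_le/(_ e e0) := cvl.
  rewrite /within /= => -[d /= d0 Hd].
  pose d' := Num.min d (pi / 2 - `|x|).
  have d'0 : 0 < d' by rewrite lt_min d0 subr_gt0.
  exists d' => //= h; rewrite /ball_/= sub0r normrN lt_min => /andP[hd hx] h0.
  have := Hd (h + x); rewrite /ball_/= opprD addrCA addrN addr0 normrN => /(_ hd).
  rewrite -subr_eq0 addrK => /(_ h0).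
  have S1 : Sang (h + x).
    apply/SangP; rewrite (le_trans (ler_normD _ _))//; lra.
  move=> /(_ S1); rewrite /quotientS addrK.
  by rewrite /= /GRing.scale/= mulr1 mulrC.
have dv : derivable f x 1 by apply/cvg_ex; exists l.
by split => //; exact: (cvg_lim _ cv).
Qed.

Lemma derivableS_is_derive f (x : R) : `|x| < pi / 2 -> derivableS f x ->
  is_derive x 1 f (deriveS f x).
Proof. by move=> xpi /(is_derive_of_quotient xpi). Qed.

Lemma deriveS_eq f (x l : R) : `|x| < pi / 2 ->
  (forall e : R, 0 < e -> exists2 d : R, 0 < d & forall y, `|y - x| < d -> y != x ->
    Sang y -> `|quotientS f x y - l| <= e) -> deriveS f x = l.
Proof.
move=> xpi H.
have cv : quotientS f x y @[y --> within Sang x^'] --> l.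
  apply/cvgrPdist_le => e e0; have [d d0 Hd] := H e e0.
  exists d => //= y /=; rewrite distrC => yd yx Sy; rewrite distrC; exact: Hd.
have d1 := is_derive_of_quotient xpi cv.
have : derivableS f x by apply/cvg_ex; exists l.
move=> /(derivableS_is_derive xpi) d2.
by rewrite -(@derive_val _ _ _ _ _ _ _ d1) -(@derive_val _ _ _ _ _ _ _ d2).
Qed.

End MeanValue.

Section KernelOfHypotheses.
Context {R : realType} (theta0 : R) (K : R.-pker R ~> R) (kappa : R -> R -> R).
Hypotheses (th0 : 0 < theta0 < pi / 2) (B0 : markov_on_S K) (B1 : hypB1 theta0 K)
  (B2 : hypB2 K kappa) (B5 : hypB5 kappa).
Notation leb := (@lebesgue_measure R).
Notation S := (@Sang R).
Implicit Types (a b x y : R).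

Let p0 : (0:R) < pi. Proof. exact: pi_gt0. Qed.

Lemma kappa_section_measurable a : S a -> measurable_fun S (kappa a).
Proof.
move=> Sa; have mk := kappa_measurable B2.
have : measurable_fun S ((fun p : R * R => kappa p.1 p.2) \o (fun b => (a, b))).
  apply: (@measurable_comp _ _ _ _ _ _ (S `*` S) _ _ (pair a)) => //.
  - by apply: measurableX; exact: mS.
  - by move=> _ [b Sb <-].
  - by apply: measurable_funTS; exact: pair1_measurable.
exact.
Qed.

(** By continuity a positive value would persist on an interval outside
    [Sang0 theta0], which has probability zero by [hypB1]. *)
Lemma kappa_supp a b : S a -> S b -> theta0 < `|b| -> kappa a b = 0.
Proof.
move=> Sa Sb tb; apply/eqP; rewrite eq_le (kappa_ge0 B2)// andbT leNgt; apply/negP => k0.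
have [del [d0 H _]] := kappa_equicontinuous B2 (divr_gt0 k0 (ltr0n R 2)).
have/andP[t0 t1] := th0.
pose c := Num.max ((theta0 + `|b|) / 2) (`|b| - del).
have cb : c < `|b| by rewrite /c gt_max; apply/andP; split; lra.
have tc : theta0 < c by rewrite /c lt_max; apply/orP; left; lra.
have bpi : `|b| <= pi / 2 by apply/SangP.
(* J ends at b and lies between b and the cone, within the modulus del *)
have [J [mJ lJ JP]] : exists J : set R, [/\ measurable J, leb J = (`|b| - c)%:E &
    forall x, J x -> [/\ S x, theta0 < `|x| & `|x - b| <= del]].
  have c1 : `|b| - del <= c by rewrite /c le_max lexx orbT.
  have [b0|b0] := leP 0 b.
    exists `[c, b]%classic; split; first exact: measurable_itv.
      rewrite lebesgue_measure_itv/= lte_fin; rewrite ger0_norm// in cb *.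
      by rewrite cb.
    move=> x; rewrite /= in_itv/= => /andP[x1 x2]; rewrite ger0_norm// in bpi c1.
    split; last by rewrite ler_norml; apply/andP; split; lra.
      by apply/SangP; rewrite ler_norml; apply/andP; split; lra.
    by rewrite (lt_le_trans tc)// (le_trans x1)// ler_norm.
  exists `[b, - c]%classic; split; first exact: measurable_itv.
    rewrite lebesgue_measure_itv/= lte_fin; rewrite ltr0_norm// in cb *.
    rewrite (_ : b < - c); last lra.
    by rewrite -EFinD; congr EFin; lra.
  move=> x; rewrite /= in_itv/= => /andP[x1 x2]; rewrite ltr0_norm// in bpi c1.
  split; last by rewrite ler_norml; apply/andP; split; lra.
    by apply/SangP; rewrite ler_norml; apply/andP; split; lra.
  by rewrite ltr0_norm; lra.
have JS : J `<=` S by move=> x /JP[].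
have mS0 : measurable (Sang0 theta0) by exact: measurable_itv.
have KJ0 : K a J = 0%E.
  have dis : [disjoint J & Sang0 theta0].
    apply/disj_setPLR => x /JP[_ tx _]; rewrite /Sang0 /= in_itv/= -ler_norml => h.
    by move: tx; rewrite ltNge h.
  have : (K a (J `|` Sang0 theta0) <= 1)%E.
    rewrite -(prob_kernel (s := K) a); apply: le_measure; rewrite ?inE//.
    exact: measurableU.
  rewrite measureU//; last by apply/disj_set2P.
  rewrite [X in (K a J + X)%R](_ : _ = 1%E); last exact: (B1 Sa).
  move=> h; apply/eqP; rewrite eq_le measure_ge0 andbT.
  by move: h; rewrite -[leRHS]add0e leeD2rE.
have : ((kappa a b / 2 * (`|b| - c))%:E <= K a J)%E.
  rewrite (kappa_density B2)// EFinM -lJ -integral_cst//.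
  apply: ge0_le_integral => //.
  - by move=> x _; rewrite lee_fin divr_ge0// ltW.
  - by apply/measurable_EFinP; apply: measurable_funS (kappa_section_measurable Sa) => //; exact: mS.
  - move=> x /JP[Sx _ xb]; rewrite lee_fin.
    have := H _ _ Sx Sb xb _ Sa.
    by rewrite ler_norml => /andP[? ?]; lra.
rewrite KJ0 lee_fin leNgt => /negP; apply.
by rewrite mulr_gt0 ?divr_gt0// subr_gt0.
Qed.

(** Since [kappa a] vanishes beyond [theta0 < pi / 2], extending it by zero keeps it
    twice differentiable in its second argument on the whole line. *)
Definition kt a b : R := if `|b| < pi / 2 then kappa (clamp a) b else 0.
Definition kt' a b : R := if `|b| < pi / 2 then deriveS (kappa (clamp a)) b else 0.
Let kt'' a b : R := if `|b| < pi / 2 then deriveS (deriveS (kappa (clamp a))) b else 0.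

Lemma kt_supp a b : theta0 < `|b| -> kt a b = 0.
Proof.
move=> tb; rewrite /kt; case: ifPn => // bp; apply: kappa_supp => //.
- exact: clamp_S.
- by apply/SangP; exact: ltW.
Qed.

Lemma ktE a b : S a -> S b -> kt a b = kappa a b.
Proof.
move=> Sa /[dup] Sb /SangP bp; rewrite /kt clamp_id//; case: ifPn => //.
rewrite -leNgt => bp'; rewrite kappa_supp//.
by have/andP[_ t1] := th0; exact: lt_le_trans bp'.
Qed.

Let lt_near (x c : R) : `|x| < c -> \forall y \near x, `|y| < c.
Proof.
move=> xc; near=> y.
have : `|x - y| < c - `|x| by near: y; apply: cvgr_dist_lt => //; rewrite subr_gt0.
have : `|y| <= `|x| + `|x - y|.
  by rewrite -[y in leLHS](subKr x) ler_normB.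
lra.
Unshelve. all: by end_near. Qed.

Let gt_near (x c : R) : c < `|x| -> \forall y \near x, c < `|y|.
Proof.
move=> xc; near=> y.
have : `|x - y| < `|x| - c by near: y; apply: cvgr_dist_lt => //; rewrite subr_gt0.
have : `|x| <= `|y| + `|x - y|.
  by rewrite -[x in leLHS](subrK y) addrC ler_normD.
lra.
Unshelve. all: by end_near. Qed.

Let far_case a x : theta0 < `|x| -> is_derive x (1 : R) (kt a) 0.
Proof.
move=> tx; apply: (@near_eq_is_derive _ _ _ (cst 0)).
by apply: filterS (gt_near tx) => y ty; rewrite kt_supp.
Qed.

Let near_case a x : `|x| < pi / 2 ->
  is_derive x (1 : R) (kt a) (deriveS (kappa (clamp a)) x).
Proof.
move=> xp; apply: (@near_eq_is_derive _ _ _ (kappa (clamp a))).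
  by apply: filterS (lt_near xp) => y yp; rewrite /kt yp.
apply: derivableS_is_derive => //; apply: (kappa_derivable B5); first exact: clamp_S.
by apply/SangP; exact: ltW.
Qed.

Lemma kt'_supp a b : theta0 < `|b| -> kt' a b = 0.
Proof.
move=> tb; rewrite /kt'; case: ifPn => // bp.
have d1 := far_case a tb; have d2 := near_case a bp.
by rewrite -(@derive_val _ _ _ _ _ _ _ d1) -(@derive_val _ _ _ _ _ _ _ d2).
Qed.

Lemma kt_derive a x : is_derive x (1 : R) (kt a) (kt' a x).
Proof.
have [xp|px] := ltP `|x| (pi / 2); first by rewrite /kt' xp; exact: near_case.
have tx : theta0 < `|x| by have/andP[_ t1] := th0; exact: lt_le_trans px.
by rewrite kt'_supp//; exact: far_case.
Qed.

Let kt'_derive a x : is_derive x (1 : R) (kt' a) (kt'' a x).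
Proof.
have [xp|px] := ltP `|x| (pi / 2).
  rewrite /kt'' xp.
  apply: (@near_eq_is_derive _ _ _ (deriveS (kappa (clamp a)))).
    by apply: filterS (lt_near xp) => y yp; rewrite /kt' yp.
  apply: derivableS_is_derive => //; apply: (kappa_derivable2 B5); first exact: clamp_S.
  by apply/SangP; exact: ltW.
rewrite /kt'' ltNge px /=.
have tx : theta0 < `|x| by have/andP[_ t1] := th0; exact: lt_le_trans px.
apply: (@near_eq_is_derive _ _ _ (cst 0)).
by apply: filterS (gt_near tx) => y ty; rewrite kt'_supp.
Qed.

Lemma measurable_clamp : measurable_fun setT (@clamp R).
Proof.
apply: continuous_measurable_fun; apply: ucont_continuous => e e0.
by exists e => // x y; apply: le_trans; exact: clamp_lip.
Qed.

Lemma measurable_kt : measurable_fun setT (fun p : R * R => kt p.1 p.2).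
Proof.
have mc1 : measurable_fun setT (fun p : R * R => (clamp p.1, clamp p.2)).
  apply/measurable_fun_pairP; split => /=.
    exact: (measurableT_comp measurable_clamp measurable_fst).
  exact: (measurableT_comp measurable_clamp measurable_snd).
have m1 : measurable_fun setT (fun p : R * R => kappa (clamp p.1) (clamp p.2)).
  apply: (@measurable_comp _ _ _ _ _ _ (S `*` S) (fun p : R * R => kappa p.1 p.2) setT
    (fun p : R * R => (clamp p.1, clamp p.2))) => //.
  - by apply: measurableX; exact: mS.
  - by move=> _ [[a b] _ <-]; split; exact: clamp_S.
  - exact: (kappa_measurable B2).
rewrite (_ : (fun p => _) = fun p : R * R =>
  if `|p.2| < pi / 2 then kappa (clamp p.1) (clamp p.2) else 0).
  apply: measurable_fun_ifT => //.
  apply: measurable_fun_ltr => //.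
  by apply: measurableT_comp => //; exact: measurable_snd.
apply/funext => -[a b] /=; rewrite /kt; case: ifPn => // bp.
by rewrite [clamp b]clamp_id//; apply/SangP; exact: ltW.
Qed.

Lemma smooth_kernel_exists : exists M, smooth_kernel theta0 M kt kt'.
Proof.
have [M1 HM1] := kappa_bounded B2.
have [_ _ [M2 HM2]] := kappa'_regular B5.
have [_ _ [M3 HM3]] := kappa''_regular B5.
have SpI b : `|b| < pi / 2 -> S b by move=> /ltW /SangP.
exists (`|M1| + `|M2| + `|M3|).
have l1 := normr_ge0 M1; have l2 := normr_ge0 M2; have l3 := normr_ge0 M3.
have n1 := ler_norm M1; have n2 := ler_norm M2; have n3 := ler_norm M3.
split.
- move=> a b; rewrite /kt; case: ifPn => // bp; apply: (kappa_ge0 B2); first exact: clamp_S.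
  exact: SpI.
- move=> a b; rewrite /kt; case: ifPn => // bp.
  by have := HM1 _ _ (clamp_S a) (SpI _ bp); lra.
- exact: kt_supp.
- move=> a; have Sa := @clamp_S _ a.
  transitivity (fine (K (clamp a) S)); last by rewrite B0.
  rewrite (kappa_density B2)//; last exact: mS.
  congr fine; apply: eq_integral => b /set_mem Sb.
  by rewrite -[in RHS]ktE// /kt [clamp (clamp a)]clamp_id.
- exact: measurable_kt.
- move=> e e0; have [del [d0 _ H]] := kappa_equicontinuous B2 e0.
  exists del => // a a' b aa; rewrite /kt; case: ifPn => bp; last by rewrite subrr normr0 ltW.
  apply: H; [exact: clamp_S|exact: clamp_S| |exact: SpI].
  exact: le_trans (clamp_lip _ _) aa.
- move=> a; apply: derive_lip (kt_derive a) _ => x; rewrite /kt'.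
  case: ifPn => xp; last by rewrite normr0; lra.
  by have := HM2 _ _ (clamp_S a) (SpI _ xp); lra.
- move=> a; apply: derive_taylor2 (kt_derive a) _.
  apply: derive_lip (kt'_derive a) _ => x; rewrite /kt''.
  case: ifPn => xp; last by rewrite normr0; lra.
  by have := HM3 _ _ (clamp_S a) (SpI _ xp); lra.
Qed.

End KernelOfHypotheses.

(** * The stationary density *)

Section DensityInt.
Context {R : realType}.
Notation leb := (@lebesgue_measure R).
Notation S := (@Sang R).
Variables (m : {measure set R -> \bar R}) (p : R -> R).
Hypotheses (bp : bmf S p) (p0 : forall x, S x -> 0 <= p x).
Hypothesis mE : forall B, measurable B -> B `<=` S ->
  m B = (\int[leb]_(x in B) (p x)%:E)%E.

Lemma eint_density (f : R -> R) : bmf S f -> (forall x, S x -> 0 <= f x) ->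
  (\int[m]_(x in S) (f x)%:E)%E = (\int[leb]_(x in S) (f x * p x))%:E.
Proof.
move=> bf f0; rewrite IS_EFin; last exact: bmfM.
(* m and leb live on two copies of the Borel line; j transports m to that of leb *)
pose j : R -> measurableTypeR R := id.
have mj : measurable_fun setT j by exact: measurable_id.
have mf : measurable_fun S (EFin \o f) by apply/measurable_EFinP; case: bf.
have f0' : forall x, S x -> (0 <= (EFin \o f) x)%E by move=> x Sx; rewrite lee_fin f0.
have f0in : {in S, forall x, (0 <= (EFin \o f) x)%E} by move=> x /set_mem; exact: f0'.
transitivity (\int[m]_(x in j @^-1` S) ((EFin \o f) \o j) x)%E; first by [].
rewrite -(@ge0_integral_pushforward _ _ _ _ _ j mj m S (EFin \o f) mS mf f0in).
rewrite (@integral_density _ _ _ _ leb S p mS bp.1 p0 _ (EFin \o f) mf f0').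
  by apply: eq_integral => x _; rewrite /= EFinM.
by move=> B mB BS; exact: mE.
Qed.

Lemma density_lty : (m S < +oo)%E.
Proof. by rewrite mE//; [rewrite -IS_EFin// ltry|exact: mS]. Qed.

Lemma rint_density (f : R -> R) : bmf S f ->
  \int[m]_(x in S) f x = \int[leb]_(x in S) (f x * p x).
Proof.
move=> bf; have [mf [C fC]] := bf.
have C0 : 0 <= C.
  apply: le_trans (fC 0 _) => //.
  by apply/SangP; rewrite normr0; have := @pi_gt0 R; lra.
have bc : bmf S (fun=> C) by exact: bmf_cst.
have bfc := bmfD bf bc.
have E (g : R -> R) : bmf S g -> (forall x, S x -> 0 <= g x) ->
    \int[m]_(x in S) g x = \int[leb]_(x in S) (g x * p x).
  by move=> bg g0; rewrite /Rintegral eint_density.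
have -> : \int[m]_(x in S) f x = \int[m]_(x in S) ((f x + C) - C).
  by apply: eq_Rintegral => x _; rewrite addrK.
rewrite (fintB mS density_lty bfc bc) !E//; last first.
  by move=> x Sx; have := fC x Sx; rewrite ler_norml => /andP[]; lra.
rewrite -ISB; [|exact: bmfM..].
by apply: eq_IS => x _; ring.
Qed.

End DensityInt.

Section ProbabilityOfDensity.
Context {R : realType}.
Notation leb := (@lebesgue_measure R).
Notation S := (@Sang R).
Variable p : R -> R.

Definition density_measure (bp : bmf S p) (p0 : forall x, S x -> 0 <= p x)
  (p1 : \int[leb]_(x in S) p x = 1) : set R -> \bar R :=
  fun B => (\int[leb]_(x in B `&` S) (p x)%:E)%E.

Hypotheses (bp : bmf S p) (p0 : forall x, S x -> 0 <= p x)
  (p1 : \int[leb]_(x in S) p x = 1).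
Local Notation nu := (density_measure bp p0 p1).

Let nu0 : nu set0 = 0%E.
Proof. by rewrite /density_measure set0I integral_set0. Qed.

Let nu_ge0 B : (0 <= nu B)%E.
Proof. by apply: integral_ge0 => x [_ Sx]; rewrite lee_fin p0. Qed.

Let nu_additive : semi_sigma_additive nu.
Proof.
move=> F mF tF mUF; rewrite /density_measure; apply: cvg_toP.
  apply: ereal_nondecreasing_is_cvgn => m n mn.
  apply: lee_sum_nneg_natr => // k _ _; exact: nu_ge0.
rewrite setI_bigcupl ge0_integral_bigcup//=.
- by move=> k; exact: (measurableI _ _ (mF k) mS).
- apply/measurable_EFinP; apply: measurable_funS bp.1; first exact: mS.
  by move=> x [k _ []].
- by move=> x [k _ [_ Sx]]; rewrite lee_fin p0.
- exact: trivIset_setIr.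
Qed.

HB.instance Definition _ := isMeasure.Build _ _ _ nu nu0 nu_ge0 nu_additive.

Let nuT : nu setT = 1%E.
Proof. by rewrite /density_measure setTI -IS_EFin// p1. Qed.

HB.instance Definition _ := @Measure_isProbability.Build _ _ R nu nuT.

Lemma density_probability : exists nu : probability R R,
  forall B, measurable B -> B `<=` S -> nu B = (\int[leb]_(x in B) (p x)%:E)%E.
Proof. by exists nu => B mB BS; rewrite /= /density_measure (setIidl BS). Qed.

End ProbabilityOfDensity.

Section StationaryDensity.
Context {R : realType} (theta0 : R) (K : R.-pker R ~> R) (kappa : R -> R -> R)
  (mu : probability R R) (varpi : R -> R).
Hypotheses (th0 : 0 < theta0 < pi / 2) (B1 : hypB1 theta0 K)
  (B2 : hypB2 K kappa) (B4 : hypB4 K mu) (V : invariant_density kappa mu varpi).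
Notation leb := (@lebesgue_measure R).
Notation S := (@Sang R).
Notation k := (kt kappa).
Notation k' := (kt' kappa).
Variable M : R.
Hypothesis sk : smooth_kernel theta0 M k k'.

Lemma K_density a B : S a -> measurable B -> B `<=` S ->
  K a B = (\int[leb]_(b in B) (k a b)%:E)%E.
Proof.
move=> Sa mB BS; rewrite (kappa_density B2)//.
apply: eq_integral => b /set_mem Bb; congr EFin.
by rewrite (ktE th0 B1 B2)//; exact: BS.
Qed.

Lemma K_eint a f : S a -> bmf S f -> (forall x, S x -> 0 <= f x) ->
  (\int[K a]_(x in S) (f x)%:E)%E = (Top k f a)%:E.
Proof.
move=> Sa bf f0.
rewrite (eint_density (k_bmf sk a) (fun x _ => sk_ge0 sk a x) _ bf f0).
  by congr EFin; apply: eq_IS => x _; rewrite mulrC.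
by move=> B mB BS; exact: K_density.
Qed.

Lemma varpi_mass1 : (\int[leb]_(b in S) (varpi b)%:E)%E = 1%E.
Proof. by rewrite -(varpi_density V)//; [exact: B4.1.1|exact: mS]. Qed.

Lemma bmf_varpi : bmf S varpi.
Proof.
split; first exact: varpi_measurable V.
exists M => b Sb; rewrite ger0_norm ?(varpi_ge0 V)// (varpi_stationary V)//.
have mk : measurable_fun S (fun a => kappa a b).
  apply: (eq_measurable_fun (fun a => k a b)).
    by move=> a /set_mem Sa; rewrite (ktE th0 B1 B2).
  apply: measurable_funTS.
  exact: (measurableT_comp (sk_meas sk) (@pair2_measurable _ _ R R b)).
have : (\int[leb]_(a in S) (varpi a * kappa a b)%:E <= M%:E)%E.
  apply: (@le_trans _ _ (\int[leb]_(a in S) (M%:E * (varpi a)%:E))%E).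
    have mv := varpi_measurable V.
    apply: ge0_le_integral; first exact: mS.
    - by move=> a Sa; rewrite lee_fin mulr_ge0 ?(varpi_ge0 V)// (kappa_ge0 B2).
    - by apply/measurable_EFinP; exact: measurable_funM.
    - by apply: measurable_funeM; exact/measurable_EFinP.
    - move=> a Sa; rewrite -EFinM lee_fin mulrC ler_wpM2r ?(varpi_ge0 V)//.
      by rewrite -(ktE th0 B1 B2)// (sk_le sk).
  rewrite ge0_integralZl ?varpi_mass1 ?mule1//; first exact: mS.
  - by apply/measurable_EFinP; exact: varpi_measurable V.
  - by move=> a Sa; rewrite lee_fin (varpi_ge0 V).
  - by rewrite lee_fin (le_trans (sk_ge0 sk 0 0) (sk_le sk 0 0)).
rewrite /Rintegral; case E : (\int[leb]_(a in S) (varpi a * kappa a b)%:E)%E => [r| |] //=.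
by move=> _; exact: (le_trans (sk_ge0 sk 0 0) (sk_le sk 0 0)).
Qed.

Lemma varpi_mass : \int[leb]_(b in S) varpi b = 1.
Proof. by rewrite /Rintegral varpi_mass1. Qed.

Lemma varpi_inv b : S b -> varpi b = Tadj k varpi b.
Proof.
move=> Sb; rewrite [LHS](varpi_stationary V)//.
by apply: eq_IS => a Sa; rewrite (ktE th0 B1 B2).
Qed.

(** A stationary density is the density of an invariant probability, which
    [hypB4] identifies with [mu]; hence it integrates functions as [varpi] does. *)
Lemma varpi_unique p : nice_density M p -> (forall b, p b = Tadj k p b) ->
  forall f, ub f -> \int[leb]_(b in S) (p b * f b) = \int[leb]_(b in S) (varpi b * f b).
Proof.
move=> np pinv f uf; have [p0 _ _ p1] := np; have bp := nice_bmf sk np.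
have [nu nuE] := density_probability bp (fun x _ => p0 x) p1.
have nu_inv : invariant_prob K nu.
  split; first by rewrite nuE//; [rewrite -IS_EFin// p1|exact: mS].
  move=> B mB BS.
  have bB : bmf S (\1_B : R -> R).
    split; first exact: measurable_funTS (measurable_indic mB).
    by exists 1 => x _; rewrite indicE; case: (x \in B); rewrite /= ?normr1 ?normr0.
  have B0x x : S x -> 0 <= (\1_B x : R) by rewrite indicE.
  have KB a : S a -> K a B = (Top k \1_B a)%:E.
    move=> Sa; rewrite -K_eint// integral_indic//; last exact: mS.
    by rewrite (setIidl BS).
  transitivity (\int[nu]_(a in S) (Top k \1_B a)%:E)%E; last first.
    by apply: eq_integral => a /set_mem Sa; rewrite KB.
  have bT : bmf S (Top k \1_B) by apply: ub_bmf; [exact: mS|exact: (Top_ub sk)].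
  rewrite (eint_density bp (fun x _ => p0 x) nuE bT); last first.
    move=> a Sa; rewrite -(Top_cst sk 0 a); apply: (le_Top sk) => //; exact: bmf_cst.
  transitivity (\int[leb]_(x in S) (Tadj k p x * \1_B x))%:E; last first.
    rewrite (Tadj_duality sk)//; congr EFin; apply: eq_IS => x _; exact: mulrC.
  rewrite nuE// IS_EFin; last first.
    by apply: bmfM => //; exact: (nice_bmf sk (Tadj_nice sk np)).
  rewrite -[in LHS](setIidr BS) integral_mkcondr; apply: eq_integral => x _.
  by rewrite patchE indicE -pinv; case: ifP => _; rewrite ?mulr1 ?mulr0.
have muE : forall B, measurable B -> B `<=` S -> mu B = (\int[leb]_(x in B) (p x)%:E)%E.
  by move=> B mB BS; rewrite -(B4.2 nu)//; exact: nuE.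
have bf : bmf S f by apply: ub_bmf => //; exact: mS.
have h1 := rint_density bp (fun x _ => p0 x) muE bf.
have h2 := rint_density bmf_varpi (varpi_ge0 V) (varpi_density V) bf.
transitivity (\int[mu]_(x in S) f x).
  by rewrite h1; apply: eq_IS => x _; exact: mulrC.
by rewrite h2; apply: eq_IS => x _; exact: mulrC.
Qed.

End StationaryDensity.

(** * The solution of the Poisson equation *)

Section TruncatedTangent.
Context {R : realType} (theta0 : R).
Hypothesis th0 : 0 < theta0 < pi / 2.

(** Bounded and uniformly continuous on the line, and equal to [tan] on the cone, which
    carries all the outgoing angles. *)
Definition ttan (x : R) : R := tan (clamp_to theta0 x).

Lemma ttanE x : `|x| <= theta0 -> ttan x = tan x.
Proof. by move=> /clamp_to_id; rewrite /ttan => ->. Qed.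

Lemma cos_S0 x : `|x| <= theta0 -> 0 < cos x.
Proof.
have/andP[t0 t1] := th0; rewrite ler_norml => /andP[h1 h2].
by apply: cos_gt0_pihalf; apply/andP; split; lra.
Qed.

Lemma ub_ttan : ub ttan.
Proof.
have/andP[t0 t1] := th0.
have c : continuous ttan.
  move=> x; apply: (@continuous_comp _ _ _ (clamp_to theta0) tan).
    apply: ucont_continuous => e e0; exists e => // y z; apply: le_trans; apply: clamp_to_lip; exact: ltW.
  by apply: continuous_tan; rewrite gt_eqF// cos_S0// clamp_to_le// ltW.
have := @ub_CbS R ttan (continuous_subspaceT c).
rewrite (_ : ttan \o _ = ttan)//; apply/funext => x /=; rewrite /ttan; congr tan.
have [Sx|nS] := pselect (Sang x); first by rewrite clamp_id.
have xp : pi / 2 < `|x| by rewrite ltNge; apply/negP => /SangP.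
have hi r y : 0 <= r -> r <= y -> clamp_to r y = r.
  by move=> r0 ry; rewrite /clamp_to (min_idPr ry); apply/max_idPr; lra.
have lo r y : 0 <= r -> y <= - r -> clamp_to r y = - r.
  move=> r0 ry; rewrite /clamp_to (min_idPl _); last by lra.
  by apply/max_idPl; lra.
have [x0|x0] := leP 0 x.
  by rewrite ger0_norm// in xp; rewrite /clamp !hi//; lra.
by rewrite ltr0_norm// in xp; rewrite /clamp !lo//; lra.
Qed.

End TruncatedTangent.

Section PoissonClauses.
Context {R : realType} (theta0 : R) (K : R.-pker R ~> R) (kappa : R -> R -> R)
  (mu : probability R R) (varpi : R -> R).
Hypotheses (th0 : 0 < theta0 < pi / 2) (B1 : hypB1 theta0 K)
  (B2 : hypB2 K kappa) (B4 : hypB4 K mu) (V : invariant_density kappa mu varpi).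
Notation leb := (@lebesgue_measure R).
Notation S := (@Sang R).
Notation k := (kt kappa).
Notation k' := (kt' kappa).
Notation t := (ttan theta0).
Variable M : R.
Hypothesis sk : smooth_kernel theta0 M k k'.
Local Notation T := (Top k).

Let ubS f : ub f -> bmf S f. Proof. by apply: ub_bmf; exact: mS. Qed.
Let bv : bmf S varpi. Proof. exact: (bmf_varpi th0 B1 B2 B4 V sk). Qed.

Lemma Top_supp f g a : (forall b, `|b| <= theta0 -> f b = g b) -> T f a = T g a.
Proof.
move=> fg; apply: eq_IS => b _.
have [bt|bt] := leP `|b| theta0; first by rewrite fg.
by rewrite (sk_supp sk)// !mul0r.
Qed.

Lemma varpi_supp b : S b -> theta0 < `|b| -> varpi b = 0.
Proof.
move=> Sb tb; rewrite (varpi_inv th0 B1 B2 V)// /Tadj.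
under eq_Rintegral do rewrite (sk_supp sk)// mulr0.
by rewrite IS_cst mul0r.
Qed.

Lemma varpi_int_supp f g : (forall b, `|b| <= theta0 -> f b = g b) ->
  \int[leb]_(b in S) (varpi b * f b) = \int[leb]_(b in S) (varpi b * g b).
Proof.
move=> fg; apply: eq_IS => b Sb.
have [bt|bt] := leP `|b| theta0; first by rewrite fg.
by rewrite varpi_supp// !mul0r.
Qed.

Lemma rhoE n a : S a -> rho kappa n a = T (fun b => t b ^+ n) a.
Proof.
move=> Sa; rewrite -(@Top_supp (fun b => tan b ^+ n)); last by move=> b bt; rewrite ttanE.
by apply: eq_IS => b Sb; rewrite (ktE th0 B1 B2).
Qed.

Lemma rhobarE n : rhobar varpi n = \int[leb]_(b in S) (varpi b * t b ^+ n).
Proof. by apply: varpi_int_supp => b bt; rewrite ttanE. Qed.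

Lemma A1E psi : A1 varpi psi = \int[leb]_(b in S) (varpi b * (psi (clamp b) * t b)).
Proof.
transitivity (\int[leb]_(b in S) (varpi b * (psi b * tan b))).
  by apply: eq_IS => b _; ring.
apply: varpi_int_supp => b bt; rewrite ttanE// clamp_id//; apply/SangP.
by apply: (le_trans bt); case/andP: th0 => _ /ltW.
Qed.

Lemma ub_ttanX n : ub (fun b => t b ^+ n).
Proof.
elim: n => [|n IH]; first exact: ub_cst.
rewrite (_ : (fun b => _) = (fun b => t b * t b ^+ n)); first exact: ubM (ub_ttan th0) IH.
by apply/funext => b; rewrite exprS.
Qed.

Lemma poisson_eqP phi : CbS phi -> poisson_eq kappa phi <->
  (forall x, S x -> phi (clamp x) - T (phi \o @clamp R) x = 2 * T t x).
Proof.
move=> cphi; have uphi := ub_CbS cphi; have bphi := ubS uphi.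
have E x : S x -> \int[leb]_(b in S) ((phi x - phi b) * kappa x b) =
    phi (clamp x) - T (phi \o @clamp R) x.
  move=> Sx; rewrite -[X in X - _](Top_cst sk (phi (clamp x)) x).
  rewrite -(TopB sk)//; last exact: bmf_cst.
  apply: eq_IS => b Sb; rewrite (ktE th0 B1 B2)//= !clamp_id//; ring.
have rE x : S x -> rho kappa 1 x = T t x.
  by move=> Sx; rewrite rhoE//; apply: eq_Top => b _; rewrite expr1.
split=> H x Sx; first by rewrite -rE// -H// E.
by rewrite E// rE// H.
Qed.

Hypothesis rho1 : rhobar varpi 1 = 0.

Lemma varpi_ttan0 : \int[leb]_(b in S) (varpi b * t b) = 0.
Proof.
rewrite -[RHS]rho1 rhobarE; apply: eq_IS => b _; by rewrite expr1.
Qed.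

Lemma poisson_of f : ub f -> \int[leb]_(b in S) (varpi b * f b) = 0 ->
  exists2 psi, ub psi & forall x, psi x - T psi x = f x.
Proof.
exact: (poisson_exists sk bv (varpi_inv th0 B1 B2 V) (varpi_unique th0 B1 B2 B4 V sk)).
Qed.

Lemma statT f : bmf S f ->
  \int[leb]_(a in S) (varpi a * T f a) = \int[leb]_(b in S) (varpi b * f b).
Proof. exact: (stationary_Top sk bv (varpi_inv th0 B1 B2 V)). Qed.

Lemma poisson_solution : exists2 psi, ub psi & forall x, psi x - T psi x = 2 * T t x.
Proof.
apply: poisson_of; first by apply: ubZ; exact: (Top_ub sk (ubS (ub_ttan th0))).
rewrite (eq_IS (g := fun b => 2 * (varpi b * T t b))); last by move=> b _; ring.
have bt := ubS (ub_ttan th0).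
rewrite ISZ; last exact: (bmfM bv (ubS (Top_ub sk bt))).
by rewrite statT ?varpi_ttan0 ?mulr0.
Qed.

Lemma poisson_eq_solvable : exists psi0 : R -> R,
  [/\ CbS psi0, poisson_eq kappa psi0 &
    forall phi, CbS phi -> poisson_eq kappa phi ->
      exists c : R, forall alpha, S alpha -> phi alpha = psi0 alpha + c].
Proof.
have [psi upsi psiE] := poisson_solution.
have cpsi : CbS psi by apply: (ucont_CbS upsi.1).
have clE x : S x -> T (psi \o @clamp R) x = T psi x.
  by move=> Sx; apply: eq_Top => b Sb; rewrite /= clamp_id.
exists psi; split => //.
  by apply/poisson_eqP => // x Sx; rewrite clE// clamp_id// psiE.
move=> phi cphi /(poisson_eqP cphi) H.
have [c Hc] := poisson_unique sk (varpi_unique th0 B1 B2 B4 V sk) (ub_CbS cphi) upsi H (fun x _ => psiE x).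
by exists c => x Sx; rewrite -Hc//= clamp_id.
Qed.

(** [A1 + rhobar 2] is a quarter of the mean squared increment of a martingale,
    whose nonnegativity is Jensen's inequality for [T]. *)
Lemma A1_rho2_ge0 psi : CbS psi -> poisson_eq kappa psi ->
  0 <= A1 varpi psi + rhobar varpi 2.
Proof.
move=> cpsi /(poisson_eqP cpsi) H.
pose p := psi \o @clamp R; have up : ub p by exact: ub_CbS.
have ut := ub_ttan th0.
pose g b := p b + 2 * t b; have ug : ub g by apply: ubD => //; exact: ubZ.
have gE a : S a -> T g a = p a.
  move=> Sa; rewrite /g (TopD sk) ?(TopZ sk); [|exact: ubS|exact: ubS|by apply: bmfZ; exact: ubS].
  by have := H a Sa; rewrite -/p /p /=; lra.
have ug2 := ubM ug ug.
have jensen a : S a -> (p a) ^+ 2 <= T (fun b => g b * g b) a.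
  move=> Sa; have : 0 <= T (fun b => (g b - p a) * (g b - p a)) a.
    rewrite -(Top_cst sk 0 a); apply: (le_Top sk); first exact: bmf_cst.
      by apply: ubS; apply: ubM; apply: ubB => //; exact: ub_cst.
    by move=> b _; rewrite -expr2 sqr_ge0.
  rewrite (@eq_Top _ k _ (fun b => g b * g b - (2 * p a * g b - p a ^+ 2))); last first.
    by move=> b _; ring.
  have b1 : bmf S (fun b => 2 * p a * g b) by apply: bmfZ; exact: ubS.
  have b2 : bmf S (fun=> p a ^+ 2) by exact: bmf_cst.
  have b3 : bmf S (fun b => g b * g b) by exact: ubS.
  have b4 : bmf S (fun b => 2 * p a * g b - p a ^+ 2) by exact: bmfB.
  have b5 : bmf S g by exact: ubS.
  rewrite (TopB sk a b3 b4) (TopB sk a b1 b2) (TopZ sk _ a b5) (Top_cst sk) gE//.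
  by nra.
have i1 : \int[leb]_(b in S) (varpi b * (p b) ^+ 2) <= \int[leb]_(b in S) (varpi b * (g b * g b)).
  rewrite -(statT (ubS ug2)).
  apply: le_IS.
  - by apply: bmfM => //; apply: bmfX; exact: ubS.
  - by apply: bmfM => //; exact: (ubS (Top_ub sk (ubS ug2))).
  - by move=> b Sb; rewrite ler_wpM2l ?jensen// (varpi_ge0 V).
have bpt : bmf S (fun b => varpi b * (p b * t b)).
  by apply: bmfM => //; apply: bmfM; exact: ubS.
have bt2 : bmf S (fun b => varpi b * t b ^+ 2).
  by apply: bmfM => //; apply: bmfX; exact: ubS.
have bp2 : bmf S (fun b => varpi b * p b ^+ 2).
  by apply: bmfM => //; apply: bmfX; exact: ubS.
have E : \int[leb]_(b in S) (varpi b * (g b * g b)) =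
    \int[leb]_(b in S) (varpi b * (p b) ^+ 2) + 4 * (A1 varpi psi + rhobar varpi 2).
  rewrite A1E rhobarE -ISD// -ISZ; last exact: bmfD.
  rewrite -ISD//; last by apply: bmfZ; exact: bmfD.
  by apply: eq_IS => b _; rewrite /g /p /=; ring.
by move: i1; rewrite E; lra.
Qed.

End PoissonClauses.

(** * Uniform ergodicity and the series *)

Section SetwiseClose.
Context {d} {T : measurableType d} {R : realType}.
Variables (m1 m2 : {measure set T -> \bar R}) (D : set T) (e : R).
Hypotheses (mD : measurable D) (m1D : m1 D = 1%E) (m2D : m2 D = 1%E)
  (close : forall B, measurable B -> B `<=` D -> (`|m1 B - m2 B| <= e%:E)%E).

Let fin (m : {measure set T -> \bar R}) : m D = 1%E -> (m D < +oo)%E.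
Proof. by move=> ->; rewrite ltry. Qed.

(** Removing the upper half of the range of [f] changes the two integrals by
    amounts that differ by at most [C / 2 * e], and halves the range. *)
Lemma setwise_close_dyadic n : forall (C : R) f, bmf D f -> (forall x, D x -> 0 <= f x <= C) ->
  `|\int[m1]_(x in D) f x - \int[m2]_(x in D) f x| <= C * e + C / 2 ^+ n.
Proof.
have e0 : 0 <= e.
  have := close measurable0 (sub0set _).
  by rewrite !measure0 subee// abse0 lee_fin.
elim: n => [|n IH] C f bf fC.
  have I (m : {measure set T -> \bar R}) : m D = 1%E -> 0 <= \int[m]_(x in D) f x <= C.
    move=> m1'; have mf := fin m1'; have c0 : bmf D (fun=> 0 : R) by exact: bmf_cst.
    have cC : bmf D (fun=> C) by exact: bmf_cst.
    have fl x : D x -> 0 <= f x by move=> /fC /andP[].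
    have fu x : D x -> f x <= C by move=> /fC /andP[].
    have := le_fint mD mf c0 bf fl; have := le_fint mD mf bf cC fu.
    by rewrite !fint_cst// m1'/= mul0r mulr1 => -> ->.
  have /andP[h1 h2] := I m1 m1D; have /andP[h3 h4] := I m2 m2D.
  rewrite expr0 divr1 ler_norml; apply/andP; split; have := mulr_ge0 (le_trans h1 h2) e0; lra.
pose B := D `&` [set x | C / 2 <= f x].
have mB : measurable B.
  rewrite (_ : B = D `&` f @^-1` `[C / 2, +oo[); last first.
    by apply/seteqP; split=> x /= [Dx] h; split => //=; move: h; rewrite in_itv/= andbT.
  by apply: bf.1 => //; exact: measurable_itv.
have b1 : bmf D (\1_B : T -> R).
  split; first exact: measurable_funTS (measurable_indic mB).
  by exists 1 => x _; rewrite indicE; case: (x \in B); rewrite /= ?normr1 ?normr0.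
pose g x := f x - C / 2 * \1_B x.
have bZ : bmf D (fun x => C / 2 * (\1_B x : R)) by exact: bmfZ.
have bg : bmf D g by exact: bmfB.
have gC x : D x -> 0 <= g x <= C / 2.
  move=> Dx; rewrite /g indicE; have /andP[h1 h2] := fC x Dx.
  have [/set_mem[_ /= h]|/negP h] := boolP (x \in B); rewrite /= ?mulr1 ?mulr0 ?subr0.
    by apply/andP; split; lra.
  have : ~~ (C / 2 <= f x) by apply/negP => h'; apply: h; apply/mem_set.
  by rewrite -ltNge => h'; apply/andP; split; lra.
have E (m : {measure set T -> \bar R}) : m D = 1%E ->
    \int[m]_(x in D) f x = C / 2 * fine (m B) + \int[m]_(x in D) g x.
  move=> m1'; have mf := fin m1'.
  rewrite /g fintB// fintZ// (_ : \int[m]_(x in D) (\1_B x : R) = fine (m B)); last first.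
    rewrite /Rintegral integral_indic//; congr (fine (m _)).
    by apply/setIidPl => x [].
  by ring.
rewrite !E//.
have := IH _ _ bg gC.
have fB (m : {measure set T -> \bar R}) : m D = 1%E -> m B \is a fin_num.
  move=> m1'; rewrite ge0_fin_numE//; apply: le_lt_trans (fin m1').
  by apply: le_measure; rewrite ?inE//; exact: subIsetl.
have : `|fine (m1 B) - fine (m2 B)| <= e.
  have := close mB (@subIsetl _ _ _).
  by rewrite -(fineK (fB _ m1D)) -(fineK (fB _ m2D)) -EFinB abse_EFin lee_fin.
have C0 : D !=set0 -> 0 <= C by move=> [x /fC /andP[h1 h2]]; exact: le_trans h2.
have {}C0 : 0 <= C.
  apply: C0; apply/set0P/eqP => D0; move: m1D; rewrite D0 measure0 => /esym /eqP.
  by rewrite onee_eq0.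
move=> h1; set x1 := \int[m1]_(_ in D) _; set x2 := \int[m2]_(_ in D) _ => h2.
have h3 : `|C / 2 * (fine (m1 B) - fine (m2 B))| <= C / 2 * e.
  by rewrite normrM ger0_norm ?ler_wpM2l//; lra.
have -> : C / 2 * fine (m1 B) + x1 - (C / 2 * fine (m2 B) + x2) =
  C / 2 * (fine (m1 B) - fine (m2 B)) + (x1 - x2) by ring.
apply: (le_trans (ler_normD _ _)); apply: (le_trans (lerD h3 h2)).
rewrite exprS invfM mulrA; lra.
Qed.

Lemma setwise_close_int (C : R) f : bmf D f -> (forall x, D x -> 0 <= f x <= C) ->
  `|\int[m1]_(x in D) f x - \int[m2]_(x in D) f x| <= C * e.
Proof.
move=> bf fC; apply/ler_addgt0Pr => r r0.
have c : (fun n => C * (2^-1 : R) ^+ n) @ \oo --> (C * 0 : R).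
  by apply: cvgM; [exact: cvg_cst|apply: cvg_expr; rewrite ger0_norm; lra].
rewrite mulr0 in c.
have [n _ /(_ n (leqnn n))] := (@cvgr_dist_le _ _ _ _ _ _ _ c) r r0.
rewrite /= sub0r normrN exprVn => /(le_trans (ler_norm _)) h.
by apply: (le_trans (setwise_close_dyadic n bf fC)); rewrite lerD2l.
Qed.

End SetwiseClose.

Lemma pker_compl0 {R : realType} (K : R.-pker R ~> R) a (A : set R) :
  measurable A -> K a A = 1%E -> K a (~` A) = 0%E.
Proof.
move=> mA KA; have := @measureU _ R R (K a) _ _ mA (measurableC mA).
rewrite setUv setICr => /(_ erefl) e1.
have : (1 + K a (~` A) = 1 + 0)%E by rewrite -[in LHS]KA -e1 adde0; exact: prob_kernel.
have := @measure_ge0 _ _ _ (K a) (~` A); case: (K a (~` A)) => // r _.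
by rewrite -!EFinD => -[] /eqP; rewrite addr0 -subr_eq0 addrAC subrr add0r => /eqP ->.
Qed.

Section ErgodicClause.
Context {R : realType} (theta0 : R) (K : R.-pker R ~> R) (kappa : R -> R -> R)
  (mu : probability R R) (varpi : R -> R).
Hypotheses (th0 : 0 < theta0 < pi / 2) (B0 : markov_on_S K) (B1 : hypB1 theta0 K)
  (B2 : hypB2 K kappa) (B4 : hypB4 K mu) (V : invariant_density kappa mu varpi).
Notation leb := (@lebesgue_measure R).
Notation S := (@Sang R).
Notation k := (kt kappa).
Notation k' := (kt' kappa).
Notation t := (ttan theta0).
Variable M : R.
Hypothesis sk : smooth_kernel theta0 M k k'.
Local Notation T := (Top k).

Let ubS f : ub f -> bmf S f. Proof. by apply: ub_bmf; exact: mS. Qed.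

Lemma kpow_integral n a (f : R -> \bar R) : (forall x, 0 <= f x)%E ->
  measurable_fun setT f ->
  (\int[kpow K n.+1 a]_x f x = \int[K a]_x \int[kpow K n x]_y f y)%E.
Proof.
move=> f0 mf.
rewrite -(@integral_kcomp _ _ _ R R R R K (kernel.kernel_snd (kpow K n)) a f f0 mf).
exact: eq_measure_integral.
Qed.

Lemma K_compl_S a : S a -> K a (~` S) = 0%E.
Proof. by move=> Sa; apply: pker_compl0; [exact: mS|exact: B0]. Qed.

Lemma bmf_iter n f : bmf S f -> bmf S (iter n T f).
Proof. by move=> bf; elim: n => //= n IH; apply: ubS; exact: (Top_ub sk). Qed.

Lemma iter_ge0 n f : bmf S f -> (forall x, S x -> 0 <= f x) ->
  forall x, S x -> 0 <= iter n T f x.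
Proof.
move=> bf f0; elim: n => //= n IH x Sx; rewrite -(Top_cst sk 0 x).
apply: (le_Top sk) => //; [exact: bmf_cst|exact: bmf_iter].
Qed.

Lemma kpow_eint n f : bmf S f -> (forall x, S x -> 0 <= f x) -> forall a, S a ->
  (\int[kpow K n a]_(x in S) (f x)%:E = (iter n T f a)%:E)%E.
Proof.
move=> bf f0; have mf : measurable_fun S (EFin \o f) by apply/measurable_EFinP; case: bf.
elim: n => [|n IH] a Sa.
  rewrite integral_dirac//; last exact: mS.
  by rewrite diracE mem_set// mul1e.
pose h := (EFin \o f) \_ S.
have mh : measurable_fun setT h by apply/(measurable_restrictT _ mS).
have h0 x : (0 <= h x)%E.
  by rewrite /h patchE; case: ifPn => // /set_mem /f0; rewrite lee_fin.
have hE (m : {measure set R -> \bar R}) : (\int[m]_(x in S) (f x)%:E = \int[m]_x h x)%E by rewrite integral_mkcond.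
rewrite hE kpow_integral//.
have mI : measurable_fun setT (fun x => \int[kpow K n x]_y h y)%E.
  have := @measurable_fun_integral_sfinite_kernel _ _ R R R (h \o snd) (kpow K n).
  by apply; [move=> x; exact: h0|exact: measurableT_comp].
have I0 x : setT x -> (0 <= \int[kpow K n x]_y h y)%E.
  by move=> _; exact: integral_ge0.
rewrite (@ge0_negligible_integral _ _ _ _ _ (~` S) _ _ _ mI I0 (K_compl_S Sa))//; last first.
  by apply: measurableC; exact: mS.
rewrite setTD setCK.
rewrite (_ : (\int[K a]_(x in S) _)%E = \int[K a]_(x in S) (iter n T f x)%:E)%E; last first.
  by apply: eq_integral => x /set_mem Sx; rewrite -hE IH.
by rewrite (K_eint th0 B1 B2 sk)//; [exact: bmf_iter|exact: iter_ge0].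
Qed.

Lemma iter_cst n c x : iter n T (fun=> c) x = c.
Proof.
elim: n x => //= n IH x; rewrite -[RHS](Top_cst sk c x).
by apply: eq_Top => b _; rewrite IH.
Qed.

Lemma kpow_mass n a : S a -> kpow K n a S = 1%E.
Proof.
move=> Sa; rewrite -[RHS]/(1%R%:E) -(iter_cst n 1 a) -kpow_eint//.
- by rewrite integral_cst ?mul1e//; exact: mS.
- exact: bmf_cst.
Qed.

Lemma iterD n f g x : bmf S f -> bmf S g ->
  iter n T (fun y => f y + g y) x = iter n T f x + iter n T g x.
Proof.
move=> bf bg; elim: n x => //= n IH x; rewrite -(TopD sk); [|exact: bmf_iter..].
by apply: eq_Top => b _; rewrite IH.
Qed.

Lemma kpow_rint_cst n a (C : R) : S a -> \int[kpow K n a]_(x in S) C = C.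
Proof.
move=> Sa; rewrite fint_cst; last exact: mS.
by have := kpow_mass n Sa => /= ->; rewrite mulr1.
Qed.

Lemma kpow_rint n a f : S a -> bmf S f -> \int[kpow K n a]_(x in S) f x = iter n T f a.
Proof.
move=> Sa bf; have [_ [C fC]] := bf.
have bC : bmf S (fun=> C) by exact: bmf_cst.
have bfC := bmfD bf bC.
have mD : (kpow K n a S < +oo)%E by rewrite kpow_mass// ltry.
have E : \int[kpow K n a]_(x in S) (f x + C) = iter n T (fun x => f x + C) a.
  rewrite /Rintegral kpow_eint// => x Sx; have := fC x Sx; rewrite ler_norml; lra.
move: E; rewrite (iterD _ _ bf bC) iter_cst (fintD mS mD)// kpow_rint_cst//.
exact: addIr.
Qed.

Lemma psi_termE n a : S a -> psi_term K kappa a n = iter n.+1 T t a.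
Proof.
move=> Sa; have bt := ubS (ub_ttan th0).
rewrite iterSr /psi_term -(kpow_rint n Sa (ubS (Top_ub sk bt))).
apply: eq_Rintegral => b /set_mem Sb; rewrite (rhoE th0 B1 B2 sk)//.
Qed.

Lemma measurable_tan_S : measurable_fun S (@tan R).
Proof.
pose I : set R := [set` `]- (pi / 2), pi / 2[%R].
have mI : measurable I by exact: measurable_itv.
have mt : measurable_fun I (@tan R).
  apply: open_continuous_measurable_fun; first exact: interval_open.
  move=> x /set_mem; rewrite /I/= in_itv/= => xI; apply: continuous_tan.
  by rewrite gt_eqF// cos_gt0_pihalf.
have /(measurable_restrictT _ mI) mr := mt.
apply: eq_measurable_fun (measurable_funTS mr) => x /set_mem Sx.
rewrite patchE; case: ifPn => // /negP nI.
have xe : `|x| = pi / 2.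
  apply/eqP; rewrite eq_le (SangP x).1//= leNgt; apply/negP => h.
  by apply: nI; apply/mem_set; rewrite /I/= in_itv/= -ltr_norml.
rewrite /tan; have -> : cos x = 0.
  have <- : cos `|x| = cos x by case: (ger0P x) => // _; rewrite cosN.
  by rewrite xe cos_pihalf.
by rewrite invr0 mulr0.
Qed.

Lemma tan_termE n a : S a -> tan_term K a n = iter n.+1 T t a.
Proof.
move=> Sa; have bt := ubS (ub_ttan th0).
rewrite -(kpow_rint n.+1 Sa bt) /tan_term /Rintegral; congr fine.
pose N := S `\` Sang0 theta0.
have mN : measurable N by apply: measurableD; [exact: mS|exact: measurable_itv].
have b1 : bmf S (\1_N : R -> R).
  split; first exact: measurable_funTS (measurable_indic mN).
  by exists 1 => x _; rewrite indicE; case: (x \in N); rewrite /= ?normr1 ?normr0.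
apply: ae_eq_integral.
- exact: mS.
- by apply/measurable_EFinP; exact: measurable_tan_S.
- by apply/measurable_EFinP; exact: bt.1.
exists N; split => //.
  have N0 x : S x -> 0 <= (\1_N x : R) by rewrite indicE.
  have := kpow_eint n.+1 b1 N0 Sa.
  rewrite integral_indic//; last exact: mS.
  rewrite (setIidl _); last by move=> x [].
  move=> ->.
  have T0 x : T \1_N x = 0.
    rewrite -[RHS](Top_cst sk 0 x); apply: (Top_supp sk) => b bt0; rewrite indicE memNset//.
    by move=> [_]; apply; rewrite /Sang0/= in_itv/= -ler_norml.
  congr EFin; rewrite iterSr (_ : T \1_N = fun=> 0); last exact/funext.
  exact: iter_cst.
move=> x /= /not_implyP[Sx h]; split => // x0; apply: h.
by rewrite ttanE//; move: x0; rewrite /Sang0/= in_itv/= -ler_norml.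
Qed.

Hypothesis rho1 : rhobar varpi 1 = 0.

Lemma ergodic_iter_cvg f : uniformly_ergodic K mu -> bmf S f -> forall a, S a ->
  iter n T f a @[n --> \oo] --> \int[leb]_(b in S) (varpi b * f b).
Proof.
move=> UE bf a Sa.
have bv := bmf_varpi th0 B1 B2 B4 V sk.
have muE : \int[mu]_(x in S) f x = \int[leb]_(b in S) (varpi b * f b).
  rewrite (rint_density bv (varpi_ge0 V) _ bf); last exact: (varpi_density V).
  by apply: eq_IS => b _; rewrite mulrC.
rewrite -muE; have [_ [C fC]] := bf.
have C0 : 0 <= C.
  by apply: le_trans (fC a Sa).
apply/cvgrPdist_le => e e0.
pose e' := e / (2 * C + 1); have e'0 : 0 < e' by apply: divr_gt0 => //; lra.
have /fine_cvgP[_] := UE.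
move=> UE'.
have UEn : \forall n \near \oo,
    (ereal_sup [set tv_dist (kpow K n alpha) mu | alpha in Sang] <= e'%:E)%E.
  have /fine_cvgP[fn /cvgr_dist_le /(_ e' e'0)] := UE.
  move: fn; apply: filterS2 => n fn /=.
  by rewrite sub0r normrN => /(le_trans (ler_norm _)); rewrite -lee_fin fineK.
move: UEn; apply: filterS => n Hn.
have cl B : measurable B -> B `<=` S -> (`|kpow K n a B - mu B| <= e'%:E)%E.
  move=> mB BS; apply: le_trans Hn; apply: (@le_trans _ _ (tv_dist (kpow K n a) mu)).
    by apply: ereal_sup_ubound; exists B.
  by apply: ereal_sup_ubound; exists a.
have bC : bmf S (fun=> C) by exact: bmf_cst.
have bfC := bmfD bf bC.
have := setwise_close_int mS (kpow_mass n Sa) B4.1.1 cl (C := 2 * C) bfC.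
have mD : (kpow K n a S < +oo)%E by rewrite kpow_mass// ltry.
have muD : (mu S < +oo)%E by rewrite B4.1.1 ltry.
rewrite (fintD mS mD)// (fintD mS muD)// kpow_rint_cst// kpow_rint//.
have -> : \int[mu]_(x in S) C = C.
  by rewrite fint_cst; [have := B4.1.1 => /= ->; rewrite mulr1|exact: mS].
rewrite opprD addrACA subrr addr0 distrC => H.
apply: le_trans (H _) _.
  by move=> x Sx; have := fC x Sx; rewrite ler_norml => /andP[]; lra.
rewrite /e' mulrA ler_pdivrMr; last by lra.
by nra.
Qed.

(** With [psi] a solution of the Poisson equation, the partial sums telescope to half
    of [psi - T^n psi], and [T^n psi] tends to the mean of [psi]. *)
Lemma poisson_eq_series : uniformly_ergodic K mu ->
  let psi0 := fun alpha : R => 2 * limn (series (psi_term K kappa alpha)) in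
  [/\ forall alpha, S alpha ->
        [/\ cvgn (series (psi_term K kappa alpha)),
            cvgn (series (tan_term K alpha)) &
            psi0 alpha = 2 * limn (series (tan_term K alpha))],
      CbS psi0 & poisson_eq kappa psi0].
Proof.
move=> UE psi0.
have bt := ubS (ub_ttan th0).
have [psi upsi psiE] := poisson_solution th0 B1 B2 B4 V sk rho1.
have bpsi := ubS upsi.
set c := \int[leb]_(b in S) (varpi b * psi b).
have tel n x : iter n T psi x - iter n.+1 T psi x = 2 * iter n.+1 T t x.
  elim: n x => [|n IH] x; first exact: psiE.
  rewrite [iter n.+1 T psi x]/= [iter n.+2 T psi x]/= -/(iter n.+1 T psi).
  rewrite -(TopB sk); [|exact: bmf_iter|exact: (bmf_iter n.+1)].
  rewrite [iter n.+2 T t x]/= -/(iter n.+1 T t) -(TopZ sk); last exact: (bmf_iter n.+1).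
  by apply: eq_Top => b _; exact: IH.
have ser a : series (fun n => iter n.+1 T t a) = fun n => 2^-1 * (psi a - iter n T psi a).
  apply/funext => n; rewrite /series/=; elim: n => [|n IH]; first by rewrite big_nil /= subrr mulr0.
  rewrite big_nat_recr//= IH -[T (iter n T t) a]/(iter n.+1 T t a).
  have := tel n a; rewrite -[T (iter n T psi) a]/(iter n.+1 T psi a); lra.
have cv a : S a -> series (fun n => iter n.+1 T t a) @ \oo --> 2^-1 * (psi a - c).
  move=> Sa; rewrite ser; apply: cvgM; first exact: cvg_cst.
  by apply: cvgB; [exact: cvg_cst|exact: ergodic_iter_cvg].
have E1 a : S a -> psi_term K kappa a = fun n => iter n.+1 T t a.
  by move=> Sa; apply/funext => n; exact: psi_termE.
have E2 a : S a -> tan_term K a = fun n => iter n.+1 T t a.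
  by move=> Sa; apply/funext => n; exact: tan_termE.
have psi0E a : S a -> psi0 a = psi a - c.
  by move=> Sa; rewrite /psi0 E1// (cvg_lim _ (cv a Sa))//; lra.
split.
- move=> a Sa; split; rewrite /psi0 ?E1// ?E2//; apply/cvg_ex; eexists; exact: cv.
- by apply: (@ucont_CbS _ (fun x => psi x - c)) => //; exact: (ubB upsi (ub_cst c)).1.
- move=> a Sa; rewrite (rhoE th0 B1 B2 sk)//.
  rewrite (@eq_Top _ k _ t); last by move=> b _; rewrite expr1.
  rewrite -psiE -(Top_cst sk (psi a) a) -(TopB sk)//; last exact: bmf_cst.
  apply: eq_IS => b Sb; rewrite !psi0E// (ktE th0 B1 B2)//; ring.
Qed.

End ErgodicClause.

(** * The exit parameter *)

Section ExpBounds.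
Context {R : realType}.
Implicit Types x : R.

Lemma expR_le2 x : x <= 1 / 2 -> expR x <= 2.
Proof.
move=> x1; have h := expR_ge1Dx (- x); have h2 := expR_gt0 (x : R).
have : expR x * expR (- x) = 1 by rewrite -expRD subrr expR0.
by nra.
Qed.

Lemma expR_ge12 x : - (1 / 2) <= x -> 1 / 2 <= expR x.
Proof. by move=> x1; have h := expR_ge1Dx x; lra. Qed.

Lemma expR_bounds x : `|x| <= 1 / 2 -> 1 / 2 <= expR x <= 2.
Proof. by rewrite ler_norml => /andP[h1 h2]; rewrite expR_ge12// expR_le2. Qed.

Lemma expR_taylor0 x : `|x| <= 1 / 2 -> `|expR x - 1| <= 2 * `|x|.
Proof.
move=> x1; have [c] := @MVT_R _ expR expR 0 x (fun y => is_derive_expR y).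
rewrite expR0 !subr0 => cx ->; rewrite normrM ler_wpM2r//.
rewrite ger0_norm ?expR_ge0//.
by have /andP[] := expR_bounds (le_trans cx x1).
Qed.

Lemma expR_taylor1 x : `|x| <= 1 / 2 -> `|expR x - 1 - x| <= 2 * `|x| ^+ 2.
Proof.
move=> x1.
have D (y : R) : is_derive y (1 : R) (fun u : R => expR u - 1 - u) (expR y - 1).
  by apply: is_derive_eq; rewrite subr0.
have [c] := MVT_R 0 x D.
rewrite expR0 !subr0 subrr subr0 => cx ->; rewrite normrM expr2 mulrA ler_wpM2r//.
by apply: (le_trans (expR_taylor0 (le_trans cx x1))); rewrite ler_wpM2l.
Qed.

Lemma expR_taylor2 x : `|x| <= 1 / 2 -> `|expR x - 1 - x - x ^+ 2 / 2| <= 2 * `|x| ^+ 3.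
Proof.
move=> x1.
have D (y : R) : is_derive y (1 : R) (fun u : R => expR u - 1 - u - u ^+ 2 / 2) (expR y - 1 - y).
  apply: is_derive_eq; rewrite /GRing.scale/= subr0; lra.
have [c] := MVT_R 0 x D.
rewrite expR0 !subr0 expr0n/= mul0r subrr !subr0 => cx ->.
rewrite normrM [X in _ <= _ * X]exprSr mulrA ler_wpM2r//.
apply: (le_trans (expR_taylor1 (le_trans cx x1))).
by rewrite ler_wpM2l// ler_pXn2r// ?nnegrE.
Qed.

Lemma atan_near x : `|atan x - x| <= `|x| ^+ 2 * `|x|.
Proof.
have D (y : R) : is_derive y (1 : R) (fun u : R => atan u - u) ((1 + y ^+ 2)^-1 - 1).
  by apply: is_derive_eq.
have [c] := MVT_R 0 x D.
rewrite atan0 !subr0 => cx ->; rewrite normrM ler_wpM2r//.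
have c2 : 0 <= c ^+ 2 by exact: sqr_ge0.
have -> : (1 + c ^+ 2)^-1 - 1 = - (c ^+ 2 / (1 + c ^+ 2)) by field; lra.
rewrite normrN ger0_norm; last by apply: divr_ge0; lra.
rewrite ler_pdivrMr; last by lra.
have : c ^+ 2 <= `|x| ^+ 2 by rewrite -[c ^+ 2]real_normK ?num_real// ler_pXn2r// nnegrE.
by nra.
Qed.

Lemma atan_lip1 x y : `|atan x - atan y| <= `|x - y|.
Proof.
rewrite -[leRHS]mul1r; apply: (derive_lip (df := fun y : R => (1 + y ^+ 2)^-1)).
move=> z; have := sqr_ge0 z => z2; rewrite ger0_norm; last by rewrite invr_ge0; lra.
by rewrite invf_le1; lra.
Qed.

Lemma atan_ge0 x : 0 <= x -> 0 <= atan x.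
Proof. by rewrite -{2}(@atan0 R); exact: le_atan. Qed.

End ExpBounds.

Section WidthMap.
Context {R : realType} (g : R).
Hypothesis g01 : 0 < g < 1.
Implicit Types w v : R.

(** A ray from abscissa [z] to abscissa [z * expR (w * v)] on the opposite wall,
    with [w = z `^ (g - 1)], has slope [Gw w v] to the vertical. *)
Definition Gw w v : R := (expR (w * v) - 1) / (w * (1 + expR (g * (w * v)))).

Definition dGw w v : R :=
  (expR (w * v) * (1 + (1 - g) * expR (g * (w * v))) + g * expR (g * (w * v))) /
  (1 + expR (g * (w * v))) ^+ 2.

(** Outgoing angle ([bw]) and next incoming angle ([aw]) of the ray with exit
    parameter [v], both measured from the inward normals. *)
Definition bw w v : R := atan (Gw w v) - atan (g * w).

Definition aw w v : R := atan (Gw w v) + atan (g * (w * expR ((g - 1) * (w * v)))).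

Definition dbw w v : R := dGw w v / (1 + Gw w v ^+ 2).

Definition daw w v : R := dbw w v +
  g * (g - 1) * w ^+ 2 * expR ((g - 1) * (w * v)) /
    (1 + (g * (w * expR ((g - 1) * (w * v)))) ^+ 2).

Lemma Gw_derive w v : 0 < w -> is_derive v (1 : R) (Gw w) (dGw w v).
Proof.
move=> w0; have e1 := expR_gt0 (w * v); have e2 := expR_gt0 (g * (w * v)).
have d0 : w * (1 + expR (g * (w * v))) != 0 by rewrite gt_eqF// mulr_gt0//; lra.
apply: is_derive_eq; rewrite /GRing.scale/=.
by rewrite /dGw; field; rewrite ?gt_eqF//; lra.
Qed.

Lemma dGw_gt0 w v : 0 < dGw w v.
Proof.
have e1 := expR_gt0 (w * v); have e2 := expR_gt0 (g * (w * v)).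
have /andP[g0 g1] := g01; apply: divr_gt0; last by apply: exprn_gt0; lra.
apply: addr_gt0; last exact: mulr_gt0.
apply: mulr_gt0 => //.
have : 0 <= (1 - g) * expR (g * (w * v)) by apply: mulr_ge0; lra.
lra.
Qed.

Lemma bw_derive w v : 0 < w -> is_derive v (1 : R) (bw w) (dbw w v).
Proof.
move=> w0; have := @Gw_derive w v w0 => D; apply: is_derive_eq.
by rewrite /dbw subr0 /GRing.scale/= mulrC.
Qed.

Lemma aw_derive w v : 0 < w -> is_derive v (1 : R) (aw w) (daw w v).
Proof.
move=> w0; have := @Gw_derive w v w0 => D; apply: is_derive_eq.
by rewrite /daw /dbw /GRing.scale/=; ring.
Qed.

Lemma Gw_lt w v v' : 0 < w -> v < v' -> Gw w v < Gw w v'.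
Proof.
move=> w0 vv; have [c _ E] := MVT_R v v' (fun x => Gw_derive x w0).
by have := dGw_gt0 w c; have : 0 < dGw w c * (v' - v); [rewrite mulr_gt0 ?dGw_gt0// subr_gt0|lra].
Qed.

Lemma Gw_le w v v' : 0 < w -> (Gw w v <= Gw w v') = (v <= v').
Proof.
move=> w0; apply/idP/idP; last first.
  by rewrite le_eqVlt => /predU1P[->//|/(Gw_lt w0)/ltW].
by apply: contraTT; rewrite -!ltNge; exact: Gw_lt.
Qed.

Lemma Gw_inj w v v' : 0 < w -> Gw w v = Gw w v' -> v = v'.
Proof.
by move=> w0 E; apply/eqP; rewrite eq_le -(Gw_le v v' w0) -(Gw_le v' v w0) E lexx.
Qed.

Lemma gwv_bound w v : `|w * v| <= 1 / 2 -> `|g * (w * v)| <= 1 / 2.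
Proof.
have /andP[g0 g1] := g01; move=> h; rewrite normrM (ger0_norm (ltW g0)).
by have := normr_ge0 (w * v); nra.
Qed.

Lemma g1wv_bound w v : `|w * v| <= 1 / 2 -> `|(g - 1) * (w * v)| <= 1 / 2.
Proof.
have /andP[g0 g1] := g01; move=> h; rewrite normrM (@ltr0_norm _ (g - 1)); last by lra.
by have := normr_ge0 (w * v); nra.
Qed.

Lemma dGw_bounds w v : `|w * v| <= 1 / 2 -> 1 / 18 <= dGw w v <= 8.
Proof.
move=> wv; have /andP[g0 g1] := g01.
have /andP[e1 e2] := expR_bounds wv; have /andP[f1 f2] := expR_bounds (gwv_bound wv).
rewrite /dGw; set e := expR (w * v) in e1 e2 *; set f := expR (g * (w * v)) in f1 f2 *.
have d0 : 0 < (1 + f) ^+ 2 by apply: exprn_gt0; lra.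
have h1 : 0 <= (1 - g) * f <= 2 by nra.
have h2 : 0 <= g * f <= 2 by nra.
rewrite ler_pdivlMr// ler_pdivrMr//; move: h1 h2.
set p := (1 - g) * f; set q := g * f => /andP[p0 p2] /andP[q0 q2].
have : 0 <= e * p <= 4 by nra.
by move=> /andP[? ?]; apply/andP; split; rewrite expr2; nra.
Qed.

Lemma Gw_abs w v : 0 < w -> `|w * v| <= 1 / 2 -> `|Gw w v| <= 2 * `|v|.
Proof.
move=> w0 wv; have f1 := expR_gt0 (g * (w * v)).
have d0 : 0 < w * (1 + expR (g * (w * v))) by apply: mulr_gt0 => //; lra.
rewrite /Gw normrM normfV (gtr0_norm d0) ler_pdivrMr//.
apply: (le_trans (expR_taylor0 wv)); rewrite normrM (gtr0_norm w0).
have : 0 <= w * `|v| by rewrite mulr_ge0// ltW.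
set x := w * `|v| => x0.
have -> : 2 * `|v| * (w * (1 + expR (g * (w * v)))) = 2 * x * (1 + expR (g * (w * v))).
  by rewrite /x; ring.
by nra.
Qed.

Lemma Gw_far w L : 0 < w -> 0 < L -> w * L <= 1 / 2 -> L / 3 <= Gw w L /\ Gw w (- L) <= - (L / 3).
Proof.
move=> w0 L0 wL; have x0 : 0 < w * L by exact: mulr_gt0.
have /andP[g0 g1] := g01.
have f1 := expR_gt0 (g * (w * L)); have f2 := expR_gt0 (g * (w * - L)).
have d1 : 0 < w * (1 + expR (g * (w * L))) by apply: mulr_gt0 => //; lra.
have d2 : 0 < w * (1 + expR (g * (w * - L))) by apply: mulr_gt0 => //; lra.
split; rewrite /Gw.
  rewrite ler_pdivlMr//.
  have := expR_ge1Dx (w * L).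
  have : expR (g * (w * L)) <= 2 by apply: expR_le2; nra.
  have -> : L / 3 * (w * (1 + expR (g * (w * L)))) = (w * L) / 3 * (1 + expR (g * (w * L))) by ring.
  by nra.
rewrite ler_pdivrMr//.
have e1 : expR (g * (w * - L)) <= 1.
  by rewrite -expR0 ler_expR mulrN mulrN oppr_le0 mulr_ge0// ltW.
have e2 := expR_ge1Dx (w * L).
have e3 : expR (w * L) * expR (w * - L) = 1 by rewrite -expRD mulrN subrr expR0.
have e4 := expR_gt0 (w * - L).
have -> : - (L / 3) * (w * (1 + expR (g * (w * - L)))) =
  - ((w * L) / 3 * (1 + expR (g * (w * - L)))) by ring.
have e5 : (1 + w * L) * expR (w * - L) <= 1.
  by rewrite -[X in _ <= X]e3; apply: ler_wpM2r => //; exact: ltW.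
have : expR (w * - L) <= 1 - 2 / 3 * (w * L) by nra.
by nra.
Qed.

(** The exit parameter: the abscissa reached along slope [tau] is
    [z * expR (w * Vw w tau)]. *)
Definition Vw w tau : R := xget 0 [set v | Gw w v = tau].

Lemma Vw_unique w v : 0 < w -> Vw w (Gw w v) = v.
Proof.
move=> w0; rewrite /Vw; case: xgetP => [x _ /= /(Gw_inj w0)//|h].
by case: (h v).
Qed.

Lemma Vw_spec w L tau : 0 < w -> 0 < L -> w * L <= 1 / 2 -> `|tau| <= L / 3 ->
  Gw w (Vw w tau) = tau /\ `|Vw w tau| <= L.
Proof.
move=> w0 L0 wL; rewrite ler_norml => /andP[t1 t2].
have [h1 h2] := Gw_far w0 L0 wL.
have cG : {within `[- L, L], continuous (Gw w)}.
  apply: continuous_subspaceT; exact: derive_continuous (fun x => Gw_derive x w0).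
have LL : - L <= L by lra.
have [|v vL E] := IVT (v := tau) LL cG.
  by rewrite ge_min le_max; apply/andP; split; apply/orP; [left|right]; lra.
rewrite -E Vw_unique//; split => //.
by move: vL; rewrite in_itv/= -ler_norml.
Qed.

(** The factor 18 is the inverse of the lower bound of [dGw]; the mean value point
    may leave the ball of radius [L], but not that of radius [3 * L]. *)
Lemma Vw_lip w L tau tau' : 0 < w -> 0 < L -> w * (3 * L) <= 1 / 2 ->
  `|tau| <= L / 3 -> `|tau'| <= L / 3 -> `|Vw w tau - Vw w tau'| <= 18 * `|tau - tau'|.
Proof.
move=> w0 L0 wL t1 t2.
have wL' : w * L <= 1 / 2 by nra.
have [E1 v1] := Vw_spec w0 L0 wL' t1; have [E2 v2] := Vw_spec w0 L0 wL' t2.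
rewrite -{2}E1 -{2}E2; set v := Vw w tau in v1 *; set v' := Vw w tau' in v2 *.
have [c cv ->] := MVT_R v' v (fun x => Gw_derive x w0).
have c3 : `|c| <= 3 * L.
  have := ler_normD (c - v') v'; rewrite subrK => /le_trans; apply.
  by have := ler_normB v v'; lra.
have /dGw_bounds/andP[d1 _] : `|w * c| <= 1 / 2.
  by rewrite normrM (gtr0_norm w0); have := normr_ge0 c; nra.
rewrite normrM (ger0_norm (_ : 0 <= dGw w c)); last by lra.
by have := normr_ge0 (v - v'); nra.
Qed.

Lemma Vw_le w L tau c : 0 < w -> 0 < L -> w * L <= 1 / 2 -> `|tau| <= L / 3 ->
  (Vw w tau <= c) = (tau <= Gw w c).
Proof.
move=> w0 L0 wL t1; have [E1 _] := Vw_spec w0 L0 wL t1.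
by rewrite -{2}E1 Gw_le.
Qed.

(** [Vw w tau <= c] amounts to [tau <= Gw w c], an inequality between measurable
    functions of [w] and [tau]. *)
Lemma measurable_Vw d (T : measurableType d) (D : set T) (wf tf : T -> R) L :
  0 < L -> measurable_fun D wf -> measurable_fun D tf ->
  (forall x, D x -> [/\ 0 < wf x, wf x * L <= 1 / 2 & `|tf x| <= L / 3]) ->
  measurable_fun D (fun x => Vw (wf x) (tf x)).
Proof.
move=> L0 mw mt HD mD; apply: (measurability _ (RGenOInfty.measurableE R)) => //.
move=> /= _ [_ [c ->] <-].
pose h x := tf x * (wf x * (1 + expR (g * (wf x * c)))) - (expR (wf x * c) - 1).
have mh : measurable_fun D h.
  have mwc : measurable_fun D (fun x => wf x * c).
    by apply: measurable_funM => //; exact: measurable_cst.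
  have me : measurable_fun D (fun x => expR (wf x * c)).
    exact: (measurableT_comp (@measurable_expR R) mwc).
  have mge : measurable_fun D (fun x => expR (g * (wf x * c))).
    apply: (measurableT_comp (@measurable_expR R)).
    by apply: measurable_funM => //; exact: measurable_cst.
  apply: measurable_funB; last by apply: measurable_funB => //; exact: measurable_cst.
  apply: measurable_funM => //; apply: measurable_funM => //.
  by apply: measurable_funD => //; exact: measurable_cst.
rewrite (_ : D `&` _ = D `&` h @^-1` `]0, +oo[).
  by apply: mh => //; exact: measurable_itv.
apply/seteqP; split=> x /= [Dx]; rewrite !in_itv/= !andbT => H; split => //;
  have [w0 wL t1] := HD x Dx; have e2 := expR_gt0 (g * (wf x * c));
  (have d0 : 0 < wf x * (1 + expR (g * (wf x * c)))
     by apply: mulr_gt0 => //; lra);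
  move: H; rewrite !ltNge (Vw_le c w0 L0 wL t1) /Gw ler_pdivlMr//;
  by rewrite /h subr_le0.
Qed.

End WidthMap.

(** * The law of the incoming angle *)

Section ExitAngle.
Context {R : realType} (theta0 g : R).
Hypotheses (th0 : 0 < theta0 < pi / 2) (g01 : 0 < g < 1).
Notation t := (ttan theta0).
Notation T1 := (tan theta0).
Notation L := (6 * (tan theta0 + 1)).
Implicit Types w v b : R.

(** [tan (b + atan (g * w))], the slope of a ray leaving at angle [b]. *)
Definition tauw w b : R := (t b + g * w) / (1 - g * w * t b).

Definition vw w b : R := Vw g w (tauw w b).

(** The incoming angle at the next collision. *)
Definition alphaw w b : R := aw g w (vw w b).

(** Smallness of the relative width [w] of the domain: exit parameters up to [3 * L]
    give exponents at most 1/2, the slopes of all rays of the cone are exit slopes,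
    and [bw] and [aw] have positive derivatives (see [dbw_bounds]). *)
Definition narrow w : Prop :=
  [/\ 0 < w, w <= 1, w * (3 * L) <= 1 / 2, theta0 + 2 * w <= atan (L / 3) &
      4 * w ^+ 2 * (18 * (1 + 4 * L ^+ 2)) <= 1].

Lemma tan_S0_gt0 : 0 < T1.
Proof.
have /andP[t0 t1] := th0; rewrite -[ltLHS](@tan0 R) ltr_tan// in_itv/=; apply/andP; split; lra.
Qed.

Let T10 := tan_S0_gt0.

Lemma ttan_abs b : `|t b| <= T1.
Proof.
have /andP[t0 t1] := th0; have := clamp_to_le b (ltW t0); rewrite ler_norml => /andP[c1 c2].
have I x : - theta0 <= x <= theta0 -> x \in `]- (pi / 2), pi / 2[.
  by move=> /andP[? ?]; rewrite in_itv/=; apply/andP; split; lra.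
have m x y : - theta0 <= x <= theta0 -> - theta0 <= y <= theta0 -> x <= y -> tan x <= tan y.
  move=> Ix Iy; apply: contraTT; rewrite -!ltNge; by rewrite ltr_tan ?I.
have I1 : - theta0 <= theta0 <= theta0 by apply/andP; split; lra.
have I2 : - theta0 <= - theta0 <= theta0 by apply/andP; split; lra.
have I3 : - theta0 <= clamp_to theta0 b <= theta0 by rewrite c1 c2.
by rewrite ler_norml -tanN /ttan !m.
Qed.

Lemma narrow_exists : exists2 w0, 0 < w0 & forall w, 0 < w <= w0 -> narrow w.
Proof.
have /andP[t0 t1] := th0.
have tK : atan T1 = theta0 by apply: tanK; rewrite in_itv/=; apply/andP; split; lra.
have Tp := T10.
have h : theta0 < atan (L / 3) by rewrite -{1}tK; apply: lt_atan; lra.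
have L2 : 0 <= L ^+ 2 by exact: sqr_ge0.
pose w0 := Num.min (Num.min 1 (6 * L)^-1) (Num.min ((atan (L / 3) - theta0) / 2)
   (72 * (1 + 4 * L ^+ 2))^-1).
exists w0 => [|w]; first by rewrite /w0 !lt_min ltr01 !invr_gt0 /=; apply/andP; split;
   [|apply/andP; split]; lra.
rewrite /w0 !le_min => /andP[w0' /andP[/andP[h1 h2] /andP[h3 h4]]]; split => //.
- move: h2; rewrite -[X in _ <= X]mul1r ler_pdivlMr; lra.
- lra.
- move: h4; rewrite -[X in _ <= X]mul1r ler_pdivlMr; last by lra.
  have x1 : 1 <= 1 + 4 * L ^+ 2 by lra.
  set x := 1 + 4 * L ^+ 2 in x1 * => h4.
  have : w ^+ 2 * x <= w * x by rewrite expr2 -mulrA ler_piMl// mulr_ge0//; lra.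
  by lra.
Qed.

Section Fixed.
Variable w : R.
Hypothesis nw : narrow w.

Let w0 : 0 < w. Proof. by case: nw. Qed.
Let L0 : 0 < L. Proof. by have := T10; lra. Qed.
Let wL : w * L <= 1 / 2.
Proof. have l0 := L0; have w0' := w0; case: nw => _ _ h _ _; nra. Qed.

Lemma gwt b : `|g * w * t b| <= 1 / 2.
Proof.
have /andP[g0 g1] := g01; have [_ _ h _ _] := nw.
rewrite (normrM (g * w)) (normrM g) (gtr0_norm g0) (gtr0_norm w0).
have h1 := ttan_abs b; have h2 := normr_ge0 (t b).
have : g * w * `|t b| <= w * T1.
  rewrite -mulrA -[leRHS]mul1r; apply: ler_pM; [exact: ltW|rewrite mulr_ge0// ltW//|exact: ltW|].
  by rewrite ler_pM2l.
by have : 0 < w * T1; [exact: mulr_gt0|nra].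
Qed.

Lemma gwt_den b : 1 / 2 <= 1 - g * w * t b.
Proof. by have := gwt b; rewrite ler_norml => /andP[]; lra. Qed.

Lemma tauw_abs b : `|tauw w b| <= L / 3.
Proof.
have /andP[g0 g1] := g01; have [_ w1 _ _ _] := nw.
have d := gwt_den b; rewrite /tauw normrM normfV (@gtr0_norm _ (1 - _)); last by lra.
rewrite ler_pdivrMr; last by lra.
have : `|t b + g * w| <= T1 + 1.
  apply: (le_trans (ler_normD _ _)); apply: lerD; first exact: ttan_abs.
  by rewrite ger0_norm ?mulr_ge0 ?ltW//; have := w0; nra.
by have := T10; nra.
Qed.

Lemma vwE b : Gw g w (vw w b) = tauw w b.
Proof. by case: (Vw_spec g01 w0 L0 wL (tauw_abs b)). Qed.

Lemma vw_abs b : `|vw w b| <= L.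
Proof. by case: (Vw_spec g01 w0 L0 wL (tauw_abs b)). Qed.

Lemma wv_abs v : `|v| <= L -> `|w * v| <= 1 / 2.
Proof. by move=> h; rewrite normrM (gtr0_norm w0); have := normr_ge0 v; have := w0; have := wL; nra. Qed.

Lemma tauw_continuous : continuous (tauw w).
Proof.
move=> b; have ct := ucont_continuous (ub_ttan th0).1.
have cn : {for b, continuous (fun b => t b + g * w)}.
  by apply: continuousD; [exact: ct|exact: cst_continuous].
have cd : {for b, continuous (fun b => 1 - g * w * t b)}.
  apply: continuousB; first exact: cst_continuous.
  by apply: continuousM; [exact: cst_continuous|exact: ct].
apply: (continuousM cn); apply: (continuousV _ cd).
by rewrite gt_eqF//; have := gwt_den b; lra.
Qed.

Lemma vw_continuous : continuous (vw w).
Proof.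
move=> b; have [_ _ h _ _] := nw; apply/cvgrPdist_le => e e0.
have e18 : 0 < e / 18 by lra.
have /cvgrPdist_le /(_ _ e18) := @tauw_continuous b.
apply: filterS => c bc.
apply: (le_trans (Vw_lip g01 w0 L0 h (tauw_abs b) (tauw_abs c))); lra.
Qed.

Lemma aw_continuous : continuous (aw g w).
Proof. exact: derive_continuous (fun v => aw_derive g v w0). Qed.

Lemma alphaw_continuous : continuous (alphaw w).
Proof.
by move=> b; apply: (@continuous_comp _ _ _ (vw w) (aw g w)); [exact: vw_continuous|exact: aw_continuous].
Qed.

Lemma atan_gw : 0 < atan (g * w) <= w.
Proof.
have /andP[g0 g1] := g01; have gw : 0 < g * w by exact: mulr_gt0.
apply/andP; split; first by rewrite -(@atan0 R); exact: lt_atan.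
have := atan_lip1 (g * w) 0; rewrite atan0 !subr0 (gtr0_norm gw) => /(le_trans (ler_norm _)).
by nra.
Qed.

Lemma atan_tauw b : `|b| <= theta0 -> atan (tauw w b) = b + atan (g * w).
Proof.
move=> bt; have /andP[t0 t1] := th0; have /andP[a1 a2] := atan_gw.
have [_ _ _ h _] := nw; have := atan_ltpi2 (L / 3) => h2.
have c1 : cos b != 0 by rewrite gt_eqF// (cos_S0 th0).
have c2 : cos (atan (g * w)) != 0.
  by rewrite cos_atan invr_neq0// gt_eqF// sqrtr_gt0; have := sqr_ge0 (g * w); lra.
have -> : tauw w b = tan (b + atan (g * w)).
  by rewrite tanD// atanK /tauw (@ttanE _ theta0)// [tan b * _]mulrC.
apply: tanK; move: bt; rewrite in_itv/= ler_norml => /andP[? ?]; apply/andP; split; lra.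
Qed.

Lemma vw_bw v : `|bw g w v| <= theta0 -> vw w (bw g w v) = v.
Proof.
move=> bt; rewrite /vw.
rewrite (_ : tauw w (bw g w v) = Gw g w v); first exact: Vw_unique.
by rewrite -[LHS]atanK atan_tauw// /bw subrK atanK.
Qed.

Lemma alphawE b : `|b| <= theta0 ->
  alphaw w b = b + atan (g * w) + atan (g * (w * expR ((g - 1) * (w * vw w b)))).
Proof. by move=> bt; rewrite /alphaw /aw vwE atan_tauw. Qed.

Lemma exp_g1 v : `|v| <= L -> 1 / 2 <= expR ((g - 1) * (w * v)) <= 2.
Proof. by move=> h; apply: expR_bounds; apply: g1wv_bound => //; exact: wv_abs. Qed.

Lemma slope_bounds v : `|v| <= L -> 0 <= g * (w * expR ((g - 1) * (w * v))) <= 2 * w.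
Proof.
have /andP[g0 g1] := g01; move=> /exp_g1; set e := expR _ => /andP[e1 e2].
have wp := w0.
have : 0 <= w * e <= 2 * w by (apply/andP; split; nra).
by move=> /andP[h1 h2]; apply/andP; split; nra.
Qed.

Lemma atan_slope v : `|v| <= L ->
  0 <= atan (g * (w * expR ((g - 1) * (w * v)))) <= 2 * w.
Proof.
move=> /slope_bounds /andP[h1 h2]; apply/andP; split; first exact: atan_ge0.
have := atan_lip1 (g * (w * expR ((g - 1) * (w * v)))) 0.
by rewrite atan0 !subr0 (ger0_norm h1) => /(le_trans (ler_norm _)) /le_trans; exact.
Qed.

Lemma alphaw_near b : `|b| <= theta0 -> `|alphaw w b - b| <= 3 * w.
Proof.
move=> bt; rewrite alphawE// [X in `|X|](_ : _ = atan (g * w) +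
  atan (g * (w * expR ((g - 1) * (w * vw w b))))); last by ring.
have /andP[a1 a2] := atan_gw; have /andP[a3 a4] := atan_slope (vw_abs b).
by rewrite ger0_norm; lra.
Qed.

Lemma dbw_bounds v : `|v| <= L -> 2 * w ^+ 2 < dbw g w v <= 8.
Proof.
move=> vL; have /andP[d1 d2] := dGw_bounds g01 (wv_abs vL).
have G := Gw_abs g w0 (wv_abs vL); rewrite /dbw.
have G2 : Gw g w v ^+ 2 <= 4 * L ^+ 2.
  rewrite -[Gw g w v ^+ 2]real_normK ?num_real//.
  have -> : 4 * L ^+ 2 = (2 * L) ^+ 2 by ring.
  have h2L : 0 <= 2 * L by have := L0; lra.
  rewrite ler_pXn2r ?nnegrE//; apply: (le_trans G).
  by rewrite ler_wpM2l.
have G0 := sqr_ge0 (Gw g w v); have [_ _ _ _ h] := nw.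
have w2 : 0 < w ^+ 2 by exact: exprn_gt0.
have d0 : 0 < 1 + Gw g w v ^+ 2 by lra.
rewrite ltr_pdivlMr// ler_pdivrMr//.
apply/andP; split; last by nra.
have : w ^+ 2 * (1 + Gw g w v ^+ 2) <= w ^+ 2 * (1 + 4 * L ^+ 2) by rewrite ler_pM2l//; lra.
have : 0 < w ^+ 2 * (1 + Gw g w v ^+ 2) by apply: mulr_gt0 => //; lra.
by lra.
Qed.

Lemma daw_dbw v : `|v| <= L -> `|daw g w v - dbw g w v| <= 2 * w ^+ 2.
Proof.
move=> vL; have /andP[g0 g1] := g01; have /andP[e1 e2] := exp_g1 vL.
rewrite /daw addrAC subrr add0r; set e := expR _ in e1 e2 *.
have s := sqr_ge0 (g * (w * e)); have w2 : 0 < w ^+ 2 by exact: exprn_gt0.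
have h0 : 0 <= g * (1 - g) <= 1 by nra.
have -> : g * (g - 1) * w ^+ 2 * e / (1 + (g * (w * e)) ^+ 2) =
  - (g * (1 - g) * (w ^+ 2 * e) / (1 + (g * (w * e)) ^+ 2)) by field; lra.
have h1 : 0 <= w ^+ 2 * e <= 2 * w ^+ 2 by nra.
set x := g * (1 - g) in h0 *; set y := w ^+ 2 * e in h1 *.
have h2 : 0 <= x * y <= 2 * w ^+ 2 by nra.
rewrite normrN ger0_norm; last by apply: divr_ge0; lra.
by rewrite ler_pdivrMr; nra.
Qed.

(** Both [bw] and [aw] differ from the angle of the ray to the vertical by nearly
    [g * w], in opposite directions. *)
Lemma shift_error v : `|v| <= L -> `|bw g w v - (aw g w v - 2 * g * w)| <= (5 + 2 * L) * w ^+ 2.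
Proof.
move=> vL; have /andP[g0 g1] := g01; have [_ w1 _ _ _] := nw.
set x := g * (w * expR ((g - 1) * (w * v))).
have -> : bw g w v - (aw g w v - 2 * g * w) =
  - (atan (g * w) - g * w) - (atan x - x) - (x - g * w) by rewrite /bw /aw -/x; ring.
have /andP[x0 x2] := slope_bounds vL; rewrite -/x in x0 x2.
have gw0 : 0 < g * w by exact: mulr_gt0.
have h1 : `|atan (g * w) - g * w| <= w ^+ 2.
  apply: (le_trans (atan_near _)); rewrite (gtr0_norm gw0).
  have gw1 : g * w <= w by nra.
  apply: (@le_trans _ _ (w ^+ 2 * 1)); last by rewrite mulr1.
  apply: ler_pM => //; [exact: exprn_ge0 (ltW _)|exact: ltW| |exact: le_trans gw1 w1].
  by rewrite ler_pXn2r// nnegrE ltW.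
have w6 : w <= 1 / 2 by (have tp := T10; have wp := w0; case: nw => _ _ ? _ _; nra).
have h2 : `|atan x - x| <= 4 * w ^+ 2.
  apply: (le_trans (atan_near _)); rewrite (ger0_norm x0).
  apply: (@le_trans _ _ ((2 * w) ^+ 2 * 1)); last by rewrite mulr1 exprMn; lra.
  apply: ler_pM => //; [exact: exprn_ge0|by rewrite ler_pXn2r// nnegrE; lra|by lra].
have h3 : `|x - g * w| <= 2 * L * w ^+ 2.
  have -> : x - g * w = g * w * (expR ((g - 1) * (w * v)) - 1) by rewrite /x; ring.
  have := expR_taylor0 (g1wv_bound g01 (wv_abs vL)).
  rewrite !normrM (gtr0_norm g0) (gtr0_norm w0) (@ltr0_norm _ (g - 1)); last by lra.
  move=> h; have v0 := normr_ge0 v.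
  have wv0 : 0 <= w * `|v| <= w * L by (apply/andP; split; nra).
  set y := w * `|v| in h wv0.
  have h' : `|expR ((g - 1) * (w * v)) - 1| <= 2 * (w * L) by apply: (le_trans h); nra.
  have := normr_ge0 (expR ((g - 1) * (w * v)) - 1).
  set z := `|_ - 1| in h' * => z0.
  have : g * w * z <= w * (2 * (w * L)).
    apply: ler_pM => //; [exact: ltW|nra].
  by rewrite expr2; lra.
apply: (le_trans (ler_normB _ _)); apply: (@le_trans _ _ (w ^+ 2 + 4 * w ^+ 2 + 2 * L * w ^+ 2)); last by lra.
apply: lerD => //; apply: (le_trans (ler_normB _ _)); rewrite normrN; exact: lerD.
Qed.

End Fixed.

End ExitAngle.

Section Substitution.
Context {R : realType}.
Notation leb := (@lebesgue_measure R).
Notation S := (@Sang R).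

Lemma Rintegral_supp (D D' : set R) (f : R -> R) :
  (forall x, ~ (D x /\ D' x) -> f x = 0) ->
  \int[leb]_(x in D) f x = \int[leb]_(x in D') f x.
Proof.
move=> f0; rewrite Rintegral_mkcond [RHS]Rintegral_mkcond.
suff E (A B : set R) : (forall x, ~ (A x /\ B x) -> f x = 0) -> f \_ A = f \_ (A `&` B).
  by rewrite (E D D')// (E D' D)// 1?setIC// => x h; apply: f0 => -[h1 h2]; apply: h.
move=> h; apply/funext => x; rewrite !patchE in_setI.
have [xA|xA] := boolP (x \in A) => //=; have [xB|xB] := boolP (x \in B) => //=.
by apply: h => -[_ /mem_set]; rewrite (negbTE xB).
Qed.

Lemma continuous_mul (f h : R -> R) : continuous f -> continuous h ->
  continuous (fun x => f x * h x).
Proof. by move=> cf ch x; apply: continuousM; [exact: cf|exact: ch]. Qed.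

Lemma continuous_comp_all (f h : R -> R) : continuous f -> continuous h ->
  continuous (fun x => h (f x)).
Proof.
by move=> cf ch x; apply: (@continuous_comp _ _ _ f h); [exact: cf|exact: ch].
Qed.

Lemma Rintegral_subst (F dF G : R -> R) (l : R) : 0 < l ->
  (forall x : R, is_derive x (1 : R) F (dF x)) -> continuous dF ->
  (forall x, `|x| <= l -> 0 < dF x) -> continuous G ->
  \int[leb]_(x in `[F (- l), F l]) G x = \int[leb]_(x in `[- l, l]) (G (F x) * dF x).
Proof.
move=> l0 DF cdF dF0 cG; rewrite /Rintegral; congr fine.
have F1 : derive1 F = dF by apply/funext => x; rewrite derive1E (@derive_val _ _ _ _ _ _ _ (DF x)).
have cF := derive_continuous DF.
rewrite (@integration_by_substitution_increasing _ F G).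
- by rewrite F1; apply: eq_integral.
- by lra.
- move=> x y; rewrite !in_itv/= => /andP[x1 x2] /andP[y1 y2] xy.
  have [|z zxy E] := MVT xy (fun z _ => DF z); first exact: continuous_subspaceT.
  rewrite -subr_gt0 E mulr_gt0 ?subr_gt0//; apply: dF0.
  by move: zxy; rewrite in_itv/= ler_norml => /andP[? ?]; apply/andP; split; lra.
- by rewrite F1 => x _; exact: cdF.
- by rewrite F1; apply/cvg_ex; exists (dF (- l)); apply: cvg_at_right_filter; exact: cdF.
- by rewrite F1; apply/cvg_ex; exists (dF l); apply: cvg_at_left_filter; exact: cdF.
- split.
  + by move=> x _; exact: (@ex_derive _ _ _ _ _ _ _ (DF x)).
  + by apply: cvg_at_right_filter; exact: cF.
  + by apply: cvg_at_left_filter; exact: cF.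
- exact: continuous_subspaceT.
Qed.

End Substitution.

Section ShiftLemma.
Context {R : realType} (theta0 g M : R) (k k' : R -> R -> R).
Hypotheses (th0 : 0 < theta0 < pi / 2) (g01 : 0 < g < 1)
  (sk : smooth_kernel theta0 M k k').
Notation leb := (@lebesgue_measure R).
Notation S := (@Sang R).
Notation t := (ttan theta0).
Notation L := (6 * (tan theta0 + 1)).
Local Notation narrow := (narrow theta0).

Lemma dbw_continuous w : 0 < w -> continuous (dbw g w).
Proof.
move=> w0 v; have D := @Gw_derive R g w v w0.
have s := sqr_ge0 (Gw g w v).
have d1 : 1 + Gw g w v ^+ 2 != 0 by rewrite gt_eqF//; lra.
have d2 : (1 + expR (g * (w * v))) ^+ 2 != 0.
  by rewrite gt_eqF// exprn_gt0//; have := expR_gt0 (g * (w * v)); lra.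
apply: differentiable_continuous; apply/derivable1_diffP; apply: ex_derive.
Qed.

Lemma daw_continuous w : 0 < w -> continuous (daw g w).
Proof.
move=> w0 v.
have s := sqr_ge0 (g * (w * expR ((g - 1) * (w * v)))).
have d1 : 1 + (g * (w * expR ((g - 1) * (w * v)))) ^+ 2 != 0 by rewrite gt_eqF//; lra.
have c2 : {for v, continuous (fun v => g * (g - 1) * w ^+ 2 * expR ((g - 1) * (w * v)) /
    (1 + (g * (w * expR ((g - 1) * (w * v)))) ^+ 2))}.
  apply: differentiable_continuous; apply/derivable1_diffP; apply: ex_derive.
exact: (continuousD (@dbw_continuous w w0 v) c2).
Qed.

Lemma dbw_daw_abs w v : narrow w -> `|v| <= L -> `|dbw g w v| <= 8 /\ `|daw g w v| <= 10.
Proof.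
move=> nw vL; have /andP[h1 h2] := dbw_bounds th0 g01 nw vL.
have w0 : 0 <= w ^+ 2 by exact: sqr_ge0.
have w1 : w ^+ 2 <= 1 by case: nw => w' w1 _ _ _; rewrite expr2; nra.
have := daw_dbw th0 g01 nw vL; rewrite ler_norml => /andP[h3 h4].
by rewrite !ger0_norm; lra.
Qed.

(** The substitutions below run over exit parameters of size at most [L], which cover the
    support of the density in both variables. *)
Lemma exit_slopes w : narrow w ->
  theta0 + 2 * w <= atan (Gw g w L) /\ atan (Gw g w (- L)) <= - (theta0 + 2 * w).
Proof.
move=> nw; have [w0 _ wL wt _] := nw.
have L0 : 0 < L by have := tan_S0_gt0 th0; lra.
have wL' : w * L <= 1 / 2 by have := mulr_gt0 w0 L0; lra.
have [G1 G2] := Gw_far g01 w0 L0 wL'.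
split; first exact: le_trans wt (le_atan G1).
by rewrite lerNr -atanN; apply: (le_trans wt); apply: le_atan; rewrite lerNr.
Qed.

Lemma bw_range w b : narrow w -> `|b| <= theta0 -> bw g w (- L) <= b <= bw g w L.
Proof.
move=> nw; have [A1 A2] := exit_slopes nw; have /andP[a1 a2] := atan_gw g01 nw.
rewrite ler_norml /bw; move: A1 A2 a1 a2.
set x := atan _; set y := atan _; set c := atan _ => A1 A2 a1 a2 /andP[b1 b2].
by apply/andP; split; lra.
Qed.

Lemma aw_range w u : narrow w -> `|u - 2 * g * w| <= theta0 ->
  S u /\ aw g w (- L) <= u <= aw g w L.
Proof.
move=> nw; have [w0 _ _ wt _] := nw; have [A1 A2] := exit_slopes nw.
have L0 : 0 <= L by have := tan_S0_gt0 th0; lra.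
have LL : `|L| <= L by rewrite ger0_norm.
have NLL : `|- L| <= L by rewrite normrN ger0_norm.
have /andP[s1 s2] := atan_slope th0 g01 nw LL.
have /andP[s3 s4] := atan_slope th0 g01 nw NLL.
have gw : 0 <= 2 * g * w <= 2 * w.
  have /andP[g0 g1] := g01; rewrite !mulr_ge0 ?(ltW g0) ?(ltW w0)//=.
  by rewrite -mulrA ler_pM2l// -[leRHS]mul1r ler_pM2r// ltW.
have wp := le_lt_trans wt (atan_ltpi2 _).
rewrite /aw; move: A1 A2 s1 s2 s3 s4 gw wp {wt nw LL NLL L0}.
set x := atan _; set y := atan _; set p := atan _; set q := atan _.
set r := 2 * g * w => A1 A2 s1 s2 s3 s4 /andP[r1 r2] wp; rewrite ler_norml => /andP[u1 u2].
split; first (by apply/SangP; rewrite ler_norml; apply/andP; split; lra).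
by apply/andP; split; lra.
Qed.

(** With the exit parameter [v] as variable of integration on both sides, [psi] is
    evaluated at the same points [aw g w v]. Only the arguments of [k] and the
    Jacobians differ, by second-order amounts ([shift_error], [daw_dbw]), so that
    no modulus of continuity of [psi] enters the bound. *)
Lemma alphaw_shift w a (psi : R -> R) C : narrow w -> ub psi -> (forall x, `|psi x| <= C) ->
  `|\int[leb]_(b in S) (k a b * psi (alphaw theta0 g w b)) -
    \int[leb]_(u in S) (k a (u - 2 * g * w) * psi u)| <=
  2 * L * (M * C * (2 + 8 * (5 + 2 * L))) * w ^+ 2.
Proof.
move=> nw upsi psiC; have [w0 w1 _ wt _] := nw; have /andP[g0 g1] := g01.
have /andP[t0 t1] := th0.
have M0 : 0 <= M by exact: le_trans (sk_ge0 sk 0 0) (sk_le sk 0 0).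
have L0 : 0 < L by have := tan_S0_gt0 th0; lra.
have cpsi := ucont_continuous upsi.1; have ck := ucont_continuous (k_ub sk a).1.
pose F1 b := k a b * psi (alphaw theta0 g w b).
pose F2 u := k a (u - 2 * g * w) * psi u.
have ca := alphaw_continuous th0 g01 nw.
have cF1 : continuous F1.
  by apply: (continuous_mul ck); exact: continuous_comp_all ca cpsi.
have cF2 : continuous F2.
  apply: continuous_mul cpsi; apply: (continuous_comp_all (f := fun u => u - 2 * g * w) _ ck) => u.
  by apply: cvgB; [exact: cvg_id|exact: cvg_cst].
have bd : forall x, `|x| <= L -> 0 < dbw g w x /\ 0 < daw g w x.
  move=> x xL; have /andP[h1 h2] := dbw_bounds th0 g01 nw xL.
  have := daw_dbw th0 g01 nw xL; have w2 : 0 <= w ^+ 2 by exact: sqr_ge0.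
  by rewrite ler_norml => /andP[h3 _]; split; lra.
have E1 : \int[leb]_(b in S) F1 b = \int[leb]_(x in `[- L, L]) (F1 (bw g w x) * dbw g w x).
  rewrite -(Rintegral_subst L0 (fun x => bw_derive g x w0) (dbw_continuous w0))//; last first.
    by move=> x /bd[].
  apply: Rintegral_supp => x h; rewrite /F1 (sk_supp sk) ?mul0r// ltNge; apply/negP => xt.
  apply: h; split; first by apply/SangP; exact: le_trans xt (ltW t1).
  by rewrite /= in_itv/= bw_range.
have E2 : \int[leb]_(b in S) F2 b = \int[leb]_(x in `[- L, L]) (F2 (aw g w x) * daw g w x).
  rewrite -(Rintegral_subst L0 (fun x => aw_derive g x w0) (daw_continuous w0))//; last first.
    by move=> x /bd[].
  apply: Rintegral_supp => x h; rewrite /F2 (sk_supp sk) ?mul0r// ltNge; apply/negP => xt.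
  by have [Sx xr] := aw_range nw xt; apply: h; split => //=; rewrite in_itv.
have E0 v : F1 (bw g w v) = k a (bw g w v) * psi (aw g w v).
  rewrite /F1; have [bt|bt] := leP `|bw g w v| theta0; last by rewrite (sk_supp sk)// !mul0r.
  by rewrite /alphaw (vw_bw th0 g01 nw).
rewrite -/(F1 _) E1 E2.
set I : set R := [set` `[- L, L]%R].
have mI : measurable I by exact: measurable_itv.
have lI : leb I = (2 * L)%:E.
  rewrite /I lebesgue_measure_itv/= lte_fin gtrN//.
  by rewrite -EFinD; congr EFin; ring.
have lIy : (leb I < +oo)%E by rewrite lI ltry.
have C0 : 0 <= C by exact: le_trans (psiC 0).
have kM x y : `|k x y| <= M by exact: (k_norm sk).
have cont_bmf (f : R -> R) D : continuous f -> (forall x, I x -> `|f x| <= D) ->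
    bmf I f.
  move=> cf fD; split; last by exists D.
  by apply: measurable_funTS; exact: continuous_measurable_fun.
have iL x : I x -> `|x| <= L by rewrite /I/= in_itv/= ler_norml.
have F1C x : `|F1 x| <= M * C by rewrite normrM ler_pM.
have F2C x : `|F2 x| <= M * C by rewrite normrM ler_pM.
have b1 : bmf I (fun x => F1 (bw g w x) * dbw g w x).
  apply: (@cont_bmf _ (M * C * 8)).
    apply: continuous_mul; last exact: dbw_continuous.
    by apply: continuous_comp_all cF1; exact: (derive_continuous (fun x => bw_derive g x w0)).
  move=> x /iL xL.
  by rewrite normrM ler_pM//; case: (dbw_daw_abs nw xL).
have b2 : bmf I (fun x => F2 (aw g w x) * daw g w x).
  apply: (@cont_bmf _ (M * C * 10)).
    apply: continuous_mul; last exact: daw_continuous.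
    by apply: continuous_comp_all cF2; exact: (derive_continuous (fun x => aw_derive g x w0)).
  move=> x /iL xL.
  by rewrite normrM ler_pM//; case: (dbw_daw_abs nw xL).
rewrite -(@fintB _ _ _ leb I mI lIy _ _ b1 b2).
have -> : 2 * L * (M * C * (2 + 8 * (5 + 2 * L))) * w ^+ 2 =
  (M * C * (2 + 8 * (5 + 2 * L))) * w ^+ 2 * fine (leb I).
  by rewrite lI/=; ring.
apply: (@fint_norm_le _ _ _ leb I mI lIy _ _ (bmfB b1 b2)) => x /iL xL.
have [h1 _] := dbw_daw_abs nw xL.
have h3 := daw_dbw th0 g01 nw xL; have h4 := shift_error th0 g01 nw xL.
rewrite E0 /F2.
have -> : k a (bw g w x) * psi (aw g w x) * dbw g w x -
    k a (aw g w x - 2 * g * w) * psi (aw g w x) * daw g w x =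
  psi (aw g w x) * ((k a (bw g w x) - k a (aw g w x - 2 * g * w)) * dbw g w x) -
  psi (aw g w x) * (k a (aw g w x - 2 * g * w) * (daw g w x - dbw g w x)) by ring.
have -> : M * C * (2 + 8 * (5 + 2 * L)) * w ^+ 2 =
  C * (M * ((5 + 2 * L) * w ^+ 2) * 8) + C * (M * (2 * w ^+ 2)) by ring.
apply: (le_trans (ler_normB _ _)); apply: lerD; rewrite normrM ler_pM//.
  rewrite normrM ler_pM//.
  by apply: (le_trans (sk_lip sk a _ _)); rewrite ler_wpM2l.
by rewrite normrM ler_pM.
Qed.

End ShiftLemma.

(** * Differentiation of the kernel *)

Section KernelDerivative.
Context {R : realType} (theta0 M : R) (k k' : R -> R -> R).
Hypothesis sk : smooth_kernel theta0 M k k'.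
Notation leb := (@lebesgue_measure R).
Notation S := (@Sang R).

Let M0 : 0 <= M. Proof. exact: le_trans (sk_ge0 sk 0 0) (sk_le sk 0 0). Qed.

Lemma k'_abs a b : `|k' a b| <= 2 * M.
Proof.
have := sk_taylor sk a b 1; rewrite expr1n mulr1 mul1r.
have := sk_ge0 sk a b; have := sk_ge0 sk a (b - 1).
have := sk_le sk a b; have := sk_le sk a (b - 1).
by rewrite !ler_norml => ? ? ? ? /andP[? ?]; apply/andP; split; lra.
Qed.

Lemma measurable_k' : measurable_fun setT (fun p : R * R => k' p.1 p.2).
Proof.
pose h (n : nat) (p : R * R) : R := n.+1%:R * (k p.1 p.2 - k p.1 (p.2 - n.+1%:R^-1)).
apply: (measurable_fun_cvg (h := h)) => [n|p _].
  apply: measurable_funM; first exact: measurable_cst.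
  apply: measurable_funB; first exact: sk_meas sk.
  have mp : measurable_fun setT (fun p : R * R => (p.1, p.2 - n.+1%:R^-1)).
    apply/measurable_fun_pairP; split => /=; first exact: measurable_fst.
    by apply: measurable_funB; [exact: measurable_snd|exact: measurable_cst].
  exact: (measurableT_comp (sk_meas sk) mp).
apply/cvgrPdist_le => e e0.
have c : (fun n => M * (n.+1%:R^-1 : R)) @ \oo --> (M * 0 : R).
  by apply: cvgM; [exact: cvg_cst|exact: cvg_harmonic].
rewrite mulr0 in c; have /cvgrPdist_le /(_ e e0) := c.
apply: filterS => n; rewrite sub0r normrN => /(le_trans (ler_norm _)) hn.
apply: le_trans hn; have n0 : (0:R) < n.+1%:R by rewrite ltr0n.
have := sk_taylor sk p.1 p.2 n.+1%:R^-1.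
have -> : k' p.1 p.2 - h n p = n.+1%:R *
   (k p.1 (p.2 - n.+1%:R^-1) - k p.1 p.2 + n.+1%:R^-1 * k' p.1 p.2).
  by rewrite /h; field; rewrite gt_eqF.
move=> H; rewrite normrM gtr0_norm//.
apply: (le_trans (ler_wpM2l (ltW n0) H)).
by rewrite expr2 mulrCA mulrA mulrA -[M * _ * _]mulrA mulfV ?gt_eqF// mulr1.
Qed.

Lemma bmf2_k' : bmf2 k'.
Proof. by split; [exact: measurable_k'|exists (2 * M) => x y _ _; exact: k'_abs]. Qed.

Lemma k'_equi (e : R) : 0 < e -> exists2 del : R, 0 < del &
  forall a a' b, `|a - a'| <= del -> `|k' a b - k' a' b| <= e.
Proof.
move=> e0; pose h := e / (4 * M + 4).
have m0 : 0 < 4 * M + 4 by have := M0; lra.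
have h0 : 0 < h by exact: divr_gt0.
have [del d0 H] := sk_equi sk (mulr_gt0 e0 (divr_gt0 h0 (ltr0n R 4))).
exists del => // a a' b /H {}H.
have h1 := sk_taylor sk a b h; have h2 := sk_taylor sk a' b h.
have h3 := H b; have h4 := H (b - h).
have mh : M * h ^+ 2 <= h * (e / 4).
  have -> : e / 4 = h * (M + 1) by rewrite /h; field; rewrite gt_eqF//; lra.
  by have := M0; rewrite expr2; nra.
have : `|h * (k' a b - k' a' b)| <= h * e.
  move: h1 h2 h3 h4; rewrite mulrBr !ler_norml => /andP[? ?] /andP[? ?] /andP[? ?] /andP[? ?].
  by apply/andP; split; lra.
by rewrite normrM (gtr0_norm h0) ler_pM2l.
Qed.

Definition Dop (psi : R -> R) a : R := \int[leb]_(b in S) (k' a b * psi b).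

Lemma k'_bmf a : bmf S (k' a).
Proof.
split; last by exists (2 * M) => b _; exact: k'_abs.
apply: measurable_funTS.
exact: (measurableT_comp measurable_k' (@pair1_measurable _ _ R R a)).
Qed.

Lemma Dop_ub psi : bmf S psi -> ub (Dop psi).
Proof.
move=> bp; have [_ [C pC]] := bp; have p0 := @pi_gt0 R.
have C0 : 0 <= C by apply: le_trans (pC 0 _) => //; apply/SangP; rewrite normr0; lra.
have b1 a := bmfM (k'_bmf a) bp.
split; last first.
  exists (2 * M * C * pi) => a; apply: IS_norm_le => // b Sb.
  by rewrite normrM ler_pM// ?pC// k'_abs.
move=> e e0; have d0 : 0 < C * pi + 1 by have := mulr_ge0 C0 (ltW p0); lra.
have [del del0 H] := k'_equi (divr_gt0 e0 d0); exists del => // a a' /H {}H.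
rewrite /Dop -ISB//.
apply: (@le_trans _ _ (e / (C * pi + 1) * C * pi)).
  apply: IS_norm_le; first exact: bmfB.
  by move=> b Sb; rewrite -mulrBl normrM ler_pM// pC.
rewrite -mulrA mulrAC ler_pdivrMr// ler_pM2l//; lra.
Qed.

Lemma k_shift psi a h C : ub psi -> (forall x, `|psi x| <= C) ->
  `|\int[leb]_(u in S) (k a (u - h) * psi u) - (Top k psi a - h * Dop psi a)| <=
  M * C * pi * h ^+ 2.
Proof.
move=> up pC; have bp : bmf S psi by apply: ub_bmf => //; exact: mS.
have bk := k_bmf sk a; have bk' := k'_bmf a.
have bs : bmf S (fun u => k a (u - h)).
  split; last by exists M => x _; exact: (k_norm sk).
  apply: measurable_funTS; apply: continuous_measurable_fun => u.
  have ck := ucont_continuous (k_ub sk a).1.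
  apply: (@continuous_comp _ _ _ (fun u => u - h) (k a)); last exact: ck.
  by apply: cvgB; [exact: cvg_id|exact: cvg_cst].
have b1 := bmfM bs bp; have b2 := bmfM bk bp; have b3 := bmfM bk' bp.
rewrite /Top /Dop -ISZ// -ISB//; last exact: bmfZ.
rewrite -ISB//; last by apply: bmfB => //; exact: bmfZ.
have -> : M * C * pi * h ^+ 2 = M * h ^+ 2 * C * pi by ring.
apply: IS_norm_le; first by apply: bmfB => //; apply: bmfB => //; exact: bmfZ.
move=> b _.
have -> : k a (b - h) * psi b - (k a b * psi b - h * (k' a b * psi b)) =
  (k a (b - h) - k a b + h * k' a b) * psi b by ring.
by rewrite normrM ler_pM// (sk_taylor sk).
Qed.

Section StationaryDensity.
Variable varpi : R -> R.
Hypotheses (bv : bmf S varpi) (v0 : forall b, S b -> 0 <= varpi b)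
  (v1 : \int[leb]_(b in S) varpi b = 1)
  (vinv : forall b, S b -> varpi b = Tadj k varpi b).

(** Differentiation under the integral sign in the stationarity equation. *)
Lemma deriveS_varpi b : `|b| < pi / 2 -> deriveS varpi b = Tadj k' varpi b.
Proof.
move=> bp; have Sb : S b by apply/SangP; exact: ltW.
apply: deriveS_eq => // e e0; exists (e / (M + 1)).
  by apply: divr_gt0 => //; have := M0; lra.
move=> y yb nyb Sy; have m1 : 0 < M + 1 by have := M0; lra.
have yb0 : y - b != 0 by rewrite subr_eq0.
have yb0' : 0 < `|y - b| by rewrite normr_gt0.
have bk c : bmf S (fun a => varpi a * k a c).
  apply: bmfM => //; split; last by exists M => x _; exact: (k_norm sk).
  apply: measurable_funTS.
  exact: (measurableT_comp (sk_meas sk) (@pair2_measurable _ _ R R c)).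
have bk' c : bmf S (fun a => varpi a * k' a c).
  apply: bmfM => //; split; last by exists (2 * M) => x _; exact: k'_abs.
  apply: measurable_funTS.
  exact: (measurableT_comp measurable_k' (@pair2_measurable _ _ R R c)).
have -> : quotientS varpi b y - Tadj k' varpi b =
    (Tadj k varpi y - Tadj k varpi b - (y - b) * Tadj k' varpi b) / (y - b).
  by rewrite /quotientS -!vinv//; field.
rewrite normrM normfV ler_pdivrMr// /Tadj -ISZ// -ISB// -ISB; [|exact: bmfB|exact: bmfZ].
have h : `|y - b| * (M + 1) <= e by move: yb; rewrite ltr_pdivlMr// => /ltW.
apply: (@le_trans _ _ (\int[leb]_(a in S) (M * `|y - b| ^+ 2 * varpi a))); last first.
  rewrite ISZ// v1 mulr1 expr2 mulrA; apply: ler_wpM2r; first exact: ltW.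
  by have := M0; nra.
have bd : bmf S (fun a => varpi a * k a y - varpi a * k a b - (y - b) * (varpi a * k' a b)).
  by apply: bmfB; [exact: bmfB|exact: bmfZ].
have bZ : bmf S (fun a => M * `|y - b| ^+ 2 * varpi a) by exact: bmfZ.
have dom a : S a -> `|varpi a * k a y - varpi a * k a b - (y - b) * (varpi a * k' a b)| <=
    M * `|y - b| ^+ 2 * varpi a.
  move=> Sa; have := sk_taylor sk a b (b - y); rewrite subKr.
  have -> : varpi a * k a y - varpi a * k a b - (y - b) * (varpi a * k' a b) =
    (k a y - k a b + (b - y) * k' a b) * varpi a by ring.
  by rewrite normrM (ger0_norm (v0 Sa)) real_normK ?num_real// -sqrrN opprB => h';
    apply: ler_wpM2r => //; exact: v0.
rewrite ler_norml; apply/andP; split.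
  rewrite -[leLHS]mulN1r -ISZ//; apply: le_IS => //; first exact: bmfZ.
  by move=> a /dom; rewrite ler_norml mulN1r => /andP[].
by apply: le_IS => // a /dom; rewrite ler_norml => /andP[].
Qed.

Lemma Rintegral_S_open (f f' : R -> R) : bmf S f' ->
  (forall b, `|b| < pi / 2 -> f b = f' b) ->
  \int[leb]_(b in S) f b = \int[leb]_(b in S) f' b.
Proof.
move=> bf ff; have p0 := @pi_gt0 R.
pose I : set R := [set` `]- (pi / 2), pi / 2[%R].
have mI : measurable I by exact: measurable_itv.
have IS' : I `<=` S by move=> x; rewrite /I /Sang/= !in_itv/= => /andP[/ltW-> /ltW->].
have mf' : measurable_fun I f' by exact: (measurable_funS mS IS' bf.1).
have mf : measurable_fun I f.
  apply: eq_measurable_fun mf' => x; rewrite inE /I/= in_itv/= -ltr_norml => h.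
  by rewrite ff.
have E (h : R -> R) : measurable_fun I h ->
    \int[leb]_(b in S) h b = \int[leb]_(b in I) h b.
  move=> mh; rewrite /Rintegral; congr fine.
  have mE : measurable_fun I (EFin \o h) by apply/measurable_EFinP.
  rewrite /I (@integral_itv_bndo_bndc _ _ _ (EFin \o h))//.
  rewrite (@integral_itv_obnd_cbnd _ _ _ (EFin \o h))//.
  by apply/measurable_EFinP; apply/measurable_fun_itv_bndo_bndcP.
rewrite E// E//; apply: eq_Rintegral => b; rewrite inE /I/= in_itv/= -ltr_norml.
exact: ff.
Qed.

(** By duality the derivative moves from the stationary density to the kernel. *)
Lemma A2E psi : CbS psi ->
  A2 varpi psi = \int[leb]_(a in S) (varpi a * Dop (psi \o @clamp R) a).
Proof.
move=> cpsi; pose p := psi \o @clamp R.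
have bp : bmf S p by apply: ub_bmf; [exact: mS|exact: ub_CbS].
rewrite -[RHS](duality2 bmf2_k' bv bp).
have bvt : bmf S (fun b => Tadj k' varpi b).
  have b2 := bmf2M (bmf2_snd bv) (bmf2_swap bmf2_k').
  have := bmf2_integral b2; apply: bmf_eq => b _; apply: eq_IS => a Sa.
  by rewrite patchE mem_set.
transitivity (\int[leb]_(b in S) (p b * deriveS varpi b)).
  by apply: eq_IS => b Sb; rewrite /p /= clamp_id.
apply: Rintegral_S_open; first exact: bmfM.
by move=> b bp'; rewrite deriveS_varpi// mulrC.
Qed.

End StationaryDensity.

End KernelDerivative.

(** * Second-order drift *)

Section UniformOrder.
Context {R : realType} {T : Type} (D : set T).
Implicit Types (f h u : R -> T -> R) (n m : nat).

(** [f w b = O(w ^ n)] as [w] tends to 0 from above, uniformly in [b] in [D]. *)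
Definition uO n f := exists C : R, exists2 w0 : R, 0 < w0 &
  forall w b, 0 < w <= w0 -> D b -> `|f w b| <= C * w ^+ n.

Lemma uO_norm n f : uO n f -> exists2 C : R, 0 <= C & exists2 w0 : R, 0 < w0 <= 1 &
  forall w b, 0 < w <= w0 -> D b -> `|f w b| <= C * w ^+ n.
Proof.
move=> [C [w0 w00 H]]; exists `|C| => //; exists (Num.min w0 1).
  by rewrite lt_min w00 ltr01 ge_min lexx orbT.
move=> w b; rewrite le_min => /andP[wp /andP[ww w1]] Db.
apply: (@le_trans _ _ (C * w ^+ n)); first by apply: H => //; rewrite wp.
by rewrite ler_wpM2r ?ler_norm// exprn_ge0// ltW.
Qed.

Lemma uO_eq n f h w0 : 0 < w0 -> (forall w b, 0 < w <= w0 -> D b -> f w b = h w b) ->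
  uO n f -> uO n h.
Proof.
move=> w00 E [C [w1 w10 H]]; exists C; exists (Num.min w0 w1); first by rewrite lt_min w00.
move=> w b; rewrite le_min => /andP[wp /andP[h1 h2]] Db.
by rewrite -E ?wp ?h1//; apply: H => //; rewrite wp.
Qed.

Lemma uO_ext n f h : (forall w b, f w b = h w b) -> uO n f -> uO n h.
Proof. by move=> E; apply: (uO_eq ltr01) => w b _ _. Qed.

Lemma uO_le n m f : (m <= n)%N -> uO n f -> uO m f.
Proof.
move=> mn /uO_norm[C C0 [w0 /andP[w00 w01] H]]; exists C; exists w0 => // w b /andP[wp ww] Db.
apply: (le_trans (H w b _ Db)); first by rewrite wp.
apply: ler_wpM2l => //; apply: ler_wiXn2l => //; first exact: ltW.
exact: le_trans w01.
Qed.

Lemma uOD n f h : uO n f -> uO n h -> uO n (fun w b => f w b + h w b).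
Proof.
move=> [C [w0 w00 H]] [C' [w1 w10 H']]; exists (C + C'); exists (Num.min w0 w1).
  by rewrite lt_min w00.
move=> w b; rewrite le_min => /andP[wp /andP[h1 h2]] Db.
apply: (le_trans (ler_normD _ _)); rewrite mulrDl.
by apply: lerD; [apply: H|apply: H'] => //; rewrite wp.
Qed.

Lemma uON n f : uO n f -> uO n (fun w b => - f w b).
Proof.
by move=> [C [w0 w00 H]]; exists C; exists w0 => // w b *; rewrite normrN; exact: H.
Qed.

Lemma uOB n f h : uO n f -> uO n h -> uO n (fun w b => f w b - h w b).
Proof. by move=> Hf Hh; apply: uOD => //; exact: uON. Qed.

Lemma uOM n m f h : uO n f -> uO m h -> uO (n + m) (fun w b => f w b * h w b).
Proof.
move=> /uO_norm[C C0 [w0 /andP[w00 _] H]] /uO_norm[C' C'0 [w1 /andP[w10 _] H']].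
exists (C * C'); exists (Num.min w0 w1); first by rewrite lt_min w00.
move=> w b; rewrite le_min => /andP[wp /andP[h1 h2]] Db.
rewrite normrM exprD mulrACA.
by apply: ler_pM => //; [apply: H|apply: H'] => //; rewrite wp.
Qed.

Lemma uO_w : uO 1 (fun w _ => w).
Proof.
by exists 1; exists 1 => // w b /andP[wp _] _; rewrite mul1r expr1 gtr0_norm.
Qed.

Lemma uO_bnd (F : T -> R) C : (forall b, D b -> `|F b| <= C) -> uO 0 (fun _ b => F b).
Proof. by move=> H; exists C; exists 1 => // w b _ Db; rewrite expr0 mulr1 H. Qed.

Lemma uO_cst (c : R) : uO 0 (fun _ _ => c).
Proof. by apply: (@uO_bnd _ `|c|). Qed.

Lemma uO_div n f : uO n.+1 (fun w b => w * f w b) -> uO n f.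
Proof.
move=> [C [w0 w00 H]]; exists C; exists w0 => // w b ww Db.
have wp : 0 < w by case/andP: ww.
by have := H w b ww Db; rewrite normrM (gtr0_norm wp) exprS mulrCA ler_pM2l.
Qed.

Lemma uO_small f : uO 1 f -> exists2 w0 : R, 0 < w0 &
  forall w b, 0 < w <= w0 -> D b -> `|f w b| <= 1 / 2.
Proof.
move=> /uO_norm[C C0 [w0 /andP[w00 _] H]]; have c0 : 0 < 2 * (C + 1) by lra.
exists (Num.min w0 (2 * (C + 1))^-1); first by rewrite lt_min w00 invr_gt0.
move=> w b; rewrite le_min => /andP[wp /andP[h1 h2]] Db.
apply: (le_trans (H w b _ Db)); first by rewrite wp.
move: h2; rewrite -[X in _ <= X]mul1r ler_pdivlMr// expr1; nra.
Qed.

Lemma uO_comp n m (F : R -> R) (C : R) u : (forall x, `|x| <= 1 / 2 -> `|F x| <= C * `|x| ^+ m) ->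
  uO 1 u -> (n <= m)%N -> uO n (fun w b => F (u w b)).
Proof.
move=> HF Hu nm; apply: (uO_le nm); have [w0 w00 H0] := uO_small Hu.
have [C' C'0 [w1 /andP[w10 _] H]] := uO_norm Hu.
exists (`|C| * C' ^+ m); exists (Num.min w0 w1); first by rewrite lt_min w00.
move=> w b; rewrite le_min => /andP[wp /andP[h1 h2]] Db.
apply: (le_trans (HF _ _)); first by apply: H0 => //; rewrite wp.
rewrite -mulrA -exprMn; apply: (@le_trans _ _ (`|C| * `|u w b| ^+ m)).
  by rewrite ler_wpM2r ?ler_norm// exprn_ge0.
rewrite ler_wpM2l//; apply: lerXn2r; rewrite ?nnegrE//; first by rewrite mulr_ge0// ltW.
by have := H w b; rewrite expr1 wp; exact.
Qed.

End UniformOrder.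

Section Expansions.
Context {R : realType} (theta0 g : R).
Hypotheses (th0 : 0 < theta0 < pi / 2) (g01 : 0 < g < 1).
Notation t := (ttan theta0).
Notation c := (fun b => 2 * g + (4 * g - 2) * t b ^+ 2).
Local Notation v := (vw theta0 g).
Local Notation D := [set b : R | `|b| <= theta0].
Local Notation O := (uO D).

Lemma uO_t : O 0 (fun _ b => t b).
Proof. by apply: (@uO_bnd _ _ _ _ (tan theta0)) => b _; exact: ttan_abs. Qed.

Lemma uO_v : O 0 v.
Proof.
have [w0 w00 H] := narrow_exists th0.
exists (6 * (tan theta0 + 1)); exists w0 => // w b /H nw _; rewrite expr0 mulr1.
exact: vw_abs.
Qed.

Let uO_wv : O 1 (fun w b => w * v w b). Proof. exact: (uOM (@uO_w _ _ _) uO_v). Qed.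

Let uO_e (x : R) : O 1 (fun w b => x * (w * v w b)).
Proof. exact: (uOM (@uO_cst _ _ _ x) uO_wv). Qed.

Let e0 (x : R) : O 1 (fun w b => expR (x * (w * v w b)) - 1).
Proof.
apply: (@uO_comp _ _ _ 1 1 (fun y => expR y - 1) 2 _ _ (uO_e x)) => // y.
by rewrite expr1; exact: expR_taylor0.
Qed.

Let e1 (x : R) : O 2 (fun w b => expR (x * (w * v w b)) - 1 - x * (w * v w b)).
Proof.
by apply: (@uO_comp _ _ _ 2 2 (fun y => expR y - 1 - y) 2 _ _ (uO_e x)) => // y; exact: expR_taylor1.
Qed.

Let e2 (x : R) : O 3 (fun w b => expR (x * (w * v w b)) - 1 - x * (w * v w b) - (x * (w * v w b)) ^+ 2 / 2).
Proof.
by apply: (@uO_comp _ _ _ 3 3 (fun y => expR y - 1 - y - y ^+ 2 / 2) 2 _ _ (uO_e x)) => // y;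
  exact: expR_taylor2.
Qed.

Lemma vw_equation : exists2 w0 : R, 0 < w0 & forall w b, 0 < w <= w0 ->
  (expR (1 * (w * v w b)) - 1) * (1 - g * w * t b) =
  w * (1 + expR (g * (w * v w b))) * (t b + g * w).
Proof.
have [w0 w00 H] := narrow_exists th0.
exists w0 => // w b ww; have nw := H w ww; have wp : 0 < w by case/andP: ww.
have := vwE th0 g01 nw b; rewrite /Gw /tauw mul1r.
have := expR_gt0 (g * (w * v w b)); set E := expR (g * _) => E0.
have d := gwt_den th0 g01 nw b.
have d0 : 1 - g * w * t b != 0 by rewrite gt_eqF//; lra.
have d1 : w * (1 + E) != 0 by rewrite gt_eqF// mulr_gt0//; lra.
by move=> /eqP; rewrite eqr_div// => /eqP ->; ring.
Qed.

Ltac uo := repeat (first [ exact: uO_t | exact: uO_v | exact: uO_wv | exact: uO_w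
  | exact: uO_cst | exact: e0 | exact: e1 | exact: e2 ]).

(** [vw_equation] divided by [w]: its left side is [v + O(w)] and its right side
    [2 * t + O(w)]. *)
Lemma v_order1 : O 1 (fun w b => v w b - 2 * t b).
Proof.
have [w0 w00 H] := vw_equation.
apply: uO_div.
have X1 := uOM (@uO_w _ _ D) (uOM (e0 g) uO_t).
have X2 := uOM (@uO_w _ _ D) (uOM (@uO_w _ _ D) (uOM (@uO_cst _ _ D g)
  (uOD (uO_le (leq0n 1) (e0 g)) (@uO_cst _ _ D 2)))).
have X3 := uOM (e0 1) (uOM (@uO_w _ _ D) (uOM (@uO_cst _ _ D g) uO_t)).
have := uOB (uOD (uOD X1 X2) X3) (e1 1).
apply: (uO_eq w00) => w b ww _; have := H w b ww.
set e := expR (1 * _); set f := expR _; lra.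
Qed.

(** Same equation, now inserting [v_order1] in the terms of order [w ^ 2]. *)
Lemma v_order2 : O 2 (fun w b => v w b - 2 * t b - w * c b).
Proof.
have [w0 w00 H] := vw_equation.
apply: uO_div.
have W := @uO_w R R D; have s1 := v_order1; have t0 := uO_t; have v0 := uO_v.
have K x := @uO_cst R R D x.
have X1 := uOM W (uOM W (uOM s1 (uOM (K (2 * g)) t0))).
have X2 := uOM W (uOM W (uOM s1 (uOM (uOD v0 (uOM (K 2) t0)) (K (1 / 2))))).
have X3 := uOM W (uOM W (uOM W (uOD (uOM (K (g ^+ 2)) v0) (uOM (K (g / 2)) (uOM t0 (uOM v0 v0)))))).
have X4 := uOM W (uOM (e1 g) (uOD t0 (uO_le (leq0n 1) (uOM (K g) W)))).
have X5 := uOM (uOM (K g) (uOM W t0)) (e2 1).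
have := uOB (uOD (uOD (uOD (uOB X1 X2) X3) X4) (uO_le (leqnSn 3) X5)) (e2 1).
apply: (uO_eq w00) => w b ww _; have := H w b ww.
set e := expR (1 * _); set f := expR _; lra.
Qed.

(** Here [p] and [q] stand for the two correctors at the new angle. The terms of
    order [w ^ 2] collect those of [v], of the square of [nu * w * v], and of the
    product of [p] with the changes of [z] and of [w]. *)
Lemma lyapunov_order nu (p q : R -> R -> R) : O 0 p -> O 0 q ->
  O 3 (fun w b => expR (nu * (w * v w b)) * (1 + nu * w * expR ((g - 1) * (w * v w b)) * p w b
      + nu * w ^+ 2 * expR (2 * (g - 1) * (w * v w b)) * q w b) -
    (1 + nu * w * (2 * t b + p w b) + nu * w ^+ 2 * (2 * g * (1 + 2 * t b ^+ 2)
      + 2 * (nu - 1) * t b ^+ 2 + 2 * (nu + g - 1) * (t b * p w b) + q w b))).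
Proof.
move=> p0 q0.
have W := @uO_w R R D; have s1 := v_order1; have r2 := v_order2; have t0 := uO_t; have v0 := uO_v.
have K x := @uO_cst R R D x.
have X1 := uOM (K nu) (uOM W r2).
have X2 := uOM (K (nu ^+ 2 / 2)) (uOM W (uOM W (uOM s1 (uOD v0 (uOM (K 2) t0))))).
have X3 := e2 nu.
have X4 := uOM (K nu) (uOM W (uOM p0 (uOD (uOM (K (nu + g - 1)) (uOM W s1)) (e1 (nu + g - 1))))).
have X5 := uOM (K nu) (uOM W (uOM W (uOM q0 (e0 (nu + 2 * (g - 1)))))).
have := uOD (uOD (uOD (uOD X1 X2) X3) X4) X5.
apply: uO_ext => w b.
have E1 : expR ((nu + g - 1) * (w * v w b)) = expR (nu * (w * v w b)) * expR ((g - 1) * (w * v w b)).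
  by rewrite -expRD; congr expR; ring.
have E2 : expR ((nu + 2 * (g - 1)) * (w * v w b)) =
    expR (nu * (w * v w b)) * expR (2 * (g - 1) * (w * v w b)).
  by rewrite -expRD; congr expR; ring.
by rewrite E1 E2; field.
Qed.

End Expansions.

Section Drift.
Context {R : realType} (theta0 g M : R) (k k' : R -> R -> R).
Hypotheses (th0 : 0 < theta0 < pi / 2) (g01 : 0 < g < 1)
  (sk : smooth_kernel theta0 M k k').
Notation leb := (@lebesgue_measure R).
Notation S := (@Sang R).
Notation t := (ttan theta0).
Local Notation T := (Top k).
Local Notation v := (vw theta0 g).
Local Notation al := (alphaw theta0 g).

Let ubS f : ub f -> bmf S f. Proof. by apply: ub_bmf; exact: mS. Qed.

(** [z `^ nu * Lyap nu w (psi a) (psi1 a)], with [w = z `^ (g - 1)], is the Lyapunov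
    function; [Lyap_next] is its value after one step, in units of [z `^ nu]. *)
Definition Lyap (nu w p q : R) : R := 1 + nu * w * p + nu * w ^+ 2 * q.

Definition Lyap_next (nu : R) (psi psi1 : R -> R) w b : R :=
  expR (nu * (w * v w b)) * (1 + nu * w * expR ((g - 1) * (w * v w b)) * psi (al w b)
      + nu * w ^+ 2 * expR (2 * (g - 1) * (w * v w b)) * psi1 (al w b)).

Variables (nu : R) (psi psi1 : R -> R).
Hypotheses (upsi : ub psi) (upsi1 : ub psi1).
Local Notation fn := (Lyap_next nu psi psi1).

Lemma continuous_bounded_bmf (f : R -> R) (C : R) : continuous f ->
  (forall x, `|f x| <= C) -> bmf S f.
Proof.
move=> cf fC; split; last by exists C.
by apply: measurable_funTS; exact: continuous_measurable_fun.
Qed.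

Lemma bmf_comp_alphaw w f : narrow theta0 w -> ub f -> bmf S (fun b => f (al w b)).
Proof.
move=> nw uf; have [_ [C fC]] := uf.
apply: (@continuous_bounded_bmf _ C) => //.
exact: (continuous_comp_all (alphaw_continuous th0 g01 nw) (ucont_continuous uf.1)).
Qed.

Lemma bmf_exp_v w x : narrow theta0 w -> bmf S (fun b => expR (x * (w * v w b))).
Proof.
move=> nw; apply: (@continuous_bounded_bmf _ (expR (`|x| * (1 / 2)))) => [|b].
  apply: (continuous_comp_all (f := fun b => x * (w * v w b)) _ (@continuous_expR R)).
  apply: (continuous_mul (f := fun=> x)); first exact: cst_continuous.
  apply: (continuous_mul (f := fun=> w)); first exact: cst_continuous.
  exact: (vw_continuous th0 g01 nw).
rewrite ger0_norm ?expR_ge0// ler_expR (le_trans (ler_norm _))// normrM ler_wpM2l//.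
exact: (wv_abs th0 nw (vw_abs th0 g01 nw b)).
Qed.

Lemma bmf_Lyap_next w : narrow theta0 w -> bmf S (fn w).
Proof.
move=> nw; apply: bmfM; first exact: bmf_exp_v.
apply: bmfD; first (apply: bmfD; first exact: bmf_cst).
  by apply: bmfM; [apply: bmfM; [exact: bmf_cst|exact: bmf_exp_v]|exact: bmf_comp_alphaw].
by apply: bmfM; [apply: bmfM; [exact: bmf_cst|exact: bmf_exp_v]|exact: bmf_comp_alphaw].
Qed.

Lemma Top_norm_supp f C a : bmf S f -> (forall b, `|b| <= theta0 -> `|f b| <= C) ->
  `|T f a| <= C.
Proof.
move=> bf fC; have bk := k_bmf sk a.
have H (c : R) h : bmf S h -> (forall b, `|b| <= theta0 -> h b <= c) -> T h a <= c.
  move=> bh hc; rewrite -(Top_cst sk c a); apply: le_IS.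
  - exact: bmfM.
  - by apply: bmfM => //; exact: bmf_cst.
  - move=> b _; have [bt|bt] := leP `|b| theta0; last by rewrite (sk_supp sk)// !mul0r.
    by rewrite ler_wpM2l ?hc// (sk_ge0 sk).
rewrite ler_norml; apply/andP; split; last first.
  by apply: H => // b /fC; rewrite ler_norml => /andP[].
rewrite lerNl -mulN1r -(TopZ sk)//; apply: H; first exact: bmfZ.
by move=> b /fC; rewrite ler_norml mulN1r => /andP[h _]; lra.
Qed.

Variable Bbar : R.
Let P b := 2 * g * (1 + 2 * t b ^+ 2) + 2 * (nu - 1) * t b ^+ 2.

(** Coefficient of [nu * w ^ 2] in the mean one-step change caused by all terms but
    the second corrector. *)
Definition drift_source a := T (fun b => 2 * g * (1 + 2 * t b ^+ 2) + 2 * (nu - 1) * t b ^+ 2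
   + 2 * (nu + g - 1) * (t b * psi b)) a - 2 * g * Dop k' psi a.

Hypothesis psiE : forall x, psi x - T psi x = 2 * T t x.
Hypothesis psi1E : forall x, psi1 x - T psi1 x = drift_source x - Bbar.

Lemma Top_alphaw : exists C : R, forall w a, narrow theta0 w ->
  `|T (fun b => psi (al w b)) a - (T psi a - 2 * g * w * Dop k' psi a)| <= C * w ^+ 2.
Proof.
have [_ [C psiC]] := upsi.
exists (2 * (6 * (tan theta0 + 1)) * (M * C * (2 + 8 * (5 + 2 * (6 * (tan theta0 + 1)))))
  + M * C * pi * (2 * g) ^+ 2) => w a nw.
have h1 := alphaw_shift th0 g01 sk a nw upsi psiC.
have h2 := k_shift sk a (2 * g * w) upsi psiC.
set y := \int[leb]_(u in S) (k a (u - 2 * g * w) * psi u) in h1 h2.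
have -> : T (fun b => psi (al w b)) a - (T psi a - 2 * g * w * Dop k' psi a) =
  (T (fun b => psi (al w b)) a - y) + (y - (T psi a - 2 * g * w * Dop k' psi a)) by ring.
apply: (le_trans (ler_normD _ _)); apply: (le_trans (lerD h1 h2)).
by rewrite [X in _ <= X]mulrDl lerD2l [(2 * g * w) ^+ 2]exprMn mulrA.
Qed.

Lemma alphaw_modulus f (e : R) : ub f -> 0 < e -> exists2 w0 : R, 0 < w0 &
  forall w b, 0 < w <= w0 -> narrow theta0 w -> `|b| <= theta0 -> `|f (al w b) - f b| <= e.
Proof.
move=> [uf _] e0; have [d d0 H] := uf e e0; exists (d / 3); first by lra.
move=> w b /andP[w0 wd] nw bt; apply: H.
by apply: (le_trans (alphaw_near th0 g01 nw bt)); lra.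
Qed.

(** The choice of [psi] cancels the first order in [w], and that of [psi1] replaces
    the second order by the constant [Bbar]. *)
Lemma drift_expansion (e : R) : 0 < e -> exists2 w0 : R, 0 < w0 & forall w a, 0 < w <= w0 ->
  `|T (fn w) a - Lyap nu w (psi a) (psi1 a) - nu * w ^+ 2 * Bbar| <= e * w ^+ 2.
Proof.
move=> e0.
have O0 f : ub f -> uO [set b : R | `|b| <= theta0] 0 (fun w b => f (al w b)).
  by move=> [_ [C fC]]; exists C; exists 1 => // w b _ _; rewrite expr0 mulr1.
have [C3 C30 [w3 /andP[w30 _] H3]] := uO_norm (lyapunov_order th0 g01 nu (O0 _ upsi) (O0 _ upsi1)).
have [C4 H4] := Top_alphaw.
pose q := `|nu| * (2 * `|nu + g - 1| + 1) + 1.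
have q0 : 0 < q.
  have : 0 <= `|nu| * (2 * `|nu + g - 1| + 1) by rewrite mulr_ge0// addr_ge0// mulr_ge0.
  by rewrite /q; lra.
have e1 : 0 < e / 2 / q by apply: divr_gt0 => //; lra.
have bt : bmf S t := ubS (ub_ttan th0).
have [_ [Ct tC]] := bt.
have utpsi : ub (fun b => t b * psi b) by apply: ubM => //; exact: ub_ttan.
have T1 b : `|t b| <= tan theta0 by exact: ttan_abs.
have T1p : 0 < tan theta0 + 1 by have := le_trans (normr_ge0 _) (T1 0); lra.
have e2 : 0 < e / 2 / q / (tan theta0 + 1) by exact: divr_gt0.
have [w5 w50 H5] := alphaw_modulus upsi e2.
have [w6 w60 H6] := alphaw_modulus upsi1 e1.
have [w7 w70 H7] := narrow_exists th0.
pose c := C3 + `|nu| * `|C4| + 1.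
have c0 : 0 < c.
  have : 0 <= `|nu| * `|C4| by exact: mulr_ge0.
  by rewrite /c; lra.
pose w0 := Num.min (Num.min w3 (Num.min w5 w6)) (Num.min w7 (e / 2 / c)).
exists w0.
  by rewrite /w0 !lt_min w30 w50 w60 w70 divr_gt0//; lra.
move=> w a; rewrite /w0 !le_min => /andP[wp /andP[/andP[h3 /andP[h5 h6]] /andP[h7 h8]]].
have nw : narrow theta0 w by apply: H7; rewrite wp.
have bpsi : bmf S psi by exact: ubS. have bpsi1 : bmf S psi1 by exact: ubS.
have ba := bmf_comp_alphaw nw upsi. have ba1 := bmf_comp_alphaw nw upsi1.
set pa := (fun b => psi (al w b)) in ba; set pa1 := (fun b => psi1 (al w b)) in ba1.
have bP : bmf S P.
  have bt2 := bmfX 2 bt.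
  apply: bmfD; last by apply: bmfM => //; exact: bmf_cst.
  apply: bmfM; first exact: bmf_cst.
  by apply: bmfD; [exact: bmf_cst|apply: bmfM => //; exact: bmf_cst].
have btpa : bmf S (fun b => t b * pa b) by exact: bmfM.
have btpsi : bmf S (fun b => t b * psi b) by exact: bmfM.
pose tg b := 1 + (nu * w * (2 * t b + pa b) + nu * w ^+ 2 *
   (P b + 2 * (nu + g - 1) * (t b * pa b) + pa1 b)).
have b1 : bmf S (fun b => 2 * t b) by exact: bmfZ.
have b2 : bmf S (fun b => 2 * t b + pa b) by exact: bmfD.
have b3 : bmf S (fun b => 2 * (nu + g - 1) * (t b * pa b)) by exact: bmfZ.
have b4 : bmf S (fun b => P b + 2 * (nu + g - 1) * (t b * pa b)) by exact: bmfD.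
have b5 : bmf S (fun b => P b + 2 * (nu + g - 1) * (t b * pa b) + pa1 b) by exact: bmfD.
have b6 := bmfZ (nu * w) b2. have b7 := bmfZ (nu * w ^+ 2) b5.
have b8 := bmfD b6 b7. have b9 : bmf S (fun=> 1 : R) by exact: bmf_cst.
have btg : bmf S tg by exact: bmfD.
have bfn := bmf_Lyap_next nw.
have E1 : `|T (fn w) a - T tg a| <= C3 * w ^+ 3.
  rewrite -(TopB sk)//; apply: Top_norm_supp; first exact: bmfB.
  move=> b bt'; have := H3 w b; rewrite wp => /(_ h3 bt'); rewrite /tg /pa /pa1 /P /Lyap_next.
  by rewrite [1 + (_ + _)]addrA.
have E2 : T tg a = 1 + (nu * w * (2 * T t a + T pa a) + nu * w ^+ 2 *
    (T P a + 2 * (nu + g - 1) * T (fun b => t b * pa b) a + T pa1 a)).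
  rewrite /tg (TopD sk a b9 b8) (Top_cst sk) (TopD sk a b6 b7) (TopZ sk _ a b2) (TopD sk a b1 ba).
  by rewrite (TopZ sk _ a bt) (TopZ sk _ a b5) (TopD sk a b4 ba1) (TopD sk a bP b3) (TopZ sk _ a btpa).
have E3 : drift_source a = T P a + 2 * (nu + g - 1) * T (fun b => t b * psi b) a - 2 * g * Dop k' psi a.
  rewrite /drift_source -(TopZ sk _ a btpsi) -(TopD sk a bP) //; exact: bmfZ.
have E4 := H4 w a nw; rewrite -/pa in E4.
have E5 : `|T (fun b => t b * pa b) a - T (fun b => t b * psi b) a| <= e / 2 / q.
  rewrite -(TopB sk)//; apply: Top_norm_supp; first exact: bmfB.
  move=> b bt'; rewrite -mulrBr normrM.
  have h := H5 w b; rewrite wp in h; have {h} := h h5 nw bt'.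
  rewrite ler_pdivlMr// => h; apply: le_trans h; rewrite mulrC ler_wpM2l//.
  by apply: (le_trans (T1 b)); rewrite lerDl.
have E6 : `|T pa1 a - T psi1 a| <= e / 2 / q.
  rewrite -(TopB sk)//; apply: Top_norm_supp; first exact: bmfB.
  by move=> b bt'; have h := H6 w b; rewrite wp in h; exact: h.
have := psiE a; have := psi1E a; rewrite E3 => F1 F2.
pose x4 := T pa a - (T psi a - 2 * g * w * Dop k' psi a).
pose x5 := T (fun b => t b * pa b) a - T (fun b => t b * psi b) a.
pose x6 := T pa1 a - T psi1 a.
have -> : T (fn w) a - Lyap nu w (psi a) (psi1 a) - nu * w ^+ 2 * Bbar =
   (T (fn w) a - T tg a) + nu * w * x4 + nu * w ^+ 2 * (2 * (nu + g - 1) * x5 + x6).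
  have G1 : psi a = T psi a + 2 * T t a by rewrite -F2 addrC subrK.
  have G2 : psi1 a = T psi1 a + (T P a + 2 * (nu + g - 1) * T (fun b => t b * psi b) a
     - 2 * g * Dop k' psi a - Bbar).
    by rewrite -F1 addrC subrK.
  rewrite /Lyap G1 G2 E2 /x4 /x5 /x6; ring.
have w2 : 0 < w ^+ 2 by exact: exprn_gt0.
have K1 : `|nu * w * x4| <= `|nu| * `|C4| * w ^+ 3.
  rewrite !normrM (gtr0_norm wp) [w ^+ 3]exprS.
  have -> : `|nu| * `|C4| * (w * w ^+ 2) = `|nu| * w * (`|C4| * w ^+ 2) by ring.
  rewrite ler_wpM2l//; first by rewrite mulr_ge0// ltW.
  by apply: (le_trans E4); rewrite ler_wpM2r ?ler_norm// ltW.
have K2 : `|nu * w ^+ 2 * (2 * (nu + g - 1) * x5 + x6)| <= e / 2 * w ^+ 2.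
  rewrite (normrM (nu * w ^+ 2)) (normrM nu) (gtr0_norm w2).
  have -> : e / 2 * w ^+ 2 = (e / 2 / q * q) * w ^+ 2 by rewrite divfK// gt_eqF.
  rewrite mulrAC ler_pM2r//.
  have h : `|2 * (nu + g - 1) * x5 + x6| <= (2 * `|nu + g - 1| + 1) * (e / 2 / q).
    apply: (le_trans (ler_normD _ _)); rewrite [X in _ <= X]mulrDl [X in _ <= _ + X]mul1r; apply: lerD => //.
    rewrite (normrM (2 * (nu + g - 1))) (normrM 2) (@ger0_norm _ 2)//.
    by apply: ler_wpM2l => //; rewrite mulr_ge0.
  apply: (le_trans (ler_wpM2l (normr_ge0 nu) h)).
  by rewrite mulrA mulrC ler_pM2l// /q lerDl.
have K3 : (C3 + `|nu| * `|C4|) * w ^+ 3 <= e / 2 * w ^+ 2.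
  have -> : (C3 + `|nu| * `|C4|) * w ^+ 3 = ((C3 + `|nu| * `|C4|) * w) * w ^+ 2 by ring.
  rewrite ler_pM2r//; move: h8; rewrite ler_pdivlMr//; apply: le_trans.
  by rewrite mulrC ler_pM2l// /c lerDl.
have -> : e * w ^+ 2 = e / 2 * w ^+ 2 + e / 2 * w ^+ 2 by field.
apply: (le_trans (ler_normD _ _)); apply: lerD => //.
apply: (le_trans (ler_normD _ _)); apply: le_trans K3; rewrite [X in _ <= X]mulrDl; exact: lerD.
Qed.

End Drift.

(** * Geometry of one collision *)

Section PowerCurve.
Context {R : realType} (g : R).
Hypothesis g01 : 0 < g < 1.
Implicit Types x m r : R.

(** In the variable [u = ln r] the difference of the two sides vanishes at 0, and its
    derivative [g * (expR u - expR (g * u))] has the sign of [u]. *)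
Lemma bernoulli_lt r : 0 <= r -> r != 1 -> r `^ g < g * r + 1 - g.
Proof.
have /andP[g0 g1] := g01; rewrite le_eqVlt => /predU1P[<- _|r0 r1].
  by rewrite powR0 ?gt_eqF//; lra.
pose f u := g * expR u + 1 - g - expR (g * u).
have D (u : R) : is_derive u (1 : R) f (g * (expR u - expR (g * u))).
  by apply: is_derive_eq; rewrite /GRing.scale/=; ring.
have cf := continuous_subspaceT (derive_continuous D).
have f0 : f 0 = 0 by rewrite /f mulr0 expR0; ring.
have -> : r `^ g = expR (g * ln r) by rewrite /powR gt_eqF.
have rE : expR (ln r) = r by rewrite lnK// posrE.
suff : 0 < f (ln r) by rewrite /f rE; lra.
have n0 : ln r != 0 by apply: contra_neq r1 => l0; rewrite -rE l0 expR0.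
have [lp|lp|/eqP] := ltgtP 0 (ln r); last by rewrite eq_sym (negbTE n0).
  have [c] := MVT lp (fun u _ => D u) (cf _).
  rewrite in_itv/= f0 !subr0 => /andP[c0 cl] ->; rewrite mulr_gt0// mulr_gt0// subr_gt0 ltr_expR.
  by nra.
have [c] := MVT lp (fun u _ => D u) (cf _).
rewrite in_itv/= f0 !sub0r => /andP[c0 cl] E;
have : expR c < expR (g * c) by rewrite ltr_expR; nra.
move=> ec; have : 0 < g * (expR (g * c) - expR c) * (- ln r).
  by rewrite mulr_gt0 ?oppr_gt0// mulr_gt0// subr_gt0.
by lra.
Qed.

Lemma bernoulli_le r : 0 <= r -> r `^ g <= g * r + 1 - g.
Proof.
move=> r0; have [->|r1] := eqVneq r 1; first by rewrite powR1; lra.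
by apply/ltW/bernoulli_lt.
Qed.

Lemma powR_split x : 0 < x -> x `^ g = x * x `^ (g - 1).
Proof. by move=> x0; rewrite mulr_powRB1 ?ltW//; case/andP: g01. Qed.

Lemma powR_scale x m : 0 <= x -> 0 < m -> x `^ g = (x / m) `^ g * m `^ g.
Proof.
move=> x0 m0; rewrite -powRM ?divfK ?gt_eqF//; last exact: ltW.
by apply: divr_ge0 => //; exact: ltW.
Qed.

Lemma tangent_le x m : 0 <= x -> 0 < m -> x `^ g <= m `^ g + g * m `^ (g - 1) * (x - m).
Proof.
move=> x0 m0; rewrite (powR_scale x0 m0).
have xm : 0 <= x / m by apply: divr_ge0 => //; exact: ltW.
have := ler_wpM2r (powR_ge0 m g) (bernoulli_le xm) => /le_trans; apply.
rewrite (powR_split m0) le_eqVlt; apply/orP; left; apply/eqP; field; rewrite gt_eqF//.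
Qed.

Lemma tangent_lt x m : 0 <= x -> 0 < m -> x != m ->
  x `^ g < m `^ g + g * m `^ (g - 1) * (x - m).
Proof.
move=> x0 m0 xm; rewrite (powR_scale x0 m0).
have xm0 : 0 <= x / m by apply: divr_ge0 => //; exact: ltW.
have xm1 : x / m != 1 by apply: contra_neq xm => h; rewrite -[x](divfK (lt0r_neq0 m0)) h mul1r.
have mg : 0 < m `^ g by exact: powR_gt0.
have := bernoulli_lt xm0 xm1; rewrite -(ltr_pM2r mg) => /lt_le_trans; apply.
rewrite (powR_split m0) le_eqVlt; apply/orP; left; apply/eqP; field; rewrite gt_eqF//.
Qed.

Lemma powR_concave x y l : 0 <= x -> 0 <= y -> x != y -> 0 < l < 1 ->
  (1 - l) * x `^ g + l * y `^ g < ((1 - l) * x + l * y) `^ g.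
Proof.
move=> x0 y0 xy /andP[l0 l1]; set m := (1 - l) * x + l * y.
have m0 : 0 < m.
  rewrite /m; have [xp|] := ltP 0 x; first by nra.
  move=> xn; have xE : x = 0 by lra.
  have yp : 0 < y by rewrite lt_neqAle y0 andbT -xE.
  by nra.
have xm : x != m.
  apply: contra xy => /eqP E; apply/eqP; have : l * (x - y) = 0 by rewrite /m in E; lra.
  by move/eqP; rewrite mulf_eq0 gt_eqF//= subr_eq0 => /eqP.
have := tangent_lt x0 m0 xm; have := tangent_le y0 m0.
set a := x `^ g; set b := y `^ g; set c := m `^ g; set d := g * _ => h1 h2.
have h3 : l * b <= l * (c + d * (y - m)) by rewrite ler_pM2l.
have h4 : (1 - l) * a < (1 - l) * (c + d * (x - m)) by rewrite ltr_pM2l//; lra.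
apply: (lt_le_trans (ltr_leD h4 h3)); rewrite le_eqVlt; apply/orP; left; apply/eqP.
have -> : (1 - l) * (c + d * (x - m)) + l * (c + d * (y - m)) =
  c + d * ((1 - l) * x + l * y - m) by ring.
by rewrite -/m subrr mulr0 addr0.
Qed.

End PowerCurve.

Section Chords.
Context {R : realType} (g : R).
Hypothesis g01 : 0 < g < 1.
Local Notation bd := (boundary g).

Lemma is_sign_norm (j : R) : is_sign j -> `|j| = 1.
Proof. by case=> ->; rewrite ?normrN normr1. Qed.

Lemma is_sign_sq (j : R) : is_sign j -> j * j = 1.
Proof. by case=> ->; rewrite ?mulrNN mulr1. Qed.

Lemma boundaryP (p : R * R) : bd p <-> 0 <= p.1 /\ `|p.2| = p.1 `^ g.
Proof.
split=> [[z [j [z0 sj ->]]]/=|[x0 xy]].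
  by rewrite normrM is_sign_norm// mul1r ger0_norm// powR_ge0.
exists p.1, (if 0 <= p.2 then 1 else -1); split => //; first by case: ifP; [right|left].
rewrite -xy [LHS]surjective_pairing; congr pair; case: ifPn => h; first by rewrite ger0_norm// mul1r.
by rewrite ltr0_norm ?ltNge// mulN1r opprK.
Qed.

(** If [s < t] were two such times, the point at time [s] would be a strict convex
    combination of the starting point and of the point at time [t], hence interior by
    strict concavity of the power function. On a vertical line the heights decide. *)
Lemma hit_unique z j b (s t : R) : 0 <= z -> is_sign j -> 0 < s -> 0 < t ->
  bd (ray g z j b s) -> bd (ray g z j b t) -> s = t.
Proof.
move=> z0 sj; wlog st : s t / s <= t => [H s0 t0 bs bt|].
  by have [st|/ltW ts] := leP s t; [exact: H|apply/esym; exact: H].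
move=> s0 t0 /boundaryP/= [x1 y1] /boundaryP/= [x2 y2].
apply/eqP; rewrite eq_le st/= leNgt; apply/negP => {}st.
set S := sin _ in x1 y1 x2 y2; set C := cos _ in y1 y2.
have SC : C ^+ 2 + S ^+ 2 = 1 by rewrite /C /S cos2Dsin2.
pose l := s / t; have l01 : 0 < l < 1.
  by rewrite /l divr_gt0//= ltr_pdivrMr// mul1r.
have lt' : l * t = s by rewrite /l divfK// gt_eqF.
have [Sz|Sz] := eqVneq S 0.
  have C0 : C != 0.
    by apply/eqP => C0; move: SC; rewrite Sz C0 expr0n/= addr0 => /eqP; rewrite eq_sym oner_eq0.
  have zg := powR_ge0 z g.
  move: y1 y2; rewrite Sz !mulr0 !addr0.
  have E x : j * z `^ g + x * (- j * C) = j * (z `^ g - x * C) by ring.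
  rewrite !E !normrM (is_sign_norm sj) !mul1r => e1 e2.
  have D x : 0 < x -> `|z `^ g - x * C| = z `^ g -> x * C = 2 * z `^ g.
    move=> x0; case: (ger0P (z `^ g - x * C)) => _ e; last by lra.
    have : x * C = 0 by lra.
    by move/eqP; rewrite mulf_eq0 (gt_eqF x0) (negbTE C0).
  have := D s s0 e1; rewrite -(D t t0 e2) => /eqP; rewrite -subr_eq0 -mulrBl mulf_eq0 (negbTE C0) orbF.
  by rewrite subr_eq0 lt_eqF.
have xz : z != z + t * S.
  by rewrite -subr_eq0 opprD addrA subrr sub0r oppr_eq0 mulf_eq0 gt_eqF.
have := powR_concave g01 z0 x2 xz l01.
have -> : (1 - l) * z + l * (z + t * S) = z + s * S by rewrite -lt'; ring.
rewrite -y1 -y2.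
have -> : j * z `^ g + s * (- j * C) =
  (1 - l) * (j * z `^ g) + l * (j * z `^ g + t * (- j * C)) by rewrite -lt'; ring.
have /andP[l0 l1] := l01.
have h := ler_normD ((1 - l) * (j * z `^ g)) (l * (j * z `^ g + t * (- j * C))).
move=> /(fun h' => lt_le_trans h' h).
rewrite (normrM (1 - l)) (normrM l) (normrM j) (is_sign_norm sj) mul1r.
rewrite (@ger0_norm _ (z `^ g)) ?powR_ge0//.
by rewrite (@gtr0_norm _ l)// (@gtr0_norm _ (1 - l)) ?ltxx// subr_gt0.
Qed.

Lemma hit_pointE z j b t : 0 <= z -> is_sign j -> 0 < t -> bd (ray g z j b t) ->
  hit_point g z j b = ray g z j b t.
Proof.
move=> z0 sj t0 bt.
have E : hit_time g z j b = t%:E.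
  rewrite /hit_time (_ : [set _ | _ in _] = [set t%:E]) ?ereal_inf1//.
  apply/seteqP; split=> [_ [s [s0 bs] <-]|_ ->].
    by congr EFin; exact: (hit_unique z0 sj s0 t0 bs bt).
  by exists t.
by rewrite /hit_point E ltry.
Qed.

Lemma hit_cases z j b : 0 <= z -> is_sign j ->
  (exists t, [/\ 0 < t, bd (ray g z j b t) & hit_point g z j b = ray g z j b t]) \/
  hit_point g z j b = (0, 0).
Proof.
move=> z0 sj; have [[t [t0 bt]]|nt] := pselect (exists t, 0 < t /\ bd (ray g z j b t)).
  by left; exists t; split => //; exact: hit_pointE.
right; rewrite /hit_point /hit_time (_ : [set _ | _ in _] = set0) ?ereal_inf0//.
by apply/seteqP; split=> // x [t tb _]; apply: nt; exists t.
Qed.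

Lemma hit_boundary z j b : 0 <= z -> is_sign j -> bd (hit_point g z j b).
Proof.
move=> z0 sj; have [[t [_ bt ->]]//|->] := hit_cases b z0 sj.
by apply/boundaryP => /=; rewrite normr0 powR0// gt_eqF//; case/andP: g01.
Qed.

End Chords.

Section ValidStep.
Context {R : realType} (g theta0 : R).
Hypotheses (g01 : 0 < g < 1) (th0 : 0 < theta0 < pi / 2).
Notation S := (@Sang R).
Local Notation bd := (boundary g).

Lemma cos_ge0_angle (x : R) : `|x| < 3 * (pi / 2) -> 0 <= cos x -> `|x| <= pi / 2.
Proof.
move=> xp cx; rewrite leNgt; apply/negP => px.
have : 0 < sin (`|x| - pi / 2) by apply: sin_gt0_pi; apply/andP; split; lra.
have -> : sin (`|x| - pi / 2) = - cos `|x|.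
  by rewrite sinB cos_pihalf sin_pihalf mulr0 mulr1 sub0r.
have -> : cos `|x| = cos x by case: (ger0P x) => // _; rewrite cosN.
by lra.
Qed.

Lemma theta_bounds z : 0 < z -> 0 < theta g z < pi / 2.
Proof.
move=> z0; rewrite /theta gt_eqF// atan_ltpi2 andbT -(@atan0 R); apply: lt_atan.
by rewrite mulr_gt0 ?powR_gt0//; case/andP: g01.
Qed.

Lemma cos_theta z : 0 < z -> 0 < cos (theta g z).
Proof.
move=> /theta_bounds /andP[h1 h2]; apply: cos_gt0_pihalf; apply/andP; split; lra.
Qed.

Lemma sin_theta z : 0 < z -> sin (theta g z) = g * z `^ (g - 1) * cos (theta g z).
Proof.
move=> z0; have c0 := cos_theta z0.
have : tan (theta g z) = g * z `^ (g - 1) by rewrite /theta gt_eqF// atanK.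
by rewrite /tan => <-; rewrite divfK// gt_eqF.
Qed.

(** The states that the dynamics preserves as soon as the ray leaves inside the cone:
    at the apex the angle is never read again, and is left unconstrained. *)
Definition valid (s : R * R * R) : Prop :=
  [/\ 0 <= s.1.1, is_sign s.1.2, s.1.1 = 0 -> s.1.2 = 1 & 0 < s.1.1 -> S s.2].

Lemma valid_state s : state_space s -> valid s.
Proof. by move=> [h1 h2 h3 h4]; split. Qed.

Lemma sgn_sign (x : R) : is_sign (sgn x).
Proof. by rewrite /sgn; case: ifP; [right|left]. Qed.

Lemma cos_sign_pi (s y : R) : is_sign s -> cos (s * pi - y) = - cos y.
Proof.
by case=> ->; [rewrite mulN1r cosB cosN sinN cospi sinpi|rewrite mul1r cosB cospi sinpi]; ring.
Qed.

(** The incoming angle is acute because its cosine has the sign of a height above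
    the tangent line of the boundary at the point that is hit. *)
Lemma in_angle_S z j b : 0 <= z -> is_sign j -> (z = 0 -> j = 1) -> `|b| <= theta0 ->
  (z = 0 -> b != 0) -> 0 < (hit_point g z j b).1 -> S (in_angle g z j b).
Proof.
move=> z0 sj zj bt zb; have /andP[g0 g1] := g01; have /andP[t0 t1] := th0.
have [[t [tp bp hE]]|->/=] := hit_cases g01 b z0 sj; last by rewrite ltxx.
rewrite /in_angle hE => x0; apply/SangP.
have b2 : `|b| < pi / 2 by lra.
move/boundaryP: bp => -[_]; set L := ray _ _ _ _ _ in x0 *; set x := L.1 in x0 * => yx.
have xg : x `^ g = x * x `^ (g - 1) by exact: powR_split.
have cx := cos_theta x0; have sx := sin_theta x0; have /andP[tx1 tx2] := theta_bounds x0.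
set th := theta g x in cx sx tx1 tx2 *.
have xg0 : 0 < x `^ g by exact: powR_gt0.
have [ze|zn] := eqVneq z 0.
  have jE := zj ze; have bn := zb ze.
  have L1 : x = t * cos b.
    by rewrite /x /L /ray/= ze /theta eqxx add0r sinD cos_pihalf sin_pihalf mul0r addr0 mul1r.
  have L2 : L.2 = t * sin b.
    rewrite /L /ray/= ze jE /theta eqxx powR0 ?gt_eqF// mulr0 add0r cosD cos_pihalf sin_pihalf.
    by rewrite mul0r mul1r; ring.
  apply: cos_ge0_angle; first by have := normr_ge0 b; rewrite ltr_norml => ?; apply/andP; split; lra.
  have -> : pi / 2 - `|b| + th = pi / 2 - (`|b| - th) by ring.
  rewrite cosB cos_pihalf sin_pihalf mul0r mul1r add0r sinB sx.
  have cb : cos `|b| = cos b by case: (ger0P b) => // _; rewrite cosN.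
  have sb : t * sin `|b| = x `^ g.
    rewrite -yx L2 normrM (gtr0_norm tp); congr (_ * _).
    have sb0 : 0 <= sin `|b| by apply: sin_ge0_pi; apply/andP; split => //; lra.
    by move: sb0; case: (ger0P b) => _ h; [rewrite ger0_norm|rewrite sinN in h *; rewrite ler0_norm//; lra].
  rewrite -(pmulr_rge0 _ tp) cb.
  have -> : t * (sin `|b| * cos th - cos b * (g * x `^ (g - 1) * cos th)) =
    cos th * (t * sin `|b| - g * x `^ (g - 1) * (t * cos b)) by ring.
  rewrite sb -L1 pmulr_rge0// xg; have : 0 < x * x `^ (g - 1) by rewrite -xg.
  by nra.
have zp : 0 < z by rewrite lt_neqAle eq_sym zn.
have /andP[tz1 tz2] := theta_bounds zp.
set ph := theta g z + b.
have L1 : x - z = t * sin ph by rewrite /x /L /ray/=; ring.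
have jL2 : j * L.2 = z `^ g - t * cos ph.
  by rewrite /L /ray/= mulrDr mulrA is_sign_sq// mul1r mulrCA mulNr mulrN mulrA is_sign_sq//;
     rewrite mul1r mulrN.
have jyx : `|j * L.2| = x `^ g by rewrite normrM is_sign_norm// mul1r.
move: bt; rewrite ler_norml => /andP[b3 b4].
have xp : 0 < x `^ (g - 1) by exact: powR_gt0.
have [jn|jn] := ltP (j * L.2) 0.
  rewrite (_ : b + theta g z + th = ph + th); last by rewrite /ph; ring.
  apply: cos_ge0_angle; first by rewrite /ph ltr_norml; apply/andP; split; lra.
  have tc : t * cos ph = z `^ g + x `^ g by move: jyx; rewrite ltr0_norm//; lra.
  rewrite -(pmulr_rge0 _ tp) cosD sx.
  have -> : t * (cos ph * cos th - sin ph * (g * x `^ (g - 1) * cos th)) =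
    cos th * (t * cos ph - g * x `^ (g - 1) * (t * sin ph)) by ring.
  rewrite tc -L1 pmulr_rge0// xg; have := powR_ge0 z g => zg.
  have : 0 <= x `^ (g - 1) * (g * z) by rewrite mulr_ge0 ?mulr_ge0// ltW.
  have : 0 <= x * x `^ (g - 1) * (1 - g) by rewrite mulr_ge0 ?mulr_ge0 ?subr_ge0// ltW.
  by lra.
have tc : t * cos ph = z `^ g - x `^ g by move: jyx; rewrite ger0_norm//; lra.
rewrite (_ : sgn b * pi - b - theta g z + th = sgn b * pi - (ph - th)); last by rewrite /ph; ring.
apply: cos_ge0_angle.
  rewrite /sgn /ph; have [b0|b0] := leP 0 b; rewrite ?mul1r ?mulN1r ltr_norml; apply/andP; split; lra.
rewrite (cos_sign_pi _ (sgn_sign b)).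
rewrite -(pmulr_rge0 _ tp) cosB sx.
have -> : t * - (cos ph * cos th + sin ph * (g * x `^ (g - 1) * cos th)) =
  cos th * (- (t * cos ph) - g * x `^ (g - 1) * (t * sin ph)) by ring.
rewrite tc -L1 pmulr_rge0//; have := tangent_le g01 z0 x0.
by lra.
Qed.

Lemma valid_step s b : valid s -> `|b| <= theta0 -> (s.1.1 = 0 -> b != 0) ->
  valid (step g s b).
Proof.
move=> [z0 sj zj Sa] bt zb; have /boundaryP[x0 yx] := hit_boundary g01 b z0 sj.
split => //=; first exact: sgn_sign.
  move=> xE; move: yx; rewrite xE powR0; last by have /andP[/gt_eqF-> _] := g01.
  by move/normr0_eq0 => ->; rewrite /sgn lexx.
by move=> xp; exact: in_angle_S.
Qed.


End ValidStep.

Section Growth.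
Context {R : realType} (g theta0 eps : R).
Hypotheses (g01 : 0 < g < 1) (th0 : 0 < theta0 < pi / 2) (eps0 : 0 < eps <= theta0).
Local Notation bd := (boundary g).

(** The inverse of the width [z `^ (g - 1)] as a function of [z]. *)
Definition iroot (A : R) : R := A `^ (g - 1)^-1.

Lemma irootK A : 0 < A -> (iroot A) `^ (g - 1) = A.
Proof.
have /andP[g0 g1] := g01; move=> A0.
rewrite /iroot -powRrM mulVf; last by rewrite subr_eq0 lt_eqF.
by rewrite powRr1// ltW.
Qed.

Lemma iroot_gt0 A : 0 < A -> 0 < iroot A.
Proof. exact: powR_gt0. Qed.

Lemma powR_g1_le x y : 0 < x -> 0 < y -> (x `^ (g - 1) <= y `^ (g - 1)) = (y <= x).
Proof.
have /andP[g0 g1] := g01; have h : 0 < 1 - g by rewrite subr_gt0.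
move=> x0 y0; rewrite -(opprB 1 g) !powRN lef_pV2 ?posrE ?powR_gt0//.
apply/idP/idP.
  by apply: contraTT; rewrite -!ltNge => xy; apply: (gt0_ltr_powR h); rewrite ?nnegrE ?ltW.
by move=> yx; apply: (ge0_ler_powR (ltW h)) => //; rewrite nnegrE ltW.
Qed.

Lemma iroot_le x A : 0 < x -> 0 < A -> x `^ (g - 1) <= A -> iroot A <= x.
Proof. by move=> x0 A0; rewrite -{1}(irootK A0) powR_g1_le// iroot_gt0. Qed.

Lemma is_derive_cont (f : R -> R) (x df : R) : is_derive x (1 : R) f df ->
  continuous_at x f.
Proof.
by move=> D; apply: differentiable_continuous; apply/derivable1_diffP; exact: (@ex_derive _ _ _ _ _ _ _ D).
Qed.

(** A line of positive slope that starts below the curve crosses it, the curve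
    being sublinear. *)
Lemma powR_line_hit (h c z s t0 : R) : 0 < z -> 0 < s -> 0 < c -> 0 <= t0 ->
  h + t0 * c <= (z + t0 * s) `^ g -> exists2 t, t0 <= t & (z + t * s) `^ g = h + t * c.
Proof.
have /andP[g0 g1] := g01; move=> z0 s0 c0 t00 H0.
pose A := c / (2 * g * s).
have A0 : 0 < A by rewrite divr_gt0// !mulr_gt0.
pose m := iroot A; have m0 : 0 < m := iroot_gt0 A0; have mA : m `^ (g - 1) = A := irootK A0.
have mg := powR_ge0 m g.
pose T := Num.max t0 (2 * (`|h| + m `^ g + g * A * z) / c).
have tT : t0 <= T by rewrite /T le_max lexx.
have T2 : 2 * (`|h| + m `^ g + g * A * z) <= T * c.
  by rewrite -ler_pdivrMr// /T le_max lexx orbT.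
pose F t := h + t * c - (z + t * s) `^ g.
have cF : {within `[t0, T], continuous F}.
  apply: continuous_in_subspaceT => t /set_mem; rewrite /= in_itv/= => /andP[t1 _].
  have zt : 0 < z + t * s by have := mulr_ge0 (le_trans t00 t1) (ltW s0); lra.
  have D1 : is_derive (t : R) (1 : R) (fun u : R => h + u * c) c.
    by apply: is_derive_eq; rewrite /GRing.scale/=; ring.
  have D2 : is_derive (t : R) (1 : R) (fun u : R => z + u * s) s.
    by apply: is_derive_eq; rewrite /GRing.scale/=; ring.
  apply: (continuousB (is_derive_cont D1)).
  apply: (@continuous_comp _ _ _ (fun u : R => z + u * s) (fun x : R => x `^ g)).
    exact: is_derive_cont D2.
  exact: (is_derive_cont (is_derive1_powR g zt)).
have F0 : F t0 <= 0 by rewrite /F subr_le0.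
have FT : 0 <= F T.
  have zT : 0 <= z + T * s by have := mulr_ge0 (le_trans t00 tT) (ltW s0); lra.
  have := tangent_le g01 zT m0; rewrite mA => h1.
  have gAs : g * A * s = c / 2 by rewrite /A; field; rewrite !gt_eqF.
  have h2 : g * A * (z + T * s - m) = g * A * z + T * (c / 2) - g * A * m by rewrite -gAs; ring.
  have h3 : 0 <= g * A * m := ltW (mulr_gt0 (mulr_gt0 g0 A0) m0).
  rewrite h2 in h1; have := ler_norm (- h); rewrite normrN /F; lra.
have [|t tI Ft] := IVT (v := 0) tT cF.
  by rewrite ge_min le_max F0 FT orbT.
exists t; first by move: tI; rewrite in_itv/= => /andP[].
by apply/esym/eqP; rewrite -subr_eq0; apply/eqP.
Qed.

Lemma tan_gt0 (x : R) : 0 < x < pi / 2 -> 0 < tan x.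
Proof.
move=> /andP[x0 x1]; rewrite -(@tan0 R) ltr_tan// in_itv/=; apply/andP; split; lra.
Qed.

Lemma tan_le (x y : R) : 0 < x -> x <= y -> y < pi / 2 -> tan x <= tan y.
Proof.
rewrite [x <= y]le_eqVlt => x0 /predU1P[->//|xy] yp; apply/ltW.
by rewrite ltr_tan// in_itv/=; apply/andP; split; lra.
Qed.

Lemma ray_bd z j b t x (i : R) : is_sign j -> is_sign i -> 0 <= x -> x = z + t * sin (theta g z + b) ->
  z `^ g - t * cos (theta g z + b) = i * x `^ g -> bd (ray g z j b t).
Proof.
move=> sj si x0 xE yE; apply/boundaryP; rewrite /ray/= -xE; split => //.
have -> : j * z `^ g + t * (- j * cos (theta g z + b)) = j * (z `^ g - t * cos (theta g z + b)) by ring.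
by rewrite yE !normrM (is_sign_norm sj) (is_sign_norm si) !mul1r ger0_norm// powR_ge0.
Qed.

Lemma growth_zero : exists2 d : R, 0 < d & forall b, `|b| <= theta0 -> b != 0 ->
  d <= (hit_point g 0 1 b).1.
Proof.
have /andP[t0 t1] := th0; have T0 := tan_gt0 th0.
exists (iroot (tan theta0)) => [|b bt b0]; first exact: iroot_gt0.
have bp : 0 < `|b| by rewrite normr_gt0.
have tb : 0 < tan `|b| by apply: tan_gt0; rewrite bp; lra.
have cb : 0 < cos `|b| by apply: cos_gt0_pihalf; apply/andP; split; lra.
pose x := iroot (tan `|b|); have x0 : 0 < x := iroot_gt0 tb.
have cE : cos `|b| = cos b by case: (ger0P b) => // _; rewrite cosN.
have tp : 0 < x / cos b by rewrite -cE divr_gt0.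
have s1 : @is_sign R 1 by right.
have xE : x = 0 + x / cos b * sin (theta g 0 + b).
  rewrite /theta eqxx sinD cos_pihalf sin_pihalf mul0r addr0 mul1r add0r divfK// -cE gt_eqF//.
have xg : x `^ g = x * tan `|b| by rewrite (powR_split g01 x0) (irootK tb).
have yE : 0 `^ g - x / cos b * cos (theta g 0 + b) = (sgn b) * x `^ g.
  rewrite /theta eqxx powR0; last by have /andP[/gt_eqF-> _] := g01.
  rewrite cosD cos_pihalf sin_pihalf mul0r mul1r !sub0r mulrN opprK xg /tan cE.
  have -> : sgn b * (x * (sin `|b| / cos b)) = x / cos b * (sgn b * sin `|b|) by ring.
  congr (_ * _); rewrite /sgn; case: (ger0P b) => _; rewrite ?mul1r// sinN; ring.
have bdx := ray_bd s1 (sgn_sign b) (ltW x0) xE yE.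
rewrite (hit_pointE g01 (lexx 0) s1 tp bdx)/= -xE.
apply: (iroot_le x0 T0); rewrite (irootK tb).
exact: tan_le.
Qed.

Lemma growth_opposite : exists2 d : R, 0 < d & forall z j b, 0 < z -> is_sign j ->
  eps <= b <= theta0 -> theta g z + b < pi / 2 -> z + d <= (hit_point g z j b).1.
Proof.
have /andP[e0 e1] := eps0; have /andP[t0 t1] := th0; have /andP[g0 g1] := g01.
have te : 0 < tan eps by apply: tan_gt0; rewrite e0; lra.
have c10 : 0 < iroot (tan eps)^-1 by rewrite iroot_gt0// invr_gt0.
exists (tan eps * iroot (tan eps)^-1 `^ g) => [|z j b z0 sj /andP[b1 b2] phl].
  by rewrite mulr_gt0// powR_gt0.
have /andP[tz0 tz1] := theta_bounds g01 z0.
set ph := theta g z + b in phl *.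
have php : 0 < ph by rewrite /ph; lra.
have C0 : 0 < cos ph by apply: cos_gt0_pihalf; apply/andP; split; lra.
have S0 : 0 < sin ph by apply: sin_gt0_pi; apply/andP; split; lra.
have zg : 0 < z `^ g by exact: powR_gt0.
have [|t tt tE] := @powR_line_hit (- z `^ g) (cos ph) z (sin ph) 0 z0 S0 C0 (lexx _).
  by rewrite !mul0r !addr0; lra.
set x := z + t * sin ph in tE.
have tp : 0 < t.
  rewrite lt_neqAle tt andbT; apply/eqP => t00; move: tE; rewrite /x -t00 !mul0r !addr0; lra.
have x0 : 0 < x by rewrite /x addr_gt0// mulr_gt0.
have sm : @is_sign R (-1) by left.
have yE : z `^ g - t * cos ph = -1 * x `^ g by rewrite tE; ring.
have bdx := ray_bd sj sm (ltW x0) erefl yE.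
rewrite (hit_pointE g01 (ltW z0) sj tp bdx)/= -/ph -/x.
have xg : 0 < x `^ g by exact: powR_gt0.
have tph : tan eps <= tan ph. by apply: tan_le => //; rewrite /ph; lra.
have xz : x - z = tan ph * (x `^ g + z `^ g).
  rewrite tE /x /tan; field; rewrite gt_eqF//.
have h1 : tan eps * x `^ g <= x - z.
  rewrite xz; apply: ler_pM => //; [exact: ltW|exact: ltW|lra].
have h2 : iroot (tan eps)^-1 <= x.
  apply: iroot_le => //; first by rewrite invr_gt0.
  have : tan eps * x `^ g <= x by lra.
  rewrite (powR_split g01 x0) mulrCA -[X in _ <= X]mulr1 ler_pM2l//.
  by rewrite -[(tan eps)^-1]mulr1 ler_pdivlMl.
have h3 : iroot (tan eps)^-1 `^ g <= x `^ g.
  by apply: (ge0_ler_powR (ltW g0)); rewrite ?nnegrE// ltW.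
have : tan eps * iroot (tan eps)^-1 `^ g <= tan eps * x `^ g by rewrite ler_pM2l.
by lra.
Qed.

Lemma growth_same : exists2 d : R, 0 < d & forall z j b, 0 < z -> is_sign j ->
  eps <= b <= theta0 -> pi / 2 < theta g z + b -> z + d <= (hit_point g z j b).1.
Proof.
have /andP[e0 e1] := eps0; have /andP[t0 t1] := th0; have /andP[g0 g1] := g01.
have T0 := tan_gt0 th0.
pose c2 := iroot (tan theta0 / g).
have c20 : 0 < c2 by rewrite iroot_gt0// divr_gt0.
pose d2 := c2 / 2 * (pi / 2 - theta0) / tan theta0.
have d20 : 0 < d2 by rewrite !mulr_gt0 ?invr_gt0//; lra.
exists (Num.min (c2 / 2) d2) => [|z j b z0 sj /andP[b1 b2] phl].
  by rewrite lt_min d20 andbT; lra.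
have /andP[tz0 tz1] := theta_bounds g01 z0.
set ph := theta g z + b in phl *.
have php : ph < pi by rewrite /ph; lra.
have C0 : 0 < - cos ph.
  have <- : sin (ph - pi / 2) = - cos ph by exact: sinBpihalf.
  by apply: sin_gt0_pi; apply/andP; split; lra.
have S0 : 0 < sin ph by apply: sin_gt0_pi; apply/andP; split; lra.
have zg : 0 < z `^ g by exact: powR_gt0.
pose sg := - cos ph / sin ph; have sg0 : 0 < sg by exact: divr_gt0.
have sgE : atan sg = ph - pi / 2.
  have -> : sg = tan (ph - pi / 2) by rewrite /tan sinBpihalf cosBpihalf.
  by apply: tanK; rewrite in_itv/=; apply/andP; split; lra.
have thz : theta g z = atan (g * z `^ (g - 1)) by rewrite /theta gt_eqF.
have h1 : pi / 2 - theta0 <= g * z `^ (g - 1) - sg.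
  have lt' : sg < g * z `^ (g - 1).
    rewrite ltNge; apply/negP => /le_atan; rewrite sgE -thz /ph; lra.
  have := atan_lip1 (g * z `^ (g - 1)) sg.
  rewrite -thz sgE (@gtr0_norm _ (g * _ - sg)) ?subr_gt0// => /(le_trans (ler_norm _)).
  by rewrite /ph; lra.
have h2 : sg <= tan theta0.
  rewrite leNgt; apply/negP => /lt_atan; rewrite sgE tanK; first by rewrite /ph; lra.
  by rewrite in_itv/=; apply/andP; split; lra.
have sgg : 0 < sg / g by exact: divr_gt0.
pose x0 := iroot (sg / g); have x00 : 0 < x0 := iroot_gt0 sgg.
have gx0 : g * x0 `^ (g - 1) = sg by rewrite (irootK sgg) mulrC divfK// gt_eqF.
have zx : z < x0.
  rewrite ltNge -(powR_g1_le z0 x00); apply/negP => h.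
  have : g * z `^ (g - 1) <= g * x0 `^ (g - 1) by rewrite ler_pM2l.
  by rewrite gx0; lra.
have dx : Num.min (c2 / 2) d2 <= x0 - z.
  have [zc|zc] := leP z (c2 / 2).
    rewrite ge_min; apply/orP; left.
    have : c2 <= x0.
      apply: iroot_le => //; first by rewrite divr_gt0.
      by rewrite (irootK sgg) ler_pM2r ?invr_gt0.
    by lra.
  rewrite ge_min; apply/orP; right; rewrite /d2 ler_pdivrMr//.
  have m : z `^ g <= x0 `^ g by apply: (ge0_ler_powR (ltW g0)); rewrite ?nnegrE// ltW.
  rewrite (powR_split g01 z0) (powR_split g01 x00) in m.
  have k1 : z * (g * z `^ (g - 1) - sg) <= (x0 - z) * sg.
    have : g * (z * z `^ (g - 1)) <= g * (x0 * x0 `^ (g - 1)) by rewrite ler_pM2l.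
    by rewrite -gx0; lra.
  have k2 : z * (pi / 2 - theta0) <= z * (g * z `^ (g - 1) - sg) by rewrite ler_pM2l.
  have k3 : (x0 - z) * sg <= (x0 - z) * tan theta0 by rewrite ler_pM2l// subr_gt0.
  have k4 : c2 / 2 * (pi / 2 - theta0) <= z * (pi / 2 - theta0).
    by rewrite ler_pM2r ?subr_gt0// ltW.
  by lra.
have t00 : 0 <= (x0 - z) / sin ph by rewrite divr_ge0 ?subr_ge0// ltW.
have [|t tt tE] := @powR_line_hit (z `^ g) (- cos ph) z (sin ph) ((x0 - z) / sin ph) z0 S0 C0 t00.
  rewrite divfK ?gt_eqF// [z + _]addrC subrK.
  have := tangent_le g01 (ltW z0) x00; rewrite gx0.
  have -> : (x0 - z) / sin ph * - cos ph = (x0 - z) * sg by rewrite /sg; ring.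
  by lra.
set x := z + t * sin ph in tE.
have xx : x0 <= x.
  by rewrite /x -lerBlDl; move: tt; rewrite ler_pdivrMr.
have tp : 0 < t by apply: lt_le_trans tt; apply: divr_gt0 => //; lra.
have x1 : 0 < x by exact: lt_le_trans xx.
have sm : @is_sign R 1 by right.
have yE : z `^ g - t * cos ph = 1 * x `^ g by rewrite tE; ring.
have bdx := ray_bd sj sm (ltW x1) erefl yE.
rewrite (hit_pointE g01 (ltW z0) sj tp bdx)/= -/ph -/x.
by lra.
Qed.

(** From the apex the exit point is at least [iroot (tan theta0)]. A ray to the
    opposite wall has slope at least [tan eps] and rises by at least a fixed
    height. A ray that comes back to the same wall makes with the tangent an angle
    at least [pi / 2 - theta0], and the slope of the wall varies slowly. *)
Lemma growth : exists2 d : R, 0 < d & forall z j b, 0 <= z -> is_sign j -> (z = 0 -> j = 1) ->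
  `|b| <= theta0 -> (z = 0 -> b != 0) -> (0 < z -> eps <= b /\ theta g z + b != pi / 2) ->
  z + d <= (hit_point g z j b).1.
Proof.
have [d1 d10 H1] := growth_zero; have [d2 d20 H2] := growth_opposite.
have [d3 d30 H3] := growth_same.
exists (Num.min d1 (Num.min d2 d3)); first by rewrite !lt_min d10 d20.
move=> z j b z0 sj zj bt zb zp.
set d := Num.min _ _.
have [l1 [l2 l3]] : d <= d1 /\ d <= d2 /\ d <= d3 by rewrite /d !ge_min !lexx !orbT.
have [ze|zn] := eqVneq z 0.
  by rewrite (zj ze) ze add0r; apply: (le_trans l1); apply: H1 => //; exact: zb.
have z1 : 0 < z by rewrite lt_neqAle eq_sym zn.
have [be nb] := zp z1; have b2 : b <= theta0 := le_trans (ler_norm b) bt.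
have [pl|pl|/eqP] := ltgtP (theta g z + b) (pi / 2); last by rewrite (negbTE nb).
- by apply: le_trans (H2 z j b z1 sj _ pl); [rewrite lerD2l|rewrite be].
- by apply: le_trans (H3 z j b z1 sj _ pl); [rewrite lerD2l|rewrite be].
Qed.

End Growth.

(** * The Lyapunov function *)

Section FarStep.
Context {R : realType} (g theta0 : R).
Hypotheses (g01 : 0 < g < 1) (th0 : 0 < theta0 < pi / 2).
Local Notation narrow := (narrow theta0).
Local Notation v := (vw theta0 g).

Lemma powR_mul_exp (z u p : R) : 0 < z -> (z * expR u) `^ p = z `^ p * expR (p * u).
Proof.
move=> z0; rewrite powRM ?expR_ge0//; last exact: ltW.
by congr (_ * _); rewrite /powR gt_eqF ?expR_gt0// expRK.
Qed.

(** Where the domain is narrow the wall is nearly flat, so a ray leaving inside the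
    cone crosses to the opposite wall; its exit parameter is [vw] by [vwE]. *)
Lemma far_step z j a b : 0 < z -> is_sign j -> narrow (z `^ (g - 1)) -> `|b| <= theta0 ->
  let w := z `^ (g - 1) in
  (step g (z, j, a) b).1.1 = z * expR (w * v w b) /\
  (step g (z, j, a) b).2 = alphaw theta0 g w b.
Proof.
move=> z0 sj nw bt w; have w0 : 0 < w by exact: powR_gt0.
have thE : theta g z = atan (g * w) by rewrite /theta gt_eqF.
have at_ := atan_tauw th0 g01 nw bt; rewrite -/w in at_.
set ph := theta g z + b; have phE : ph = atan (tauw theta0 g w b) by rewrite at_ /ph thE addrC.
have C0 : 0 < cos ph.
  by rewrite phE; apply: cos_gt0_pihalf; rewrite atan_gtNpi2 atan_ltpi2.
have S0 : sin ph = tauw theta0 g w b * cos ph.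
  have : tan ph = tauw theta0 g w b by rewrite phE atanK.
  by rewrite /tan => <-; rewrite divfK// gt_eqF.
pose x := z * expR (w * v w b); have x0 : 0 < x by rewrite mulr_gt0// expR_gt0.
have zg : z `^ g = z * w by exact: powR_split.
have xg : x `^ g = z * w * expR (g * (w * v w b)) by rewrite powR_mul_exp// zg.
have e0 := expR_gt0 (g * (w * v w b)).
pose t := (x `^ g + z `^ g) / cos ph.
have t0 : 0 < t by rewrite divr_gt0// addr_gt0 ?powR_gt0.
have tC : t * cos ph = x `^ g + z `^ g by rewrite /t divfK// gt_eqF.
have xE : x = z + t * sin ph.
  rewrite S0 mulrCA tC xg zg -(vwE th0 g01 nw b) -/w /Gw /x; field.
  by rewrite !gt_eqF//; lra.
have sm : @is_sign R (-1) by left.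
have yE : z `^ g - t * cos ph = -1 * x `^ g by rewrite tC; ring.
have bdx := ray_bd sj sm (ltW x0) xE yE.
have hE := hit_pointE g01 (ltW z0) sj t0 bdx.
rewrite /step/= hE /in_angle hE/= -/ph -xE; split => //.
rewrite gt_eqF//.
have -> : j * (j * z `^ g + t * (- j * cos ph)) = (j * j) * (z `^ g - t * cos ph) by ring.
rewrite (is_sign_sq sj) mul1r yE mulN1r oppr_lt0 powR_gt0//.
rewrite (alphawE th0 g01 nw bt) -/w thE /theta (gt_eqF x0) powR_mul_exp// -/w; congr (_ + atan _).
Qed.

Variables (nu : R) (psi psi1 : R -> R).

Definition lyap (s : R * R * R) : R :=
  s.1.1 `^ nu * Lyap nu (s.1.1 `^ (g - 1)) (psi s.2) (psi1 s.2).

Lemma far_lyap z j a b : 0 < z -> is_sign j -> narrow (z `^ (g - 1)) -> `|b| <= theta0 ->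
  lyap (step g (z, j, a) b) = z `^ nu * Lyap_next theta0 g nu psi psi1 (z `^ (g - 1)) b.
Proof.
move=> z0 sj nw bt; have [E1 E2] := far_step a z0 sj nw bt.
rewrite /lyap E1 E2 !powR_mul_exp// -mulrA /Lyap_next /Lyap; congr (_ * (_ * (_ + _ + _))).
  by ring.
rewrite exprMn expr2 -!mulrA; congr (_ * (_ * (_ * _))).
by rewrite mulrA -expRD; congr (expR _ * _); ring.
Qed.

Lemma Lyap_bounds C : exists2 w0 : R, 0 < w0 & forall w p q, 0 < w <= w0 ->
  `|p| <= C -> `|q| <= C -> 1 / 2 <= Lyap nu w p q <= 2.
Proof.
pose D := 4 * (`|nu| * `|C| + 1).
have nC : 0 <= `|nu| * `|C| by exact: mulr_ge0.
exists (Num.min 1 D^-1) => [|w p q]; first by rewrite lt_min ltr01 invr_gt0 /D; lra.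
rewrite le_min => /andP[w0 /andP[w1]]; rewrite -[X in _ <= X]mul1r ler_pdivlMr; last by rewrite /D; lra.
rewrite /D => wD pC qC.
have h r : `|r| <= C -> `|nu * r| <= `|nu| * `|C|.
  by move=> rC; rewrite normrM ler_wpM2l// (le_trans rC)// ler_norm.
have := h p pC; have := h q qC; rewrite !ler_norml => /andP[q1 q2] /andP[p1 p2].
have -> : Lyap nu w p q = 1 + w * (nu * p) + w ^+ 2 * (nu * q) by rewrite /Lyap; ring.
have w2 : 0 <= w ^+ 2 <= w by rewrite expr2; nra.
by apply/andP; split; nra.
Qed.

Variables (M : R) (k k' : R -> R -> R).
Hypotheses (sk : smooth_kernel theta0 M k k') (upsi : ub psi) (upsi1 : ub psi1).
Variable Bbar : R.
Hypothesis psiE : forall x, psi x - Top k psi x = 2 * Top k (ttan theta0) x.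
Hypothesis psi1E : forall x, psi1 x - Top k psi1 x =
  drift_source theta0 g k k' nu psi x - Bbar.
Hypothesis drift_neg : nu * Bbar < 0.

(** Apply [drift_expansion] with an error smaller than the main term [nu * Bbar]. *)
Lemma lyap_supermartingale : exists2 w0 : R, 0 < w0 & forall w, 0 < w <= w0 ->
  [/\ narrow w,
      forall x y, 1 / 2 <= Lyap nu w (psi x) (psi1 y) <= 2,
      forall b, 1 / 2 * expR (nu * (w * v w b)) <= Lyap_next theta0 g nu psi psi1 w b &
      forall a, Top k (Lyap_next theta0 g nu psi psi1 w) a <= Lyap nu w (psi a) (psi1 a)].
Proof.
have [_ [C1 HC1]] := upsi; have [_ [C2 HC2]] := upsi1.
have [w1 w10 H1] := narrow_exists th0.
have [w2 w20 H2] := Lyap_bounds (Num.max C1 C2).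
have e0 : 0 < - (nu * Bbar) by rewrite oppr_gt0.
have [w3 w30 H3] := drift_expansion th0 g01 sk upsi upsi1 psiE psi1E e0.
exists (Num.min w1 (Num.min (w2 / 2) w3)).
  by rewrite !lt_min w10 w30 andbT /=; lra.
move=> w; rewrite !le_min => /andP[w0 /andP[h1 /andP[h2 h3]]].
have p1 x : `|psi x| <= Num.max C1 C2 by rewrite le_max HC1.
have p2 x : `|psi1 x| <= Num.max C1 C2 by rewrite le_max HC2 orbT.
have nw : narrow w by apply: H1; rewrite w0.
split => //.
- by move=> x y; apply: H2 => //; rewrite w0; lra.
- move=> b; rewrite /Lyap_next mulrC ler_pM2l ?expR_gt0//.
  set e := expR ((g - 1) * _).
  have /andP[e1 e2] : 1 / 2 <= e <= 2 by exact: (exp_g1 th0 g01 nw (vw_abs th0 g01 nw b)).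
  have -> : expR (2 * (g - 1) * (w * v w b)) = e ^+ 2.
    by rewrite expr2 -expRD; congr expR; ring.
  have we : 0 < w * e <= w2 by (apply/andP; split; nra).
  have /andP[h _] := H2 _ _ _ we (p1 (alphaw theta0 g w b)) (p2 (alphaw theta0 g w b)).
  apply: le_trans (_ : Lyap nu (w * e) (psi (alphaw theta0 g w b)) (psi1 (alphaw theta0 g w b)) <= _).
    exact: h.
  rewrite le_eqVlt; apply/orP; left; apply/eqP; rewrite /Lyap; ring.
- move=> a; have := H3 w a; rewrite w0 h3 => /(_ isT); rewrite ler_norml => /andP[_ h].
  have -> : Lyap nu w (psi a) (psi1 a) = (Lyap nu w (psi a) (psi1 a) + nu * w ^+ 2 * Bbar) +
    - (nu * Bbar) * w ^+ 2 by ring.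
  by lra.
Qed.

End FarStep.

(** * Joint law of a state and the next outgoing angle *)

Section ConstantKernel.
Context {d0 d1} {T0 : measurableType d0} {T1 : measurableType d1} {R : realType}.
Variable m : {measure set T1 -> \bar R}.
Hypothesis m1 : (m setT <= 1)%E.

Definition kconst (_ : T0) : {measure set T1 -> \bar R} := m.

Let measurable_kconst U : measurable U -> measurable_fun setT (kconst ^~ U).
Proof. by move=> mU; exact: measurable_cst. Qed.

HB.instance Definition _ := isKernel.Build _ _ _ _ _ kconst measurable_kconst.

Let kconst_sub : (ereal_sup [set kconst x setT | x in setT] <= 1)%E.
Proof. by apply: ge_ereal_sup => _ [x _ <-]; exact: m1. Qed.

HB.instance Definition _ := Kernel_isSubProbability.Build _ _ _ _ _ kconst kconst_sub.

Definition kconst_sub_kernel : R.-spker T0 ~> T1 := kconst.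

End ConstantKernel.

Section GraphKernel.
Context {d0 d1 d2} {T0 : measurableType d0} {T1 : measurableType d1}
  {T2 : measurableType d2} {R : realType}.
Variables (X : T0 -> T1) (k : R.-spker T1 ~> T2).
Hypothesis mX : measurable_fun setT X.

(** The law of [(X x, b)] with [b] drawn from [k (X x)]. *)
Definition kgraph (x : T0) (A : set (T1 * T2)) : \bar R := k (X x) (xsection A (X x)).

Section Measure.
Variable x : T0.
Let kgraph0 : kgraph x set0 = 0%E.
Proof. by rewrite /kgraph xsection0 measure0. Qed.

Let kgraph_ge0 A : (0 <= kgraph x A)%E.
Proof. exact: measure_ge0. Qed.

Let kgraph_additive : semi_sigma_additive (kgraph x).
Proof.
move=> F mF tF mUF; rewrite /kgraph xsection_bigcup.
apply: measure_semi_sigma_additive.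
- by move=> n; exact: measurable_xsection.
- exact: trivIset_xsection.
- by apply: bigcup_measurable => n _; exact: measurable_xsection.
Qed.

HB.instance Definition _ := isMeasure.Build _ _ _ (kgraph x) kgraph0 kgraph_ge0 kgraph_additive.
End Measure.

Definition mkgraph (x : T0) : {measure set (T1 * T2) -> \bar R} := kgraph x.

Let measurable_mkgraph U : measurable U -> measurable_fun setT (mkgraph ^~ U).
Proof.
move=> mU.
have h : measurable_fun setT (fun s : T1 => k s (xsection U s)).
  by apply: measurable_fun_xsection_finite_kernel; rewrite inE.
exact: (measurableT_comp h mX).
Qed.

HB.instance Definition _ := isKernel.Build _ _ _ _ _ mkgraph measurable_mkgraph.

Let mkgraph_sub : (ereal_sup [set mkgraph x setT | x in setT] <= 1)%E.
Proof.
apply: ge_ereal_sup => _ [x _ <-]; apply: le_trans (sprob_kernel_le1 k (X x)).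
by apply: le_measure; rewrite ?inE//; apply: measurable_xsection.
Qed.

HB.instance Definition _ := Kernel_isSubProbability.Build _ _ _ _ _ mkgraph mkgraph_sub.

Definition graph_kernel : R.-spker T0 ~> (T1 * T2)%type := mkgraph.

Lemma graph_kernel_integral x (F : T1 * T2 -> \bar R) : measurable_fun setT F ->
  (forall p, 0 <= F p)%E ->
  (\int[graph_kernel x]_p F p = \int[k (X x)]_b F (X x, b))%E.
Proof.
move=> mF F0.
have mp : measurable_fun setT (fun b : T2 => (X x, b)) by exact: pair1_measurable.
rewrite -(@ge0_integral_pushforward _ _ _ _ _ _ mp (k (X x)) setT F measurableT mF); last by move=> p _.
apply: eq_measure_integral => A mA _; rewrite /= /mkgraph /kgraph /pushforward/=.
by congr (k _ _); rewrite xsectionE.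
Qed.

End GraphKernel.

Section JointLaw.
Context {d1 d2 d} {T1 : measurableType d1} {T2 : measurableType d2}
  {Omega : measurableType d} {R : realType}.
Variables (P : probability Omega R) (H : set Omega) (X : Omega -> T1) (Y : Omega -> T2)
  (k : R.-spker T1 ~> T2).
Hypotheses (mH : measurable H) (mX : measurable_fun setT X) (mY : measurable_fun setT Y).
Hypothesis rect : forall A B, measurable A -> measurable B ->
  P ((H `&` X @^-1` A) `&` Y @^-1` B) = (\int[P]_(w in H `&` X @^-1` A) k (X w) B)%E.

Lemma integral_mrestr (F : Omega -> \bar R) : measurable_fun setT F -> (forall w, 0 <= F w)%E ->
  (\int[mrestr P mH]_w F w = \int[P]_(w in H) F w)%E.
Proof.
move=> mF F0.
rewrite (@ge0_negligible_integral _ _ _ (mrestr P mH) setT (~` H))//.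
- rewrite setTD setCK; apply: eq_measure_integral => A mA AH.
  by change (P (A `&` H) = P A); rewrite (setIidl AH).
- exact: measurableC.
- by change (P (~` H `&` H) = 0%E); rewrite setICl measure0.
Qed.

Let mr1 : (mrestr P mH setT <= 1)%E.
Proof. by rewrite /mrestr setTI probability_le1. Qed.

Let mXT : measurable_fun setT (X \o @snd unit Omega).
Proof. exact: (measurableT_comp mX measurable_snd). Qed.

(** Both sides are integrals of [F] against finite measures on the product, the
    right-hand one being a composition of kernels; by [rect] they agree on
    rectangles, which generate. *)
Lemma joint_law_integral (F : T1 * T2 -> \bar R) : measurable_fun setT F ->
  (forall p, 0 <= F p)%E ->
  (\int[P]_(w in H) F (X w, Y w) = \int[P]_(w in H) \int[k (X w)]_b F (X w, b))%E.
Proof.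
move=> mF F0.
pose l := kconst_sub_kernel (T0 := unit) mr1.
pose kk := graph_kernel k mXT.
have mXY : measurable_fun setT (fun w => (X w, Y w)) by apply/measurable_fun_pairP.
have E2 : (\int[kcomp l kk tt]_p F p = \int[P]_(w in H) \int[k (X w)]_b F (X w, b))%E.
  rewrite (integral_kcomp l kk)//.
  transitivity (\int[mrestr P mH]_w \int[k (X w)]_b F (X w, b))%E.
    by apply: eq_integral => w _; rewrite graph_kernel_integral.
  apply: integral_mrestr; last by move=> w; exact: integral_ge0.
  have h := @measurable_fun_integral_sfinite_kernel _ _ T1 T2 R F k F0 mF.
  exact: (measurableT_comp h mX).
rewrite -E2 -integral_mrestr//; last exact: (measurableT_comp mF mXY).
rewrite -(@ge0_integral_pushforward _ _ _ _ _ _ mXY (mrestr P mH) setT F measurableT mF); last by move=> p _.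
apply: eq_measure_integral => A mA _.
pose C : set (set (T1 * T2)) :=
  [set C | exists A, measurable A /\ exists B, measurable B /\ C = A `*` B].
have CI : setI_closed C.
  move=> /= _ _ [X1 [mX1 [X2 [mX2 ->]]]] [Y1 [mY1 [Y2 [mY2 ->]]]].
  rewrite -setXI; exists (X1 `&` Y1); split; first exact: measurableI.
  by exists (X2 `&` Y2); split => //; exact: measurableI.
apply: (measure_unique C (fun=> setT)) => //.
- rewrite measurable_prod_measurableType //; congr (<<s _ >>).
  rewrite predeqE => D; split => [[A1 mA1 [B1 mB1 <-]]|[A1 [mA1 [B1 [mB1 ->]]]]].
    by exists A1; split => //; exists B1.
  by exists A1 => //; exists B1.
- by move=> i; exists setT; split => //; exists setT; split => //; rewrite setXTT.
- by rewrite bigcup_const//; exists 0%N.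
- move=> _ [A1 [mA1 [B1 [mB1 ->]]]].
  change (P ((fun w => (X w, Y w)) @^-1` (A1 `*` B1) `&` H) = kcomp l kk tt (A1 `*` B1)).
  have -> : (fun w => (X w, Y w)) @^-1` (A1 `*` B1) `&` H = (H `&` X @^-1` A1) `&` Y @^-1` B1.
    by apply/seteqP; split=> w /= => [[[? ?] ?]|[[? ?] ?]].
  rewrite rect// /kcomp/= /kconst_sub_kernel /kconst.
  have mk : measurable_fun setT (fun w => kgraph (X \o snd) k (tt, w) (A1 `*` B1)).
    have h : measurable_fun setT (fun s : T1 => k s (xsection (A1 `*` B1) s)).
      by apply: measurable_fun_xsection_finite_kernel; rewrite inE; exact: measurableX.
    exact: (measurableT_comp h mX).
  rewrite integral_mrestr//.
  rewrite integral_mkcond [RHS]integral_mkcond; apply: eq_integral => w _.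
  rewrite !patchE /kgraph/=; have [wA|wA] := boolP (X w \in A1).
    rewrite in_xsectionX//.
    have -> : (w \in H `&` X @^-1` A1) = (w \in H).
      by rewrite in_setI (_ : w \in X @^-1` A1 = true) ?andbT//; apply/mem_set/set_mem.
    by [].
  rewrite notin_xsectionX// measure0 if_same.
  by rewrite ifF//; apply/negbTE; apply: contra wA => /set_mem[_ /mem_set].
- move=> i; change (P ((fun w => (X w, Y w)) @^-1` setT `&` H) < +oo)%E.
  by rewrite preimage_setT setTI; exact: le_lt_trans (probability_le1 P mH) (ltry 1).
Qed.

End JointLaw.

(** * Events of the past and almost sure properties *)

Section Past.
Context {R : realType} {d : measure_display} {Omega : measurableType d}.
Variable zeta : nat -> Omega -> R * R * R.
Local Notation Z n w := (zeta n w).1.1.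
Local Notation state := (R * R * R)%type.
Local Notation G n := [set H : set Omega | exists i A, [/\ (i <= n)%N, measurable A & H = zeta i @^-1` A]].

Lemma pastI n H H' : past zeta n H -> past zeta n H' -> past zeta n (H `&` H').
Proof. exact: (@measurableI _ (g_sigma_algebraType (G n))). Qed.

Lemma pastC n H : past zeta n H -> past zeta n (~` H).
Proof. exact: (@measurableC _ (g_sigma_algebraType (G n))). Qed.

Lemma pastU n H H' : past zeta n H -> past zeta n H' -> past zeta n (H `|` H').
Proof. exact: (@measurableU _ (g_sigma_algebraType (G n))). Qed.

Lemma pastT n : past zeta n setT.
Proof. exact: (@measurableT _ (g_sigma_algebraType (G n))). Qed.

Lemma past_preimage n i A : (i <= n)%N -> measurable A -> past zeta n (zeta i @^-1` A).
Proof. by move=> ni mA; apply: sub_sigma_algebra; exists i, A. Qed.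

Lemma past_le n m : (n <= m)%N -> past zeta n `<=` past zeta m.
Proof.
move=> nm; apply: sub_smallest2r; first exact: smallest_sigma_algebra.
by move=> _ [i [A [ni mA ->]]]; exists i, A; split => //; exact: (leq_trans ni nm).
Qed.

Lemma past_Z n i : (i <= n)%N -> measurable_fun
  (setT : set (g_sigma_algebraType (G n)))
  (fun w => Z i w).
Proof.
move=> ni _ B mB; rewrite setTI.
have m1 : measurable_fun setT (fun s : state => s.1.1).
  exact: (measurableT_comp measurable_fst measurable_fst).
apply: (past_preimage ni (A := (fun s : state => s.1.1) @^-1` B)).
by rewrite -[X in measurable X]setTI; exact: m1.
Qed.

Lemma past_itv n i (J : interval R) : (i <= n)%N -> past zeta n [set w | Z i w \in J].
Proof. by move=> ni; have := past_Z ni measurableT (measurable_itv J); rewrite setTI. Qed.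

Lemma past_increment n i j (c : R) : (i <= n)%N -> (j <= n)%N -> past zeta n [set w | Z i w + c <= Z j w].
Proof.
move=> ni nj; have mf := measurable_funB (measurable_funB (past_Z nj) (past_Z ni)) (@measurable_cst _ _ (g_sigma_algebraType (G n)) _ setT c).
have := mf measurableT _ (measurable_itv `[0, +oo[); rewrite setTI.
rewrite (_ : _ @^-1` _ = [set w | Z i w + c <= Z j w])//.
by apply/seteqP; split => w /=; rewrite in_itv/= andbT; lra.
Qed.

Definition stays_below (Y : R) n : set Omega := [set w | forall k, (k <= n)%N -> Z k w < Y].

Lemma stays_below0 Y : stays_below Y 0 = [set w | Z 0 w \in `]-oo, Y[].
Proof.
apply/seteqP; split => w /=; rewrite in_itv/=; first by move=> /(_ 0%N (leqnn 0)).
by move=> h k; rewrite leqn0 => /eqP ->.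
Qed.

Lemma stays_belowS Y n :
  stays_below Y n.+1 = stays_below Y n `&` [set w | Z n.+1 w \in `]-oo, Y[].
Proof.
apply/seteqP; split => w /=; rewrite in_itv/=.
  by move=> h; split => [k kn|]; apply: h => //; exact: leqW.
by move=> [h1 h2] k; rewrite leq_eqVlt => /orP[/eqP -> //|]; exact: h1.
Qed.

Lemma past_stays_below Y n : past zeta n (stays_below Y n).
Proof.
elim: n => [|n IH]; first by rewrite stays_below0; exact: past_itv.
rewrite stays_belowS; apply: pastI; last exact: past_itv.
exact: (past_le (leqnSn n) IH).
Qed.

Hypothesis mzeta : forall n, measurable_fun setT (zeta n).

Lemma past_measurable n H : past zeta n H -> measurable H.
Proof.
have h : G n `<=` @measurable d Omega.
  by move=> _ [i [A [_ mA ->]]]; rewrite -[X in measurable X]setTI; exact: mzeta.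
exact: (smallest_sub (@sigma_algebra_measurable _ Omega) h).
Qed.

End Past.

Section ProcessBasics.
Context {R : realType} (g theta0 : R) (K : R.-pker R ~> R) (kappa : R -> R -> R) (M : R).
Hypotheses (g01 : 0 < g < 1) (th0 : 0 < theta0 < pi / 2) (B0 : markov_on_S K)
  (B1 : hypB1 theta0 K) (B2 : hypB2 K kappa)
  (sk : smooth_kernel theta0 M (kt kappa) (kt' kappa)).
Context {d : measure_display} {Omega : measurableType d}.
Variables (P : probability Omega R) (zeta : nat -> Omega -> R * R * R) (beta : nat -> Omega -> R).
Hypothesis CP : collisions_process g theta0 K P zeta beta.
Local Notation S := (@Sang R).
Local Notation leb := (@lebesgue_measure R).
Local Notation state := (R * R * R)%type.

Let mzeta := zeta_measurable CP.
Let mbeta := beta_measurable CP.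

Lemma Z_ge0 n w : 0 <= (zeta n w).1.1 /\ is_sign (zeta n w).1.2.
Proof.
elim: n => [|n [z0 sj]]; first by have [] := zeta_init CP w.
rewrite (zeta_step CP)/=; split; last exact: sgn_sign.
by have /boundaryP[] := hit_boundary g01 (beta n w) z0 sj.
Qed.

Definition validset : set state := [set s | valid s].

Lemma measurable_validset : measurable validset.
Proof.
have m1 : measurable_fun setT (fun s : state => s.1.1).
  exact: (measurableT_comp measurable_fst measurable_fst).
have m2 : measurable_fun setT (fun s : state => s.1.2).
  exact: (measurableT_comp measurable_snd measurable_fst).
have m3 : measurable_fun setT (fun s : state => s.2) by exact: measurable_snd.
pose pre (f : state -> R) (A : set R) := f @^-1` A.
have mpre f A : measurable_fun setT f -> measurable A -> measurable (pre f A).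
  by move=> mf mA; rewrite /pre -[X in measurable X]setTI; exact: mf.
have mi (i : interval R) : measurable [set` i] by exact: measurable_itv.
pose f1 := fun s : state => s.1.1; pose f2 := fun s : state => s.1.2; pose f3 := fun s : state => s.2.
rewrite (_ : validset = pre f1 [set` `[0, +oo[%R] `&` (pre f2 [set -1] `|` pre f2 [set 1]) `&`
   (~` pre f1 [set 0] `|` pre f2 [set 1]) `&` (~` pre f1 [set` `]0, +oo[%R] `|` pre f3 S)).
  have s1 x : measurable (pre f2 [set x]) by exact: mpre.
  have s2 : measurable (pre f1 [set` `[0, +oo[%R]) by exact: mpre.
  have s3 : measurable (pre f1 [set` `]0, +oo[%R]) by exact: mpre.
  have s4 : measurable (pre f1 [set 0]) by exact: mpre.
  have s5 : measurable (pre f3 S) by apply: mpre => //; exact: mS.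
  apply: measurableI; first apply: measurableI; first apply: measurableI => //.
  - exact: measurableU.
  - by apply: measurableU => //; exact: measurableC.
  - by apply: measurableU => //; exact: measurableC.
apply/seteqP; split=> s /=; rewrite /pre /f1 /f2 /f3/= !in_itv/= !andbT.
  move=> [h1 h2 h3 h4]; split; first split; first split => //.
  - by have [/h3|] := pselect (s.1.1 = 0); [right|left].
  - by have [/h4|] := pselect (0 < s.1.1); [right|left].
move=> [[[h1 h2] h3] h4]; split => //.
- by move=> e; case: h3.
- by move=> e; case: h4.
Qed.

Lemma out_law_compl s : valid s -> out_law theta0 K s (~` Sang0 theta0) = 0%E.
Proof.
move=> [z0 _ _ Sa]; rewrite /out_law; case: ifPn => zp.
  by apply: pker_compl0; [exact: measurable_itv|apply: B1; exact: Sa].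
apply: integral0_eq => x; rewrite /Sang0/= in_itv/= => /negP/negbTE xn.
by rewrite /uniform_pdf xn.
Qed.

Lemma K_point a x : S a -> K a [set x] = 0%E.
Proof.
move=> Sa; have [Sx|nSx] := pselect (S x).
  rewrite (kappa_density B2)//; last by move=> y ->.
  by rewrite integral_set1.
apply/eqP; rewrite -measure_le0 -(K_compl_S B0 Sa); apply: le_measure; rewrite ?inE//.
  by apply: measurableC; exact: mS.
by move=> y ->.
Qed.

Lemma out_law_point s x : valid s -> out_law theta0 K s [set x] = 0%E.
Proof.
move=> [z0 _ _ Sa]; rewrite /out_law; case: ifPn => zp; first by rewrite K_point//; exact: Sa.
by rewrite integral_set1.
Qed.

Lemma past_valid n : past zeta n (zeta n @^-1` validset).
Proof. by apply: past_preimage => //; exact: measurable_validset. Qed.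

Lemma beta_null n B : measurable B -> (forall s, valid s -> out_law theta0 K s B = 0%E) ->
  P (zeta n @^-1` validset `&` beta n @^-1` B) = 0%E.
Proof.
move=> mB H; rewrite (beta_law CP)//; last exact: past_valid.
by apply: integral0_eq => w vw; exact: H.
Qed.

Lemma beta_cone n : P.-negligible
  (zeta n @^-1` validset `&` [set w | ~ (`|beta n w| <= theta0 /\ beta n w != 0)]).
Proof.
have mV : measurable (zeta n @^-1` validset).
  by apply: (past_measurable mzeta); exact: past_valid.
have mS0 : measurable (Sang0 theta0) by exact: measurable_itv.
have null B : measurable B -> (forall s, valid s -> out_law theta0 K s B = 0%E) ->
    P.-negligible (zeta n @^-1` validset `&` beta n @^-1` B).
  move=> mB HB; apply/negligibleP; last exact: beta_null.
  by apply: measurableI => //; rewrite -[X in measurable X]setTI; exact: mbeta.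
have N1 := null _ (measurableC mS0) out_law_compl.
have N2 := null _ (@measurable_set1 R 0) (fun s => @out_law_point s 0).
apply: negligibleS (negligibleU N1 N2) => w [vw h].
have [b0|/eqP b0] := pselect (beta n w = 0); first by right.
left; split => // bt; apply: h; split => //.
by move: bt; rewrite /Sang0/= in_itv/= -ler_norml.
Qed.

Lemma valid_ae n : P.-negligible (~` (zeta n @^-1` validset)).
Proof.
elim: n => [|n IH].
  rewrite (_ : ~` _ = set0); first exact: negligible_set0.
  apply/seteqP; split => // w h; apply: h; apply: valid_state; exact: (zeta_init CP).
apply: negligibleS (negligibleU IH (beta_cone n)) => w h.
have [vw|nv] := pselect (valid (zeta n w)); last by left.
right; split => // -[bt b0]; apply: h; rewrite /validset/= (zeta_step CP).
exact: (valid_step g01 th0).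
Qed.

Lemma beta_ae n :
  P.-negligible [set w | ~ (valid (zeta n w) /\ `|beta n w| <= theta0 /\ beta n w != 0)].
Proof.
apply: negligibleS (negligibleU (valid_ae n) (beta_cone n)) => w h.
by have [vw|nv] := pselect (valid (zeta n w)); [right; split => // hb; apply: h|left].
Qed.

Definition Kstate : R.-spker state ~> R := kernel.kernel_snd K.

Lemma joint_integral n H (F : state * R -> \bar R) : past zeta n H ->
  (forall w, H w -> 0 < (zeta n w).1.1) -> measurable_fun setT F -> (forall p, 0 <= F p)%E ->
  (\int[P]_(w in H) F (zeta n w, beta n w) =
   \int[P]_(w in H) \int[K (zeta n w).2]_b F (zeta n w, b))%E.
Proof.
move=> pH Hz mF F0.
apply: (@joint_law_integral _ _ _ state R Omega R P H (zeta n) (beta n) Kstate) => //.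
  exact: (past_measurable mzeta pH).
move=> A B mA mB; rewrite (beta_law CP)//; last by apply: pastI => //; exact: past_preimage.
apply: eq_integral => w /set_mem [Hw _]; rewrite /out_law ifT//; exact: Hz.
Qed.

(** Horizontal rays may never return to the boundary. Given the past, the outgoing
    angle has a density and avoids the one angle that produces them. *)
Lemma horizontal_ae n : P.-negligible [set w | 0 < (zeta n w).1.1 /\ theta g (zeta n w).1.1 + beta n w = pi / 2].
Proof.
pose h (s : state) : R := pi / 2 - atan (g * s.1.1 `^ (g - 1)).
have m1 : measurable_fun setT (fun s : state => s.1.1).
  exact: (measurableT_comp measurable_fst measurable_fst).
have mh : measurable_fun setT h.
  apply: measurable_funB; first exact: measurable_cst.
  have ma : measurable_fun setT (@atan R).
    by apply: continuous_measurable_fun => x; exact: continuous_atan.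
  apply: (measurableT_comp ma); apply: measurable_funM; first exact: measurable_cst.
  exact: (measurableT_comp (measurable_powR (g - 1)) m1).
pose E : set (state * R) := (fst @^-1` validset) `&` (fun p : state * R => p.2 - h p.1) @^-1` [set 0].
have mE : measurable E.
  apply: measurableI.
    by rewrite -[X in measurable X]setTI; apply: measurable_fst => //; exact: measurable_validset.
  have mf : measurable_fun setT (fun p : state * R => p.2 - h p.1).
    apply: measurable_funB; first exact: measurable_snd.
    exact: (measurableT_comp mh measurable_fst).
  by rewrite -[X in measurable X]setTI; exact: mf.
pose H := zeta n @^-1` (validset `&` (fun s : state => s.1.1) @^-1` [set` `]0, +oo[%R]).
have mpos : measurable ((fun s : state => s.1.1) @^-1` [set` `]0, +oo[%R]).
  by rewrite -[X in measurable X]setTI; apply: m1 => //; exact: measurable_itv.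
have pH : past zeta n H.
  by apply: past_preimage => //; apply: measurableI => //; exact: measurable_validset.
have mH := past_measurable mzeta pH.
have Hz w : H w -> 0 < (zeta n w).1.1 by move=> [_] /=; rewrite in_itv/= andbT.
have mXY : measurable_fun setT (fun w => (zeta n w, beta n w)) by apply/measurable_fun_pairP; split; [exact: mzeta|exact: mbeta].
have mind : measurable_fun setT (fun p : state * R => (\1_E p : R)%:E).
  by apply/measurable_EFinP; exact: measurable_indic.
have F0 (p : state * R) : (0 <= (\1_E p : R)%:E)%E by rewrite lee_fin indicE.
have := joint_integral pH Hz mind F0.
rewrite [RHS]integral0_eq; last first.
  move=> w [vw zp].
  rewrite (_ : (fun b => _) = (fun b => (\1_[set h (zeta n w)] b : R)%:E)).
    rewrite integral_indic// setIT K_point//; case: vw => _ _ _; apply.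
    by move: zp; rewrite /= in_itv/= andbT.
  apply/funext => b; rewrite !indicE; congr (_%:R%:E); congr nat_of_bool.
  apply/idP/idP => /set_mem.
    by move=> [_ /= /eqP]; rewrite subr_eq0 => /eqP ->; apply/mem_set.
  by move=> ->; apply/mem_set; split => //=; rewrite subrr.
set Q := (fun w => (zeta n w, beta n w)) @^-1` E.
have mQ : measurable Q by rewrite -[X in measurable X]setTI; exact: mXY.
rewrite (_ : (fun w => _) = (fun w => (\1_Q w : R)%:E)); last by apply/funext => w; rewrite !indicE.
rewrite integral_indic// => PQ.
have N1 : P.-negligible (Q `&` H) by apply/negligibleP => //; exact: measurableI.
apply: negligibleS (negligibleU (valid_ae n) N1) => w [zp e].
have [vw|nv] := pselect (valid (zeta n w)); last by left.
right; split.
  split => //=; apply/eqP; rewrite subr_eq0; apply/eqP.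
  by rewrite /h -e /theta gt_eqF//; ring.
by split => //=; rewrite in_itv/= zp.
Qed.

End ProcessBasics.

(** * Escape from bounded regions *)

Section Escape.
Context {R : realType} (g theta0 : R) (K : R.-pker R ~> R) (kappa : R -> R -> R) (M : R).
Hypotheses (g01 : 0 < g < 1) (th0 : 0 < theta0 < pi / 2) (B0 : markov_on_S K)
  (B1 : hypB1 theta0 K) (B2 : hypB2 K kappa) (B3 : hypB3 K).
Context {d : measure_display} {Omega : measurableType d}.
Variables (P : probability Omega R) (zeta : nat -> Omega -> R * R * R) (beta : nat -> Omega -> R).
Hypothesis CP : collisions_process g theta0 K P zeta beta.
Local Notation S := (@Sang R).
Local Notation leb := (@lebesgue_measure R).
Local Notation state := (R * R * R)%type.
Local Notation Z n w := (zeta n w).1.1.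

Let mzeta := zeta_measurable CP.
Let mbeta := beta_measurable CP.

Lemma measure_le_negligible (A B : set Omega) : measurable A -> measurable B ->
  P.-negligible (A `\` B) -> (P A <= P B)%E.
Proof.
move=> mA mB nAB; rewrite (measureDI P mA mB)// measure_negligible//; last exact: measurableD.
by rewrite add0e; apply: le_measure; rewrite ?inE//; exact: measurableI.
Qed.

Lemma measurable_out_law B : measurable B -> measurable_fun setT (fun s : state => out_law theta0 K s B).
Proof.
move=> mB; rewrite /out_law; apply: measurable_fun_ifT.
- apply: measurable_fun_ltr; first exact: measurable_cst.
  exact: (measurableT_comp measurable_fst measurable_fst).
- have h := measurable_kernel K B mB.
  exact: (measurableT_comp h measurable_snd).
- exact: measurable_cst.
Qed.

(** At the apex the law is uniform on the cone: the forward angles beyond half of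
    [theta0] have probability 1/4. *)
Lemma out_law_forward : exists2 e : R, 0 < e <= theta0 & exists2 q : R, 0 < q <= 1 &
  forall s, valid s -> (q%:E <= out_law theta0 K s [set` `[e, pi / 2]%R])%E.
Proof.
have [e3 e30 He] := B3; have /andP[t0 t1] := th0.
pose e := Num.min e3 (theta0 / 2).
have [e0 ele3 ele] : [/\ 0 < e, e <= e3 & e <= theta0 / 2].
  by rewrite lt_min e30 ge_min lexx ge_min lexx orbT; split => //; lra.
have mE (x : R) : measurable [set` `[x, pi / 2]%R] by exact: measurable_itv.
exists e; first by apply/andP; split => //; lra.
exists (Num.min e3 (1 / 4)); first by rewrite lt_min e30 ge_min; apply/andP; split; [lra|apply/orP; right; lra].
move=> s [z0 _ _ Sa]; rewrite /out_law; case: ifPn => zp.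
  apply: le_trans (_ : (e3%:E <= _)%E); first by rewrite lee_fin ge_min lexx.
  apply: le_trans (He _ (Sa zp)) _; apply: le_measure; rewrite ?inE//.
    by have := mE e3; congr measurable; apply/seteqP; split => x /=; rewrite in_itv.
  by move=> x /=; rewrite in_itv/= => /andP[h1 h2]; apply/andP; split => //; lra.
have mI : measurable [set` `[e, theta0]%R] by exact: measurable_itv.
have mU : measurable_fun setT (fun x : R => (uniform_pdf (- theta0) theta0 x)%:E).
  by apply/measurable_EFinP; exact: measurable_uniform_pdf.
have U0 (x : R) : (0 <= (uniform_pdf (- theta0) theta0 x)%:E)%E.
  by rewrite lee_fin uniform_pdf_ge0//; lra.
apply: (@le_trans _ _ (\int[leb]_(x in [set` `[e, theta0]%R]) (uniform_pdf (- theta0) theta0 x)%:E)%E); last first.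
  apply: ge0_subset_integral => //; first exact: measurable_funS mU.
  by move=> x /=; rewrite !in_itv/= => /andP[h1 h2]; apply/andP; split => //; lra.
rewrite (eq_integral (cst ((2 * theta0)^-1)%:E)); last first.
  move=> x /set_mem/=; rewrite in_itv/= => /andP[h1 h2]; rewrite /uniform_pdf ifT.
    by congr (_^-1)%:E; ring.
  by apply/andP; split; lra.
have lm : leb [set` `[e, theta0]%R] = (theta0 - e)%:E.
  by rewrite lebesgue_measure_itv/= lte_fin ifT; last by lra.
rewrite integral_cst//; rewrite [X in (_ * X)%E]lm -EFinM lee_fin ge_min; apply/orP; right.
by rewrite ler_pdivlMl; lra.
Qed.

Lemma advance : exists2 c : R, 0 < c & exists2 q : R, 0 < q <= 1 & forall n H, past zeta n H ->
  (q%:E * P H <= P (H `&` [set w | Z n w + c <= Z n.+1 w]%R))%E.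
Proof.
have [e e01 [q q01 Hq]] := out_law_forward; have [c c0 Hc] := growth g01 th0 e01.
exists c => //; exists q => // n H pH; have mH := past_measurable mzeta pH.
have pV : past zeta n (zeta n @^-1` validset) by exact: past_valid.
have mV := past_measurable mzeta pV.
have mB : measurable [set` `[e, pi / 2]%R] by exact: measurable_itv.
have mHV : measurable (H `&` zeta n @^-1` validset) by exact: measurableI.
have -> : (P H = P (H `&` zeta n @^-1` (@validset R)))%E.
  apply/eqP; rewrite eq_le; apply/andP; split.
    apply: measure_le_negligible => //.
    apply: negligibleS (valid_ae g01 th0 B0 B1 B2 CP n) => w [Hw nw] vw.
    by apply: nw.
  by apply: le_measure; rewrite ?inE//; exact: subIsetl.
have mO : measurable_fun setT (fun w => out_law theta0 K (zeta n w) [set` `[e, pi / 2]%R]).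
  exact: (measurableT_comp (measurable_out_law mB) (mzeta n)).
rewrite -integral_cst//.
apply: (@le_trans _ _ (\int[P]_(w in H `&` zeta n @^-1` (@validset R)) out_law theta0 K (zeta n w) [set` `[e, pi / 2]%R])%E).
  apply: ge0_le_integral => //.
  - by move=> w _; rewrite lee_fin; case/andP: q01 => /ltW.
  - exact: measurable_funS mO.
  - by move=> w [_ vw]; exact: Hq.
rewrite -(beta_law CP)//; last exact: pastI.
have mbB : measurable (beta n @^-1` [set` `[e, pi / 2]%R]).
  by rewrite -[X in measurable X]setTI; exact: mbeta.
apply: measure_le_negligible.
- exact: measurableI.
- apply: measurableI => //.
  by apply: (past_measurable mzeta); apply: (@past_increment _ _ _ zeta n.+1).
apply: negligibleS (negligibleU (beta_ae g01 th0 B0 B1 B2 CP n) (horizontal_ae g01 th0 B0 B1 B2 CP n)).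
move=> w [[[Hw vw] bw] nadv]; apply: contrapT => h; apply: nadv; split => //.
have [[z0 sj z1 Sa] [bt b0]] : valid (zeta n w) /\ `|beta n w| <= theta0 /\ beta n w != 0.
  by apply: contrapT => h'; apply: h; left.
rewrite /= (zeta_step CP n); apply: Hc => // zp; split.
  by move: bw; rewrite /= in_itv/= => /andP[].
by apply/eqP => eh; apply: h; right.
Qed.

(** Whatever the past, [m] successive advances by [c] occur with probability at least
    [q ^+ m], and [m * c >= Y] forces an exit. So the probability [p] of never
    leaving satisfies [p + q ^+ m * p <= p]. *)
Lemma escape (Y : R) : P (\bigcap_n stays_below zeta Y n) = 0%E.
Proof.
have [c c0 [q /andP[q0 q1] Hadv]] := advance.
pose A := stays_below zeta Y; have pA n : past zeta n (A n) by exact: past_stays_below.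
have mA n := past_measurable mzeta (pA n).
have Ann n : A n.+1 `<=` A n by move=> w h k kn; apply: h; exact: leqW.
have Adec : {homo A : n m / (n <= m)%N >-> (m <= n)%O}.
  by move=> n m nm; apply/subsetPset => w h k kn; apply: h; exact: leq_trans nm.
have mI : measurable (\bigcap_n A n) by apply: bigcap_measurable => // n _.
have PA0 : (P (A 0%N) < +oo)%E by exact: le_lt_trans (probability_le1 P (mA 0%N)) (ltry 1).
have cvgA := nonincreasing_cvg_mu PA0 mA mI Adec.
pose m := Num.bound (`|Y| / c).
have mc : Y <= m%:R * c.
  have Yc : 0 <= `|Y| / c by rewrite divr_ge0// ltW.
  have := archi_boundP Yc; rewrite ltr_pdivrMr// => h.
  exact: le_trans (ler_norm Y) (ltW h).
pose D n i : set Omega := [set w | A n w /\ forall j, (j < i)%N -> Z (n + j)%N w + c <= Z (n + j).+1 w].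
have DS n i : D n i.+1 = D n i `&` [set w | Z (n + i)%N w + c <= Z (n + i).+1 w].
  apply/seteqP; split => w /=.
    by move=> [h1 h2]; split; [split => // j ji; apply: h2; exact: ltnW|exact: h2].
  by move=> [[h1 h2] h3]; split => // j; rewrite ltnS leq_eqVlt => /orP[/eqP -> //|]; exact: h2.
have D0 n : D n 0%N = A n by apply/seteqP; split => w //= [].
have pD n i : past zeta (n + i)%N (D n i).
  elim: i => [|i IH]; first by rewrite addn0 D0.
  rewrite DS addnS; apply: pastI; first exact: past_le IH.
  by apply: past_increment => //.
have PD n i : ((q ^+ i)%:E * P (A n) <= P (D n i))%E.
  elim: i => [|i IH]; first by rewrite expr0 mul1e D0.
  rewrite DS; apply: le_trans (Hadv _ _ (pD n i)); rewrite exprS EFinM -muleA.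
  by apply: lee_wpmul2l => //; rewrite lee_fin ltW.
have DA n : D n m `&` A (n + m)%N = set0.
  apply/seteqP; split => // w [[h1 h2] h3].
  have hz i : (i <= m)%N -> i%:R * c <= Z (n + i)%N w.
    elim: i => [_|i IH im]; first by rewrite mul0r; have [] := Z_ge0 g01 CP (n + 0) w.
    rewrite addnS; apply: le_trans (h2 i im); rewrite mulrSr mulrDl mul1r lerD2r.
    by apply: IH; exact: ltnW.
  have := h3 _ (leqnn (n + m)%N); rewrite ltNge => /negP; apply.
  by apply: le_trans mc _; exact: hz.
have step_ n : (P (A (n + m)%N) + (q ^+ m)%:E * P (A n) <= P (A n))%E.
  apply: (@le_trans _ _ (P (A (n + m)%N) + P (D n m))%E); first exact: leeD2l.
  have mD := past_measurable mzeta (pD n m).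
  rewrite -measureU//; last by rewrite setIC.
  apply: le_measure; rewrite ?inE//; first exact: measurableU.
  move=> w [h|[]//]; have /subsetPset := Adec _ _ (leq_addr m n); exact.
set p := P (\bigcap_n A n).
have pf : p \is a fin_num.
  rewrite ge0_fin_numE ?measure_ge0//; exact: le_lt_trans (probability_le1 P mI) (ltry 1).
have pA' n : (p <= P (A n))%E.
  by apply: le_measure; rewrite ?inE// => w; exact.
have lim_ n : (p + (q ^+ m)%:E * p <= P (A n))%E.
  apply: le_trans (step_ n); apply: leeD => //.
  by apply: lee_wpmul2l => //; rewrite lee_fin exprn_ge0// ltW.
have : (p + (q ^+ m)%:E * p <= p)%E.
  apply: cvge_ge cvgA.
  by apply: nearW => n; exact: lim_.
have p0 : (0 <= p)%E by exact: measure_ge0.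
rewrite -(fineK pf) -EFinM -EFinD lee_fin => hp.
have p0' : 0 <= fine p by exact: fine_ge0.
have qm : 0 < q ^+ m by exact: exprn_gt0.
congr EFin; apply/eqP; rewrite eq_le p0' andbT.
by have : q ^+ m * fine p <= 0; [lra|rewrite pmulr_rle0].
Qed.

End Escape.

(** * The supermartingale *)

Section OneStep.
Context {R : realType} (g theta0 : R) (K : R.-pker R ~> R) (kappa : R -> R -> R) (M : R).
Hypotheses (g01 : 0 < g < 1) (th0 : 0 < theta0 < pi / 2) (B0 : markov_on_S K)
  (B1 : hypB1 theta0 K) (B2 : hypB2 K kappa)
  (sk : smooth_kernel theta0 M (kt kappa) (kt' kappa)).
Context {d : measure_display} {Omega : measurableType d}.
Variables (P : probability Omega R) (zeta : nat -> Omega -> R * R * R) (beta : nat -> Omega -> R).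
Hypothesis CP : collisions_process g theta0 K P zeta beta.
Local Notation S := (@Sang R).
Local Notation state := (R * R * R)%type.
Local Notation Z n w := (zeta n w).1.1.
Local Notation v := (vw theta0 g).
Local Notation T := (Top (kt kappa)).

Variables (nu : R) (psi psi1 : R -> R) (z1 : R).
Hypotheses (upsi : ub psi) (upsi1 : ub psi1) (z10 : 0 < z1).
Hypothesis Hlyap : forall z, z1 < z -> let w := z `^ (g - 1) in
  [/\ narrow theta0 w,
      forall x y, 1 / 2 <= Lyap nu w (psi x) (psi1 y) <= 2,
      forall b, 1 / 2 * expR (nu * (w * v w b)) <= Lyap_next theta0 g nu psi psi1 w b &
      forall a, T (Lyap_next theta0 g nu psi psi1 w) a <= Lyap nu w (psi a) (psi1 a)].

Let mzeta := zeta_measurable CP.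
Let mbeta := beta_measurable CP.

Lemma measurable_ub (f : R -> R) : ub f -> measurable_fun setT f.
Proof. by move=> uf; have [] := ub_bmf measurableT uf. Qed.

(** The truncation at 0 matters below [z1] only; it makes all integrals meaningful. *)
Definition flyap (s : state) : R := Num.max 0 (lyap g nu psi psi1 s).

Lemma measurable_flyap : measurable_fun setT flyap.
Proof.
apply: measurable_maxr; first exact: measurable_cst.
have m1 : measurable_fun setT (fun s : state => s.1.1).
  exact: (measurableT_comp measurable_fst measurable_fst).
have m3 : measurable_fun setT (fun s : state => s.2) by exact: measurable_snd.
have mp p : measurable_fun setT (fun s : state => s.1.1 `^ p).
  exact: (measurableT_comp (measurable_powR p) m1).
have mps (f : R -> R) : ub f -> measurable_fun setT (fun s : state => f s.2).
  by move=> uf; exact: (measurableT_comp (measurable_ub uf) m3).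
have mc (c : R) : measurable_fun setT (fun _ : state => c) by exact: measurable_cst.
rewrite /lyap /Lyap; apply: measurable_funM => //.
apply: measurable_funD; first apply: measurable_funD => //.
  by apply: measurable_funM; [exact: measurable_funM|exact: mps].
apply: measurable_funM; [apply: measurable_funM => //|exact: mps].
by apply: measurable_funX; exact: mp.
Qed.

Definition stepF (p : state * R) : R :=
  p.1.1.1 `^ nu * Lyap_next theta0 g nu psi psi1 (p.1.1.1 `^ (g - 1)) p.2.

Definition farset : set (state * R) := [set p | z1 < p.1.1.1].

Lemma measurable_farset : measurable farset.
Proof.
have m1 : measurable_fun setT (fun p : state * R => p.1.1.1).
  exact: (measurableT_comp (measurableT_comp measurable_fst measurable_fst) measurable_fst).
have := m1 measurableT _ (measurable_itv `]z1, +oo[); rewrite setTI.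
rewrite (_ : _ @^-1` _ = farset)//.
by apply/seteqP; split => p; rewrite /farset/= in_itv/= andbT.
Qed.

Lemma measurable_stepF : measurable_fun farset stepF.
Proof.
have m1 : measurable_fun farset (fun p : state * R => p.1.1.1).
  apply: measurable_funTS.
  exact: (measurableT_comp (measurableT_comp measurable_fst measurable_fst) measurable_fst).
have m2 : measurable_fun farset (fun p : state * R => p.2).
  by apply: measurable_funTS; exact: measurable_snd.
have mp p : measurable_fun farset (fun s : state * R => s.1.1.1 `^ p).
  exact: (measurableT_comp (measurable_powR p) m1).
have mc (c : R) : measurable_fun farset (fun _ : state * R => c) by exact: measurable_cst.
have mt : measurable_fun farset (fun p : state * R => ttan theta0 p.2).
  exact: (measurableT_comp (measurable_ub (ub_ttan th0)) m2).
have mexp (f : state * R -> R) : measurable_fun farset f -> measurable_fun farset (fun p => expR (f p)).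
  by move=> mf; exact: (measurableT_comp (@measurable_expR R) mf).
have matan (f : state * R -> R) : measurable_fun farset f -> measurable_fun farset (fun p => atan (f p)).
  have ma : measurable_fun setT (@atan R).
    by apply: continuous_measurable_fun => x; exact: continuous_atan.
  by move=> mf; exact: (measurableT_comp ma mf).
pose wf (p : state * R) := p.1.1.1 `^ (g - 1).
have nw p : farset p -> narrow theta0 (wf p) by move=> fp; have [] := Hlyap fp.
have mw : measurable_fun farset wf by exact: mp.
pose tf p := tauw theta0 g (wf p) p.2.
have mtau : measurable_fun farset tf.
  apply: (eq_measurable_fun (fun p => (ttan theta0 p.2 + g * wf p) *
    (1 - g * wf p * ttan theta0 p.2) `^ (-1))).
    move=> p /set_mem fp; rewrite /tf /tauw -[in RHS]powR_inv1//.
    by have := gwt_den th0 g01 (nw _ fp) p.2; lra.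
  apply: measurable_funM; first by apply: measurable_funD => //; exact: measurable_funM.
  apply: (measurableT_comp (measurable_powR (-1))).
  apply: measurable_funB => //; apply: measurable_funM => //; exact: measurable_funM.
have L0 : 0 < 6 * (tan theta0 + 1) by have := tan_gt0 th0; lra.
have mv : measurable_fun farset (fun p => v (wf p) p.2).
  apply: (measurable_Vw g01 L0 mw mtau) => p fp; have [w0 w1 w2 _ _] := nw _ fp.
  split => //; last exact: (tauw_abs th0 g01 (nw _ fp)).
  by have : 0 <= wf p * (6 * (tan theta0 + 1)); [apply: mulr_ge0; exact: ltW|lra].
have mwv : measurable_fun farset (fun p => wf p * v (wf p) p.2) by exact: measurable_funM.
have ma : measurable_fun farset (fun p => alphaw theta0 g (wf p) p.2).
  apply: (eq_measurable_fun (fun p => atan (tf p) +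
     atan (g * (wf p * expR ((g - 1) * (wf p * v (wf p) p.2)))))).
    move=> p /set_mem fp; rewrite /alphaw /aw (vwE th0 g01 (nw _ fp)) -/(tf p).
    by congr (_ + atan _); rewrite mulrA.
  apply: measurable_funD; first exact: matan.
  apply: matan; apply: measurable_funM => //; apply: measurable_funM => //.
  by apply: mexp; exact: measurable_funM.
have mps (f : R -> R) : ub f -> measurable_fun farset (fun p => f (alphaw theta0 g (wf p) p.2)).
  by move=> uf; exact: (measurableT_comp (measurable_ub uf) ma).
rewrite /stepF /Lyap_next; apply: measurable_funM => //.
apply: measurable_funM; first by apply: mexp; exact: measurable_funM.
apply: measurable_funD; first apply: measurable_funD => //.
  apply: measurable_funM; last exact: mps.
  by apply: measurable_funM; [exact: measurable_funM|apply: mexp; exact: measurable_funM].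
apply: measurable_funM; last exact: mps.
apply: measurable_funM; last by apply: mexp; exact: measurable_funM.
by apply: measurable_funM => //; apply: measurable_funX.
Qed.

Lemma far_narrow z b : z1 < z -> 0 <= Lyap_next theta0 g nu psi psi1 (z `^ (g - 1)) b.
Proof.
move=> zz; have [_ _ h _] := Hlyap zz; apply: le_trans (h b).
by rewrite mulr_ge0 ?expR_ge0//; lra.
Qed.

Lemma flyap_bounds n w : z1 < Z n w ->
  1 / 2 * Z n w `^ nu <= flyap (zeta n w) <= 2 * Z n w `^ nu.
Proof.
move=> zz; have [_ /(_ (zeta n w).2 (zeta n w).2)/andP[h1 h2] _ _] := Hlyap zz.
have p0 : 0 < Z n w `^ nu by apply: powR_gt0; exact: lt_trans zz.
rewrite /flyap /lyap max_r; first by apply/andP; split; nra.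
by rewrite mulr_ge0// ?ltW//; lra.
Qed.

(** Beyond [z1] the next collision is computed by [far_step]; this fails only on the
    null event that the current state is not valid or the angle is not in the cone. *)
Lemma flyap_next n : P.-negligible [set w | z1 < Z n w /\
  ~ [/\ 0 < Z n.+1 w, 1 / 2 * Z n.+1 w `^ nu <= flyap (zeta n.+1 w) &
        flyap (zeta n.+1 w) = stepF (zeta n w, beta n w)]].
Proof.
apply: negligibleS (beta_ae g01 th0 B0 B1 B2 CP n) => w [zz h] [[z0 sj _ _] [bt _]]; apply: h.
have zp : 0 < Z n w by exact: lt_trans zz.
have [nw _ hl _] := Hlyap zz.
have zE : zeta n w = (Z n w, (zeta n w).1.2, (zeta n w).2) by case: (zeta n w) => [[]].
have [E1 _] := far_step g01 th0 (zeta n w).2 zp sj nw bt.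
have E2 := far_lyap g01 th0 nu psi psi1 (zeta n w).2 zp sj nw bt.
rewrite -zE in E1 E2; rewrite -(zeta_step CP) in E1 E2.
have pz : 0 < Z n w `^ nu by exact: powR_gt0.
have pos : 0 <= stepF (zeta n w, beta n w) by rewrite /stepF/= mulr_ge0 ?powR_ge0//; exact: far_narrow.
have fE : flyap (zeta n.+1 w) = stepF (zeta n w, beta n w).
  by rewrite /flyap E2 max_r.
split => //; first by rewrite E1 mulr_gt0// expR_gt0.
rewrite fE /stepF E1 powR_mul_exp//= mulrCA ler_pM2l//; exact: hl.
Qed.

(** By [joint_integral] the left side is an integral of [T (Lyap_next _)] at the
    current state, which the drift estimate in [Hlyap] bounds. *)
Lemma flyap_supermartingale n H : past zeta n H -> H `<=` [set w | z1 < Z n w] ->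
  (\int[P]_(w in H) (flyap (zeta n.+1 w))%:E <= \int[P]_(w in H) (flyap (zeta n w))%:E)%E.
Proof.
move=> pH Hz; have mH := past_measurable mzeta pH.
have mf k D : measurable_fun D (fun w => (flyap (zeta k w))%:E).
  apply: measurable_funTS; apply/measurable_EFinP.
  exact: (measurableT_comp measurable_flyap (mzeta k)).
have f0 k w : (0 <= (flyap (zeta k w))%:E)%E by rewrite lee_fin le_max lexx.
pose V := zeta n @^-1` (@validset R).
have pV : past zeta n V by exact: past_valid.
have mV := past_measurable mzeta pV.
have PV : P (~` V) = 0%E.
  by apply: measure_negligible; [exact: measurableC|exact: (valid_ae g01 th0 B0 B1 B2 CP)].
have red k : (\int[P]_(w in H) (flyap (zeta k w))%:E = \int[P]_(w in H `&` V) (flyap (zeta k w))%:E)%E.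
  by rewrite (@ge0_negligible_integral _ _ _ P H (~` V))// ?setDE ?setCK//; exact: measurableC.
rewrite !red; have pHV := pastI pH pV; have mHV := past_measurable mzeta pHV.
pose F (p : state * R) : \bar R := ((stepF \_ farset) p)%:E.
have mF : measurable_fun setT F.
  apply/measurable_EFinP; apply/(measurable_restrict stepF measurable_farset measurableT).
  by rewrite setTI; exact: measurable_stepF.
have FE p : farset p -> F p = (stepF p)%:E by move=> fp; rewrite /F patchE mem_set.
have F0 p : (0 <= F p)%E.
  rewrite /F patchE lee_fin; case: ifPn => // /set_mem fp.
  by rewrite /stepF mulr_ge0 ?powR_ge0//; exact: far_narrow.
have mXY : measurable_fun setT (fun w => (zeta n w, beta n w)).
  by apply/measurable_fun_pairP; split; [exact: mzeta|exact: mbeta].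
have -> : (\int[P]_(w in H `&` V) (flyap (zeta n.+1 w))%:E =
           \int[P]_(w in H `&` V) F (zeta n w, beta n w))%E.
  apply: ge0_ae_eq_integral => //.
    by apply: measurable_funTS; exact: (measurableT_comp mF mXY).
  apply: negligibleS (flyap_next n) => w h; split; last move=> [_ _ E].
    by apply: contrapT => nz; apply: h => -[Hw _]; case: nz; exact: Hz.
  by apply: h => -[Hw _]; rewrite E FE//; exact: Hz.
rewrite (joint_integral CP pHV)//; last first.
  by move=> w [Hw _]; apply: lt_trans z10 _; exact: Hz.
apply: ge0_le_integral => //.
- by move=> w _; exact: integral_ge0.
- have h := @measurable_fun_integral_sfinite_kernel _ _ _ _ R F (Kstate K) F0 mF.
  by apply: measurable_funTS; exact: (measurableT_comp h (mzeta n)).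
- move=> w [Hw [z0 sj _ Sa]]; have zz : z1 < Z n w := Hz w Hw.
  have zp : 0 < Z n w by exact: lt_trans zz.
  have [nw hb _ hT] := Hlyap zz; have Sal := Sa zp.
  have mSS : measurable S by exact: mS.
  have mFb : measurable_fun setT (fun b : R => F (zeta n w, b)).
    exact: (measurableT_comp mF (pair1_measurable _)).
  rewrite (@ge0_negligible_integral _ _ _ (K (zeta n w).2) setT (~` S))//; last 2 first.
    exact: measurableC.
    exact: K_compl_S.
  rewrite setTD setCK.
  have bL := bmf_Lyap_next th0 g01 nu upsi upsi1 nw.
  rewrite (eq_integral (fun b => (Z n w `^ nu * Lyap_next theta0 g nu psi psi1 (Z n w `^ (g - 1)) b)%:E)); last first.
    by move=> b _; rewrite FE.
  rewrite (K_eint th0 B1 B2 sk Sal)//; last 2 first.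
    exact: bmfZ.
    by move=> b _; rewrite mulr_ge0 ?powR_ge0//; exact: far_narrow.
  rewrite (TopZ sk)// lee_fin /flyap /lyap le_max; apply/orP; right.
  by rewrite ler_pM2l ?powR_gt0//; exact: hT.
Qed.

End OneStep.

(** * From supermartingales to long-run behaviour *)

Section LongRun.
Context {R : realType} {d : measure_display} {Omega : measurableType d}.
Variables (P : probability Omega R) (zeta : nat -> Omega -> R * R * R).
Local Notation Z n w := (zeta n w).1.1.
Hypothesis mzeta : forall n, measurable_fun setT (zeta n).
Variables (nu z1 : R) (f : nat -> Omega -> R).
Hypotheses (z10 : 0 < z1) (mf : forall n, measurable_fun setT (f n)) (f0 : forall n w, 0 <= f n w).
Hypothesis fb : forall n w, z1 < Z n w -> 1 / 2 * Z n w `^ nu <= f n w <= 2 * Z n w `^ nu.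
Hypothesis fnext : forall n, P.-negligible
  [set w | z1 < Z n w /\ ~ (0 < Z n.+1 w /\ 1 / 2 * Z n.+1 w `^ nu <= f n.+1 w)].
Hypothesis fS : forall n H, past zeta n H -> H `<=` [set w | z1 < Z n w] ->
  (\int[P]_(w in H) (f n.+1 w)%:E <= \int[P]_(w in H) (f n w)%:E)%E.

Let mE n D : measurable_fun D (fun w => (f n w)%:E).
Proof. by apply: measurable_funTS; apply/measurable_EFinP. Qed.

Lemma negligible_small (A : set Omega) :
  (forall e : R, 0 < e -> exists2 U, measurable U & A `<=` U /\ (P U <= e%:E)%E) -> P.-negligible A.
Proof.
move=> h; have {h}/choice[U HU] : forall n : nat, exists U, measurable U /\ A `<=` U /\ (P U <= (n.+1%:R^-1)%:E)%E.
  by move=> n; have [|U mU hU] := h (n.+1%:R^-1); [rewrite invr_gt0 ltr0n|exists U].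
exists (\bigcap_n U n); split.
- by apply: bigcap_measurable => // n _; have [] := HU n.
- apply/eqP; rewrite -measure_le0; apply/lee_addgt0Pr => e e0; rewrite add0e.
  pose n := Num.bound e^-1; have [mU [_ PU]] := HU n.
  apply: le_trans (_ : (P (U n) <= _)%E).
    apply: le_measure; rewrite ?inE//; first by apply: bigcap_measurable => // k _; have [] := HU k.
    by move=> w; apply.
  apply: le_trans PU _; rewrite lee_fin -[leRHS]invrK lef_pV2 ?posrE ?invr_gt0 ?ltr0n//.
  have e1 : 0 <= e^-1 by rewrite invr_ge0 ltW.
  by apply: ltW; apply: lt_le_trans (archi_boundP e1) _; rewrite ler_nat.
- by move=> w Aw n _; have [_ [AU _]] := HU n; exact: AU.
Qed.

Lemma integral_ge_cst n (c : R) H : measurable H -> 0 <= c ->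
  P.-negligible [set w | H w /\ ~ (c <= f n w)] -> (c%:E * P H <= \int[P]_(w in H) (f n w)%:E)%E.
Proof.
move=> mH c0 N; rewrite -integral_cst//; apply: ae_ge0_le_integral => //.
- by move=> w _; rewrite lee_fin.
- by apply: negligibleS N => w h; split; apply: contrapT => h'; apply: h => ?; [|rewrite lee_fin; apply: contrapT].
Qed.

Lemma integral_le_cst n (c : R) H : measurable H -> (forall w, H w -> f n w <= c) ->
  (\int[P]_(w in H) (f n w)%:E <= c%:E * P H)%E.
Proof.
move=> mH h; rewrite -integral_cst//; apply: ge0_le_integral => //.
by move=> w _; rewrite lee_fin.
Qed.

Section Positive.
Hypothesis nu0 : 0 < nu.

(** On the event [T i] of having started below [c] and stayed beyond [z1], the integral
    of [f] stays below its initial bound, so by Markov's inequality large values of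
    [Z] have small probability, uniformly in time. *)
Lemma no_escape (m : nat) (c : R) : P.-negligible [set w | [/\ Z m w <= c,
  forall i, z1 < Z (m + i)%N w & forall r, \forall n \near \oo, r < Z n w]].
Proof.
have hz := z10; have hnu := nu0; pose T i : set Omega := [set w | Z m w <= c /\ forall k, (k <= i)%N -> z1 < Z (m + k)%N w].
have pT i : past zeta (m + i)%N (T i).
  elim: i => [|i IH].
    have := pastI (@past_itv _ _ _ zeta (m + 0) m `]-oo, c] (leq_addr _ _))
       (@past_itv _ _ _ zeta (m + 0)%N (m + 0)%N `]z1, +oo[ (leqnn _)).
    congr (past _ _ _); apply/seteqP; split => w /=; rewrite !in_itv/= andbT => -[h1 h2]; split => //.
      by move=> k; rewrite leqn0 => /eqP ->.
    exact: h2.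
  have := pastI (past_le (leqnSn _) IH) (@past_itv _ _ _ zeta (m + i).+1 (m + i).+1 `]z1, +oo[ (leqnn _)).
  rewrite -addnS; congr (past _ _ _); apply/seteqP; split => w /=; rewrite in_itv/= andbT.
    move=> [[h1 h2] h3]; split => // k; rewrite leq_eqVlt => /orP[/eqP -> //|]; exact: h2.
  by move=> [h1 h2]; split; [split => // k ki; apply: h2; exact: leqW|exact: h2].
have mT i := past_measurable mzeta (pT i).
have Tz i : T i `<=` [set w | z1 < Z (m + i)%N w] by move=> w [_]; exact.
have I0 : (\int[P]_(w in T 0%N) (f m w)%:E <= (2 * c `^ nu)%:E)%E.
  apply: le_trans (_ : ((2 * c `^ nu)%:E * P (T 0%N) <= _)%E).
    apply: integral_le_cst => // w [h1 /(_ 0%N (leqnn 0))]; rewrite addn0 => h2.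
    have /andP[_ h3] := fb h2; apply: le_trans h3 _; rewrite ler_pM2l//.
    by apply: ge0_ler_powR => //; rewrite ?nnegrE; lra.
  rewrite -[leRHS]mule1; apply: lee_wpmul2l; last exact: probability_le1.
  by rewrite lee_fin mulr_ge0 ?powR_ge0.
have In i : (\int[P]_(w in T i) (f (m + i) w)%:E <= (2 * c `^ nu)%:E)%E.
  elim: i => [|i IH]; first by rewrite addn0.
  apply: le_trans IH; rewrite addnS; apply: le_trans (fS (pT i) (Tz i)).
  apply: ge0_subset_integral => //; first by move=> w _; rewrite lee_fin.
  by move=> w [h1 h2]; split => // k ki; apply: h2; exact: leqW.
apply: negligible_small => e e0.
have [c0|cN] := ltP 0 c; last first.
  exists set0 => //; rewrite measure0 lee_fin ltW//; split => // w [h1 h2 _].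
  by have := h2 0%N; rewrite addn0; lra.
pose r := (4 * c `^ nu / e) `^ nu^-1.
have cn : 0 < c `^ nu by exact: powR_gt0.
have r0 : 0 < r by rewrite powR_gt0// divr_gt0// mulr_gt0.
have rn : r `^ nu = 4 * c `^ nu / e.
  by rewrite /r -powRrM mulVf ?gt_eqF// powRr1// divr_ge0// ?mulr_ge0// ltW.
pose X i : set Omega := T i `&` [set w | Z (m + i)%N w \in `]r, +oo[].
have mX i : measurable (X i).
  by apply: measurableI => //; apply: (past_measurable mzeta); exact: past_itv (leqnn _).
have PX i : (P (X i) <= e%:E)%E.
  have h : ((1 / 2 * r `^ nu)%:E * P (X i) <= (2 * c `^ nu)%:E)%E.
    apply: le_trans (In i); apply: le_trans (_ : (\int[P]_(w in X i) (f (m + i) w)%:E <= _)%E).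
      apply: integral_ge_cst => //; first by rewrite mulr_ge0 ?powR_ge0//; lra.
      rewrite (_ : [set w | _] = set0); first exact: negligible_set0.
      apply/seteqP; split => // w [[Tw /=]]; rewrite in_itv/= andbT => rz; apply.
      have /andP[h _] := fb (Tz _ _ Tw); apply: le_trans h; rewrite ler_pM2l; last by lra.
      by apply: ge0_ler_powR; rewrite ?nnegrE; lra.
    apply: ge0_subset_integral => //; first by move=> w _; rewrite lee_fin.
    exact: subIsetl.
  have Pf : P (X i) \is a fin_num by exact: fin_num_measure.
  move: h; rewrite -(fineK Pf) -EFinM !lee_fin rn => h.
  have e1 : 0 < e^-1 by rewrite invr_gt0.
  have : 2 * c `^ nu * (fine (P (X i)) / e) <= 2 * c `^ nu * 1 by lra.
  by rewrite ler_pM2l ?ler_pdivrMr ?mul1r//; lra.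
pose E N : set Omega := \bigcap_(i in [set i | (N <= i)%N]) X i.
have mEE N : measurable (E N) by apply: bigcap_measurable => //; exists N => /=.
have mU : measurable (\bigcup_N E N) by exact: bigcup_measurable.
exists (\bigcup_N E N) => //; split.
  move=> w [h1 h2 h3]; have [N _ HN] := h3 r.
  exists N => // i /= Ni; split; first by split => // k _; exact: h2.
  by rewrite /= in_itv/= andbT; apply: HN => /=; exact: leq_trans (leq_addl _ _).
have Einc : {homo E : n m / (n <= m)%N >-> (n <= m)%O}.
  by move=> a b ab; apply/subsetPset => w h i /= bi; apply: h => /=; exact: leq_trans bi.
apply: cvge_le (nondecreasing_cvg_mu mEE mU Einc); apply: nearW => N /=.
by apply: le_trans (PX N); apply: le_measure; rewrite ?inE// => w; apply => /=.
Qed.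

Lemma recurrent_of_supermartingale : recurrent P zeta.
Proof.
have N : P.-negligible (\bigcup_m \bigcup_c [set w | [/\ Z m w <= c%:R,
  forall i, z1 < Z (m + i)%N w & forall r, \forall n \near \oo, r < Z n w]]).
  by apply: negligible_bigcup => m; apply: negligible_bigcup => c; exact: no_escape.
apply: negligibleS N => w /negP; rewrite -leNgt leye_eq => /eqP h.
have hr r : \forall n \near \oo, r < Z n w.
  apply: contrapT => nr.
  have : (limn_einf (fun n => (Z n w)%:E) <= r%:E)%E.
    rewrite limn_einf_lim; apply: lime_le; first exact: is_cvg_einfs.
    apply: nearW => n; apply: contrapT => /negP; rewrite -ltNge => hn; apply: nr.
    exists n => // k /= nk; rewrite -lte_fin; apply: lt_le_trans hn _.
    by apply: ereal_inf_lbound; exists k.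
  by rewrite h leye_eq.
have [m _ Hm] := hr z1; exists m => //; exists (Num.bound `|Z m w|) => //; split => //.
- exact: le_trans (ler_norm _) (ltW (archi_boundP (normr_ge0 _))).
- by move=> i; apply: Hm => /=; exact: leq_addr.
Qed.

End Positive.

Section Negative.
Hypothesis nu01 : -1 < nu < 0.
Hypothesis escapeY : forall Y : R, P (\bigcap_n stays_below zeta Y n) = 0%E.

Let nu1 : 0 < nu + 1 < 1. Proof. by have h := nu01; lra. Qed.

Let powR_nu_le x y : 0 < x -> 0 < y -> (x `^ nu <= y `^ nu) = (y <= x).
Proof. by move=> x0 y0; have := powR_g1_le nu1 x0 y0; rewrite addrK. Qed.

Section Levels.
Variables (y Y : R).
Hypotheses (zy : z1 <= y) (yY : y < Y).

Local Notation below := (stays_below zeta Y).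

(** The level [Y] has been reached, and since then the process stayed above [y]. *)
Fixpoint above n : set Omega := match n with
  | 0%N => [set w | Z 0 w \in `[Y, +oo[]
  | k.+1 => (above k `&` [set w | Z k.+1 w \in `]y, +oo[])
      `|` (below k `&` [set w | Z k.+1 w \in `[Y, +oo[]) end.

Fixpoint returned n : set Omega := match n with
  | 0%N => set0
  | k.+1 => returned k `|` (above k `&` [set w | Z k.+1 w \in `]-oo, y]]) end.

Lemma past_above n : past zeta n (above n).
Proof.
elim: n => [|n IH]; first exact: past_itv.
apply: pastU; apply: pastI; first [exact: past_itv|apply: (past_le (leqnSn n))] => //.
exact: past_stays_below.
Qed.

Lemma past_returned n : past zeta n (returned n).
Proof.
elim: n => [|n IH]; first by rewrite /= -setCT; apply: pastC; exact: pastT.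
apply: pastU; first exact: (past_le (leqnSn n) IH).
by apply: pastI; [exact: (past_le (leqnSn n) (@past_above n))|exact: past_itv].
Qed.

Lemma above_gt n : above n `<=` [set w | z1 < Z n w].
Proof.
by have hz := zy; have hy := yY; case: n => [|n] w /=; [|move=> [] [_]]; rewrite in_itv/= andbT; lra.
Qed.

Lemma above_below n w : above n w -> below n w -> False.
Proof.
elim: n => [|n IH] /=; rewrite !in_itv/= !andbT.
  by move=> h1 /(_ 0%N (leqnn 0)); lra.
move=> [[h1 _] h2|[_ h1] /(_ _ (leqnn n.+1))]; last by lra.
by apply: IH h1 _ => k kn; apply: h2; exact: leqW.
Qed.

Local Notation a := (2 * Y `^ nu).
Local Notation b := (1 / 2 * y `^ nu).

(** Supermartingale argument without stopping times. Before reaching [Y] a path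
    carries the weight [2 * Y `^ nu], which bounds [f] beyond [Y] as [nu < 0];
    it then carries [f], and at its return below [y] the weight
    [1 / 2 * y `^ nu], which [f] dominates there. The total never increases. *)
Lemma returned_potential n :
  (\int[P]_(w in above n) (f n w)%:E + a%:E * P (below n) + b%:E * P (returned n) <= a%:E)%E.
Proof.
have hz := zy; have hy := yY; have y0 : 0 < y := lt_le_trans z10 zy; have Y0 : 0 < Y := lt_trans y0 yY.
have a0 : 0 <= a by rewrite mulr_ge0 ?powR_ge0.
have b0 : 0 <= b by rewrite mulr_ge0 ?powR_ge0//; lra.
have mB k := past_measurable mzeta (@past_stays_below _ _ _ zeta Y k).
have mA k := past_measurable mzeta (@past_above k).
have mR k := past_measurable mzeta (@past_returned k).
have mi k (J : interval R) : measurable [set w | Z k w \in J].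
  by apply: (past_measurable mzeta); exact: past_itv (leqnn k).
have fY k w : Y <= Z k w -> f k w <= a.
  move=> h; have zz : z1 < Z k w by lra.
  have /andP[_ h2] := fb zz; apply: le_trans h2 _; rewrite ler_pM2l// powR_nu_le//; lra.
elim: n => [|n IH].
  have -> : returned 0 = set0 by [].
  rewrite measure0 mule0 adde0.
  apply: (@le_trans _ _ (a%:E * P (above 0%N) + a%:E * P (below 0%N))%E).
    apply: leeD => //; apply: integral_le_cst; first exact: mA.
    by move=> w /=; rewrite in_itv/= andbT; exact: fY.
  rewrite -muleDr ?ge0_adde_def ?inE ?measure_ge0// -measureU//; last first.
    by apply/seteqP; split => // w [h1 h2]; exact: (@above_below 0 w).
  rewrite -[leRHS]mule1; apply: lee_wpmul2l; first by rewrite lee_fin.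
  by apply: probability_le1; exact: measurableU.
apply: le_trans IH.
set A1 := above n `&` [set w | Z n.+1 w \in `]y, +oo[].
set A2 := above n `&` [set w | Z n.+1 w \in `]-oo, y]].
set B1 := below n `&` [set w | Z n.+1 w \in `[Y, +oo[].
have [mA1 mA2 mB1] : [/\ measurable A1, measurable A2 & measurable B1].
  by split; apply: measurableI.
have EA : (\int[P]_(w in above n.+1) (f n.+1 w)%:E =
   \int[P]_(w in A1) (f n.+1 w)%:E + \int[P]_(w in B1) (f n.+1 w)%:E)%E.
  apply: ge0_integral_setU => //; first by move=> w _; rewrite lee_fin.
  by apply/disj_setPS => w [[h1 _] [h2 _]]; exact: (@above_below n w).
have EI : (\int[P]_(w in A1) (f n.+1 w)%:E + \int[P]_(w in A2) (f n.+1 w)%:E <=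
    \int[P]_(w in above n) (f n w)%:E)%E.
  apply: le_trans (fS (@past_above n) (@above_gt n)).
  rewrite -ge0_integral_setU//; last 2 first.
    by move=> w _; rewrite lee_fin.
    by apply/disj_setPS => w [[_ /= h1] [_ /= h2]]; move: h1 h2; rewrite !in_itv/= andbT; lra.
  apply: ge0_subset_integral => //; [exact: measurableU|by move=> w _; rewrite lee_fin|].
  by move=> w [[]|[]].
have E2 : (b%:E * P A2 <= \int[P]_(w in A2) (f n.+1 w)%:E)%E.
  apply: integral_ge_cst => //; apply: negligibleS (fnext n) => w [[h1 /=]].
  rewrite in_itv/= => h2 h3; split; first exact: (above_gt h1).
  move=> [p1 p2]; apply: h3; apply: le_trans p2; rewrite ler_pM2l; last by lra.
  by rewrite powR_nu_le.
have E1 : (\int[P]_(w in B1) (f n.+1 w)%:E <= a%:E * P B1)%E.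
  by apply: integral_le_cst => // w [_ /=]; rewrite in_itv/= andbT; exact: fY.
have EB : (P B1 + P (below n.+1) <= P (below n))%E.
  rewrite -measureU//; last first.
    apply/seteqP; split => // w [[_ /=]]; rewrite in_itv/= andbT => h1 /(_ _ (leqnn n.+1)); lra.
  apply: le_measure; rewrite ?inE//; first exact: measurableU.
  by move=> w [[]//|h] k kn; apply: h; exact: leqW.
have ER : (P (returned n.+1) <= P (returned n) + P A2)%E by exact: measureU2.
rewrite EA.
apply: (@le_trans _ _ (\int[P]_(w in A1) (f n.+1 w)%:E + a%:E * P B1 + a%:E * P (below n.+1) +
   (b%:E * P (returned n) + \int[P]_(w in A2) (f n.+1 w)%:E))%E).
  apply: leeD; first by rewrite leeD2r// leeD2l.
  apply: (@le_trans _ _ (b%:E * (P (returned n) + P A2))%E); first by rewrite lee_wpmul2l.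
  by rewrite ge0_muleDr ?measure_ge0// leeD2l.
rewrite (_ : (_ + _ = (\int[P]_(w in A1) (f n.+1 w)%:E + \int[P]_(w in A2) (f n.+1 w)%:E) +
   a%:E * (P B1 + P (below n.+1)) + b%:E * P (returned n))%E).
  by apply: leeD => //; apply: leeD => //; apply: lee_wpmul2l.
rewrite ge0_muleDr ?measure_ge0//.
have AC5 (u v p q r : \bar R) : (u + p + q + (r + v) = u + v + (p + q) + r)%E.
  by rewrite (addeC r) addeA -!(addeA u) (addeC v) !addeA.
exact: AC5.
Qed.

Lemma returned_le n : (P (returned n) <= (4 * Y `^ nu / y `^ nu)%:E)%E.
Proof.
have hz := zy; have hy := yY; have y0 : 0 < y := lt_le_trans z10 zy.
have yn : 0 < y `^ nu by exact: powR_gt0.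
have Yn : 0 <= Y `^ nu by exact: powR_ge0.
have h : (b%:E * P (returned n) <= a%:E)%E.
  apply: le_trans (returned_potential n); rewrite -[leLHS]add0e; apply: leeD => //.
  apply: adde_ge0; first by apply: integral_ge0 => w _; rewrite lee_fin.
  by rewrite mule_ge0// lee_fin mulr_ge0.
have Pf : P (returned n) \is a fin_num.
  by apply: fin_num_measure; exact: (past_measurable mzeta (@past_returned n)).
move: h; rewrite -(fineK Pf) -EFinM !lee_fin => h.
by rewrite ler_pdivlMr//; lra.
Qed.

Lemma frequent_below w : (forall n, exists2 k, (n <= k)%N & Z k w <= y) ->
  (exists n, returned n w) \/ forall n, below n w.
Proof.
move=> freq; have [|nr] := pselect (exists n, returned n w); [by left|right].
apply: contrapT => /existsNP[n nb].
have [m Am] : exists m, above m w.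
  elim: n nb => [|n IH] nb.
    exists 0%N; rewrite /= in_itv/= andbT; apply: contrapT => h; apply: nb => k.
    by rewrite leqn0 => /eqP ->; lra.
  have [bn|] := pselect (below n w); last exact: IH.
  exists n.+1; right; split => //=; rewrite in_itv/= andbT; apply: contrapT => h; apply: nb => k.
  rewrite leq_eqVlt => /orP[/eqP ->|]; [lra|exact: bn].
have Ai i : above (m + i)%N w.
  elim: i => [|i IH]; first by rewrite addn0.
  rewrite addnS; left; split => //=; rewrite in_itv/= andbT; apply: contrapT => h; apply: nr.
  by exists (m + i).+1; right; split => //=; rewrite in_itv/=; lra.
have [k mk hk] := freq m.+1; apply: nr; exists k.
have := Ai (k.-1 - m)%N; case: k mk hk => // k mk hk /=; rewrite subnKC// => Ak.
by right; split => //=; rewrite in_itv.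
Qed.

End Levels.

(** The probability of a return is at most a multiple of [(Y / y) `^ nu], which tends
    to 0 as [Y] grows, and [Y] is reached almost surely. *)
Lemma returned_negligible (y : R) : z1 <= y ->
  P.-negligible [set w | forall n, exists2 k, (n <= k)%N & Z k w <= y].
Proof.
move=> zy; apply: negligible_small => e e0.
have y0 : 0 < y := lt_le_trans z10 zy. have yn : 0 < y `^ nu by exact: powR_gt0.
pose A := e * y `^ nu / 4; have A0 : 0 < A by rewrite !mulr_gt0.
pose Y := Num.max (y + 1) (iroot (nu + 1) A).
have yY : y < Y by rewrite lt_max; apply/orP; left; lra.
have Y0 : 0 < Y by lra.
have YA : Y `^ nu <= A.
  have := irootK nu1 A0; rewrite addrK => <-; rewrite powR_nu_le ?iroot_gt0//.
  by rewrite le_max lexx orbT.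
have mR n := past_measurable mzeta (@past_returned y Y n).
have mB n := past_measurable mzeta (@past_stays_below _ _ _ zeta Y n).
have mUR : measurable (\bigcup_n returned y Y n) by exact: bigcup_measurable.
have mIB : measurable (\bigcap_n stays_below zeta Y n) by apply: bigcap_measurable.
exists (\bigcup_n returned y Y n `|` \bigcap_n stays_below zeta Y n); first exact: measurableU.
split.
  move=> w /(@frequent_below y Y)[[n hn]|h]; first by left; exists n.
  by right => n _; exact: h.
apply: le_trans (measureU2 _ mUR mIB) _; rewrite [X in (_ + X)%E]escapeY adde0.
have inc : {homo returned y Y : n m / (n <= m)%N >-> (n <= m)%O}.
  move=> n m /subnKC <-; elim: (m - n)%N => [|i IH]; first by rewrite addn0.
  by rewrite addnS; apply: le_trans IH _; apply/subsetPset => w; left.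
apply: cvge_le (nondecreasing_cvg_mu mR mUR inc); apply: nearW => n /=.
apply: le_trans (returned_le zy yY n) _; rewrite lee_fin ler_pdivrMr//.
by move: YA; rewrite /A; lra.
Qed.

Lemma transient_of_supermartingale : transient P zeta.
Proof.
have N : P.-negligible (\bigcup_j [set w | forall n, exists2 k, (n <= k)%N & Z k w <= z1 + j%:R]).
  by apply: negligible_bigcup => j; apply: returned_negligible; rewrite lerDl.
apply: negligibleS N => w h; apply: contrapT => h'; apply: h; apply/cvgryPgt => A.
pose j := Num.bound `|A|.
have hj : A < z1 + j%:R.
  have hz := z10; have := archi_boundP (normr_ge0 A); rewrite -/j; have := ler_norm A; lra.
apply: contrapT => nA; apply: h'; exists j => // n.
apply: contrapT => nn; apply: nA; exists n => // k /= nk; apply: lt_trans hj _.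
by rewrite ltNge; apply/negP => hk; apply: nn; exists k.
Qed.

End Negative.
End LongRun.

(** * The criterion *)

Section Criterion.
Context {R : realType} (g theta0 : R) (K : R.-pker R ~> R) (kappa : R -> R -> R)
  (mu : probability R R) (varpi : R -> R) (M : R).
Hypotheses (g01 : 0 < g < 1) (th0 : 0 < theta0 < pi / 2) (B0 : markov_on_S K)
  (B1 : hypB1 theta0 K) (B2 : hypB2 K kappa) (B3 : hypB3 K) (B4 : hypB4 K mu)
  (V : invariant_density kappa mu varpi)
  (sk : smooth_kernel theta0 M (kt kappa) (kt' kappa)).
Variable psi0 : R -> R.
Hypotheses (cpsi : CbS psi0) (peq : poisson_eq kappa psi0).
Local Notation leb := (@lebesgue_measure R).
Local Notation S := (@Sang R).
Local Notation k := (kt kappa).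
Local Notation k' := (kt' kappa).
Local Notation t := (ttan theta0).
Local Notation T := (Top (kt kappa)).
Local Notation p := (psi0 \o @clamp R).
Local Notation num := (A1 varpi psi0 + rhobar varpi 2).
Local Notation den := (gamma_den varpi psi0).

Let ubS f : ub f -> bmf S f. Proof. by apply: ub_bmf; exact: mS. Qed.
Let up : ub p. Proof. exact: ub_CbS. Qed.

(** The extended kernel depends on its first argument through [clamp], so the equation
    on [Sang] extends to the line. *)
Lemma poisson_eq_clamp x : p x - T p x = 2 * T t x.
Proof.
have Tc f : T f x = T f (clamp x).
  by apply: eq_IS => b _; rewrite /kt (clamp_id (clamp_S x)).
have /(poisson_eqP th0 B1 B2 sk cpsi) H := peq.
by have := H _ (clamp_S x); rewrite -!Tc /= clamp_id//; exact: clamp_S.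
Qed.

(** Stationarity removes the kernel from the terms in [t] and [psi0], and [A2E] turns
    the last term of [drift_source] into [A2]. *)
Lemma drift_mean nu : \int[leb]_(a in S) (varpi a * drift_source theta0 g k k' nu p a) =
  2 * (g * den - (1 - nu) * num).
Proof.
have bv : bmf S varpi by exact: (bmf_varpi th0 B1 B2 B4 V sk).
have bD : bmf S (Dop k' p) by apply: ubS; apply: (Dop_ub sk); exact: ubS.
have ut := ub_ttan th0; have ut2 := ub_ttanX th0 2.
pose c1 := 2 * (nu + g - 1); pose c2 := 4 * g + 2 * (nu - 1).
pose h b := c1 * (t b * p b) + (c2 * t b ^+ 2 + 2 * g).
have bh : bmf S h.
  by apply: ubS; apply: ubD; [apply: ubZ; exact: ubM|apply: ubD; [exact: ubZ|exact: ub_cst]].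
have bTh : bmf S (T h) by apply: ubS; exact: (Top_ub sk bh).
transitivity (\int[leb]_(a in S) (varpi a * T h a - 2 * g * (varpi a * Dop k' p a))).
  apply: eq_IS => a _; rewrite /drift_source (@eq_Top _ k _ h); first by ring.
  by move=> b _; rewrite /h /c1 /c2 /=; ring.
rewrite ISB; [|exact: bmfM|by apply: bmfZ; exact: bmfM].
rewrite (statT th0 B1 B2 B4 V sk bh) ISZ; last exact: bmfM.
rewrite -(A2E sk bv (varpi_ge0 V) (varpi_mass B4 V) (fun b Sb => varpi_inv th0 B1 B2 V Sb) cpsi).
have b1 : bmf S (fun b => varpi b * (p b * t b)) by apply: bmfM => //; apply: ubS; exact: ubM.
have b2 : bmf S (fun b => varpi b * t b ^+ 2) by apply: bmfM => //; exact: ubS.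
rewrite (eq_IS (g := fun b => c1 * (varpi b * (p b * t b)) +
   (c2 * (varpi b * t b ^+ 2) + 2 * g * varpi b))); last by move=> b _; rewrite /h; ring.
rewrite ISD; [|exact: bmfZ|by apply: bmfD; exact: bmfZ].
rewrite ISD; [|exact: bmfZ|exact: bmfZ].
rewrite !ISZ// (varpi_mass B4 V) -(A1E th0 B1 B2 V sk) -(rhobarE th0 B1 B2 V sk).
by rewrite /gamma_den /c1 /c2; ring.
Qed.

(** The second corrector exists because [drift_source] minus its mean has mean zero. *)
Lemma lyapunov_exists nu : nu * (g * den - (1 - nu) * num) < 0 ->
  exists psi1 z1, [/\ ub psi1, 0 < z1 & forall z, z1 < z -> let w := z `^ (g - 1) in
  [/\ narrow theta0 w,
      forall x y, 1 / 2 <= Lyap nu w (p x) (psi1 y) <= 2,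
      forall b, 1 / 2 * expR (nu * (w * vw theta0 g w b)) <= Lyap_next theta0 g nu p psi1 w b &
      forall a, T (Lyap_next theta0 g nu p psi1 w) a <= Lyap nu w (p a) (psi1 a)]].
Proof.
move=> neg; have bv : bmf S varpi by exact: (bmf_varpi th0 B1 B2 B4 V sk).
have ut := ub_ttan th0; have ut2 := ub_ttanX th0 2.
pose Bbar := 2 * (g * den - (1 - nu) * num).
have uds : ub (drift_source theta0 g k k' nu p).
  apply: ubB; last by apply: ubZ; apply: (Dop_ub sk); exact: ubS.
  apply: (Top_ub sk); apply: ubS; apply: ubD; last by apply: ubZ; exact: ubM.
  apply: ubD; last exact: ubZ.
  by apply: ubZ; apply: ubD; [exact: ub_cst|exact: ubZ].
have um : ub (fun a => drift_source theta0 g k k' nu p a - Bbar).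
  by apply: ubB => //; exact: ub_cst.
have m0 : \int[leb]_(a in S) (varpi a * (drift_source theta0 g k k' nu p a - Bbar)) = 0.
  rewrite (eq_IS (g := fun a => varpi a * drift_source theta0 g k k' nu p a - Bbar * varpi a)); last first.
    by move=> a _; ring.
  rewrite ISB; [|by apply: bmfM => //; exact: ubS|exact: bmfZ].
  by rewrite ISZ// drift_mean (varpi_mass B4 V) mulr1 subrr.
have [psi1 upsi1 psi1E] := poisson_of th0 B1 B2 B4 V sk um m0.
have nB : nu * Bbar < 0 by rewrite /Bbar; lra.
have [w0 w00 Hw] := lyap_supermartingale g01 th0 sk up upsi1 poisson_eq_clamp psi1E nB.
exists psi1, (iroot g w0); split => //; first exact: iroot_gt0.
move=> z hz w; have i0 := iroot_gt0 g w00; have z0 : 0 < z by exact: lt_trans hz.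
apply: Hw; rewrite powR_gt0//= -(irootK g01 w00) powR_g1_le//; exact: ltW.
Qed.

Section Process.
Context {d : measure_display} {Omega : measurableType d}.
Variables (P : probability Omega R) (zeta : nat -> Omega -> R * R * R) (beta : nat -> Omega -> R).
Hypothesis CP : collisions_process g theta0 K P zeta beta.

(** As [g * den < num], the averaged drift is still negative for small [nu > 0]. *)
Lemma recurrent_criterion : 0 <= num -> g * den < num -> recurrent P zeta.
Proof.
move=> n0 lt; pose nu := (num - g * den) / (2 * (num + 1)).
have nu0 : 0 < nu by rewrite divr_gt0//; lra.
have nuE : nu * (2 * (num + 1)) = num - g * den by rewrite divfK// gt_eqF//; lra.
have neg : nu * (g * den - (1 - nu) * num) < 0 by rewrite pmulr_rlt0//; nra.
have [psi1 [z1 [upsi1 z10 H]]] := lyapunov_exists neg.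
apply: (@recurrent_of_supermartingale _ _ _ P zeta (zeta_measurable CP) nu z1
  (fun n w => flyap g nu p psi1 (zeta n w))) => //.
- move=> n; exact: (measurableT_comp (measurable_flyap g nu up upsi1) (zeta_measurable CP n)).
- by move=> n w; rewrite le_max lexx.
- exact: (flyap_bounds z10 H).
- by move=> n H' pH' Hz; exact: (flyap_supermartingale g01 th0 B0 B1 B2 sk CP up upsi1 z10 H pH' Hz).
Qed.

(** As [num < g * den], the averaged drift is positive for small [nu < 0], so the
    bounded function of order [z `^ nu] decreases on average. *)
Lemma transient_criterion : 0 <= num -> num < g * den -> transient P zeta.
Proof.
move=> n0 lt; pose m := Num.min (1 / 2) ((g * den - num) / (2 * (num + 1))).
have m0 : 0 < m by rewrite lt_min; apply/andP; split; [lra|rewrite divr_gt0//; lra].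
have m1 : m <= 1 / 2 by rewrite ge_min lexx.
have m2 : m * (2 * (num + 1)) <= g * den - num.
  by rewrite -ler_pdivlMr; [rewrite ge_min lexx orbT|lra].
have neg : - m * (g * den - (1 - - m) * num) < 0.
  by rewrite mulNr oppr_lt0 mulr_gt0//; nra.
have [psi1 [z1 [upsi1 z10 H]]] := lyapunov_exists neg.
apply: (@transient_of_supermartingale _ _ _ P zeta (zeta_measurable CP) (- m) z1
  (fun n w => flyap g (- m) p psi1 (zeta n w))) => //.
- move=> n; exact: (measurableT_comp (measurable_flyap g (- m) up upsi1) (zeta_measurable CP n)).
- by move=> n w; rewrite le_max lexx.
- exact: (flyap_bounds z10 H).
- move=> n; apply: negligibleS (flyap_next g01 th0 B0 B1 B2 CP z10 H n) => w [zz h].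
  by split => // -[h1 h2 _]; exact: h.
- by move=> n H' pH' Hz; exact: (flyap_supermartingale g01 th0 B0 B1 B2 sk CP up upsi1 z10 H pH' Hz).
- by lra.
- exact: (escape g01 th0 B0 B1 B2 B3 CP).
Qed.

End Process.

Lemma gamma_c_range : 0 <= num -> 0 <= den -> 0 <= gamma_c varpi psi0 <= 1.
Proof.
move=> n0 d0; rewrite /gamma_c; case: ifPn => _; first by rewrite ler01 lexx.
by rewrite le_min ler01 andbT ge_min lexx orbT divr_ge0.
Qed.

Lemma lt_gamma_c : 0 <= den -> 0 < Num.max num den ->
  g < gamma_c varpi psi0 -> g * den < num.
Proof.
move=> d0 mx; rewrite /gamma_c; case: ifPn => [/eqP e _|dn0].
  by move: mx; rewrite e mulr0 lt_max ltxx orbF.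
by rewrite lt_min => /andP[h _]; rewrite -ltr_pdivlMr// lt_def dn0.
Qed.

Lemma gamma_c_lt : 0 <= den -> gamma_c varpi psi0 < g -> num < g * den.
Proof.
have /andP[_ g1] := g01; move=> d0; rewrite /gamma_c; case: ifPn => [_|dn0]; first by lra.
rewrite gt_min => /orP[h|]; last by lra.
by rewrite -ltr_pdivrMr// lt_def dn0.
Qed.

End Criterion.

Theorem theorem3p4 (R : realType) (gamma theta0 : R)
    (K : R.-pker R ~> R) (kappa : R -> R -> R)
    (mu : probability R R) (varpi : R -> R) :
  0 < gamma < 1 -> 0 < theta0 < pi / 2 ->
  markov_on_S K ->
  hypB1 theta0 K -> hypB2 K kappa -> hypB3 K -> hypB4 K mu ->
  invariant_density kappa mu varpi -> hypB5 kappa ->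
  rhobar varpi 1 = 0 ->
  [/\ exists psi0 : R -> R,
        [/\ CbS psi0, poisson_eq kappa psi0 &
          forall phi, CbS phi -> poisson_eq kappa phi ->
            exists c : R, forall alpha, Sang alpha -> phi alpha = psi0 alpha + c],
      forall psi0 : R -> R, CbS psi0 -> poisson_eq kappa psi0 ->
        0 <= A1 varpi psi0 + rhobar varpi 2 /\
        (0 <= 1 + A1 varpi psi0 - A2 varpi psi0 + 2 * rhobar varpi 2 ->
         0 < Num.max (A1 varpi psi0 + rhobar varpi 2)
               (1 + A1 varpi psi0 - A2 varpi psi0 + 2 * rhobar varpi 2) ->
         0 <= gamma_c varpi psi0 <= 1 /\
         forall (d : measure_display) (Omega : measurableType d)
           (P : probability Omega R) (zeta : nat -> Omega -> R * R * R)
           (beta : nat -> Omega -> R),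
           collisions_process gamma theta0 K P zeta beta ->
           (gamma_c varpi psi0 < gamma -> transient P zeta) /\
           (gamma < gamma_c varpi psi0 -> recurrent P zeta)) &
      uniformly_ergodic K mu ->
        let psi0 := fun alpha : R => 2 * limn (series (psi_term K kappa alpha)) in
        [/\ forall alpha, Sang alpha ->
              [/\ cvgn (series (psi_term K kappa alpha)),
                  cvgn (series (tan_term K alpha)) &
                  psi0 alpha = 2 * limn (series (tan_term K alpha))],
            CbS psi0 & poisson_eq kappa psi0]].
Proof.
move=> g01 th0 B0 B1 B2 B3 B4 V B5 rho1.
have [M sk] := smooth_kernel_exists th0 B0 B1 B2 B5.
split.
- exact: (poisson_eq_solvable th0 B1 B2 B4 V sk rho1).
- move=> psi0 cpsi peq; have num0 := A1_rho2_ge0 th0 B1 B2 B4 V sk cpsi peq.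
  split=> // den0 mx; split; first exact: gamma_c_range.
  move=> d Omega P zeta beta CP; split=> h.
    by apply: (transient_criterion g01 th0 B0 B1 B2 B3 B4 V sk cpsi peq CP num0); exact: gamma_c_lt.
  by apply: (recurrent_criterion g01 th0 B0 B1 B2 B4 V sk cpsi peq CP num0); exact: lt_gamma_c.
- exact: (poisson_eq_series th0 B0 B1 B2 B4 V sk rho1).
Qed.
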